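(* Let $\tau=\frac{-b+\sqrt{-d}}{2a}$ where $a,b,c$ are mutually coprime integers with $a>0$, $a\tau^2+b\tau+c=0$ and $-d=b^2-4ac$, and suppose $\tau$ lies in $C_{1/w,\infty}$. Then $$\frac{F^2}{6}\left[\frac{u+3}{u+1}-\frac{u^2+18u-27}{(u-9)(u+1)}s_2(\tau)\right]-w\frac{d}{dw}F^2=\frac{a}{\pi\sqrt{d}}\,\frac{u-1}{u+1},$$ where $w=w(\tau)$, $u=u(\tau)$, $F={}_2F_1\!\left(\frac16,\frac13;1;\frac1w\right)$, and $\frac{d}{dw}F^2$ denotes the derivative of $x\mapsto{}_2F_1(\frac16,\frac13;1;\frac1x)^2$ evaluated at $x=w(\tau)$.
   Context: $\mathfrak H$ is the upper half-plane, $q=e^{2\pi i\tau}$, $E_2=1-24\sum_{n\ge1}n\frac{q^n}{1-q^n}$, $E_4=1+240\sum_{n\ge1}n^3\frac{q^n}{1-q^n}$, $E_6=1-504\sum_{n\ge1}n^5\frac{q^n}{1-q^n}$, $E_2^*(\tau)=E_2(\tau)-\frac{3}{\pi\mathrm{Im}(\tau)}$, $s_2(\tau)=\frac{E_4(\tau)}{E_6(\tau)}E_2^*(\tau)$. ${}_2F_1$ is the Gauss hypergeometric function. $u(\tau)=-\frac{1}{27}\left(\frac{\eta(\tau)}{\eta(3\tau)}\right)^{12}$ ($\eta$ the Dedekind eta function) is the Hauptmodul of $\Gamma_0(3)$ and $w(\tau)=\frac{(\eta(\tau)^{12}+27\eta(3\tau)^{12})^2}{108\,\eta(\tau)^{12}\eta(3\tau)^{12}}$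 is the Hauptmodul of $\Gamma_0^+(3)$; they satisfy $w=-\frac{(1-u)^2}{4u}$. With $\mathcal{F}_{3A}=\{z\in\mathfrak{H}:|z|^2>1/3,|\mathrm{Re}(z)|<1/2\}$, $C_{1/w,\infty}$ is the connected component of $\{\tau\in\mathcal F_{3A}:|1/w(\tau)|<1\}$ whose closure contains the cusp $\infty$ (i.e. containing points of arbitrarily large imaginary part). *)

(* Defs.v *)
(* MathComp-Analysis. The complex numbers are R[i] for an arbitrary
   R : realType; R[i]^o is the same type, carrying the topology of the complex
   modulus that limits, derivatives and connectedness refer to. *)
From mathcomp Require Import all_boot all_order all_algebra.
From mathcomp Require Import all_classical all_reals all_analysis.
From mathcomp Require Import complex.

Set Implicit Arguments.
Unset Strict Implicit.
Unset Printing Implicit Defensive.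

Import Order.TTheory GRing.Theory Num.Theory.
Import numFieldNormedType.Exports.

Local Open Scope classical_set_scope.
Local Open Scope complex_scope.
Local Open Scope ring_scope.

Definition cexp (R : realType) (z : R[i]) : R[i] :=
  (expR (complex.Re z))%:C *
  (cos (complex.Im z) +i* sin (complex.Im z)).

(* cexp2pi z = e^(2 pi i z); the nome of tau is q = cexp2pi tau, and
   cexp2pi (tau / 24) is the branch of q^(1/24) used in the eta function. *)
Definition cexp2pi (R : realType) (z : R[i]) : R[i] :=
  cexp ((2 * pi)%:C * 'i%C * z).

Definition lambert (R : realType) (k : nat) (q : R[i]) : R[i] :=
  (\big[+%R/0]_(1 <= n <oo) (n%:R ^+ k * (q ^+ n / (1 - q ^+ n)) : R[i]^o)).

Definition E2 (R : realType) (tau : R[i]) : R[i] :=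
  1 - 24 * lambert 1 (cexp2pi tau).

Definition E4 (R : realType) (tau : R[i]) : R[i] :=
  1 + 240 * lambert 3 (cexp2pi tau).

Definition E6 (R : realType) (tau : R[i]) : R[i] :=
  1 - 504 * lambert 5 (cexp2pi tau).

Definition E2star (R : realType) (tau : R[i]) : R[i] :=
  E2 tau - (3 / (pi * complex.Im tau))%:C.

Definition s2 (R : realType) (tau : R[i]) : R[i] :=
  E4 tau / E6 tau * E2star tau.

Definition eta (R : realType) (tau : R[i]) : R[i] :=
  cexp2pi (tau / 24) *
  (\big[*%R/1]_(1 <= n <oo) (1 - cexp2pi tau ^+ n : R[i]^o)).

Definition u3 (R : realType) (tau : R[i]) : R[i] :=
  - (1 / 27) * (eta tau / eta (3 * tau)) ^+ 12.

Definition w3 (R : realType) (tau : R[i]) : R[i] :=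
  (eta tau ^+ 12 + 27 * eta (3 * tau) ^+ 12) ^+ 2 /
  (108 * eta tau ^+ 12 * eta (3 * tau) ^+ 12).

Definition pochhammer (R : realType) (a : R[i]) (n : nat) : R[i] :=
  \prod_(k < n) (a + k%:R).

(* The Gauss series; only meaningful where it converges, e.g. for |z| < 1. *)
Definition hyp2F1 (R : realType) (a b c z : R[i]) : R[i] :=
  (\big[+%R/0]_(0 <= n <oo)
     (pochhammer a n * pochhammer b n / (pochhammer c n * n`!%:R) * z ^+ n
      : R[i]^o)).

Definition F3A (R : realType) : set R[i]^o :=
  [set z : R[i] | [/\ 0 < complex.Im z, 1 / 3 < `|z| ^+ 2
                    & `|complex.Re z| < 1 / 2] ].

Definition invw_disc (R : realType) : set R[i]^o :=
  [set tau : R[i] | F3A tau /\ `|1 / w3 tau| < 1].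

(* The points whose connected component in invw_disc has points of arbitrarily
   large imaginary part.  connected_component A x is empty for x outside A, so
   this is a subset of invw_disc. *)
Definition C_invw_oo (R : realType) : set R[i]^o :=
  [set tau : R[i] | forall M : R,
     exists2 z : R[i], connected_component (@invw_disc R) tau z
                     & M < complex.Im z].

(* Main.v *)
(* Write q = e^(2 pi i tau), D = q d/dq, s = -1/u, x = 1/w = 4s/(1+s)^2, and let
   a be the weight one theta series of level 3 and b = eta(tau)^9/eta(3 tau)^3.
   Then a^3 = b(1+s), E4 = 9a^4 - 8ab, E6 = 36a^3 b - 27a^6 - 8b^2, D s = a^2 s and
   12 D a = a E2 - 4b + 3a^3, all consequences of five convolution identities
   for divisor sums.  With them the hypergeometric equation for F says that
   k = F(x(tau))/a(tau) satisfies D^2 k = 0.  On the component of the disc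
   |x| < 1 that reaches the cusp, Dk is therefore constant; it tends to 0 and k
   tends to 1 at the cusp, so F(x) = a and D F(x) = D a there, and the formula
   becomes an identity between a, b, s, E2 and E2*, in which
   a/(pi sqrt d) = 1/(2 pi Im tau).

   The quotient s2 and the factor u - 9 force a look at the zeros of E4 and E6 in
   F_3A: E4 has none, so u <> 9 and s <> -1, and at a zero of E6 (where s2 is 0 by
   convention) E2* vanishes too.  Both follow from the transformation laws under
   tau -> -1/tau, obtained for E4 and E6 from partial fractions of
   sum n^(k-1) q^n and for E2 by differentiating the law of E4, together with
   the uniqueness of the zero of E4 and of E6 in the disc |q| <= 1/146. *)

Require Import Defs.
From HB Require Import structures.
From mathcomp Require Import all_boot all_order all_algebra.
From mathcomp Require Import all_classical all_reals all_analysis.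
From mathcomp Require Import complex.
From mathcomp Require Import ring lra zify.

Set Implicit Arguments.
Unset Strict Implicit.
Unset Printing Implicit Defensive.

Import Order.TTheory GRing.Theory Num.Theory.
Import numFieldNormedType.Exports.

Local Open Scope classical_set_scope.
Local Open Scope complex_scope.
Local Open Scope ring_scope.

(** * Liouville's identity *)

(** Relations between the level 3 series are proved on coefficients, not by dimensions of spaces of
    modular forms: two formal series solving the same equation u Dy = c y agree as soon as finitely
    many of their coefficients do. Evaluation at q is a ring morphism on series of radius at least 1
    and turns D into (1/2 pi i) d/dtau, so each relation carries over to the upper half-plane. There
    is a reason for D^2 k = 0: pulled back along x, the solutions of the hypergeometric equation are
    a(tau) times affine functions of tau, so k = F(x)/a is locally affine in tau. The slope is the
    contribution of the logarithmic solution; the cusp kills it, but only on the component that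
    reaches the cusp, hence the open-and-closed argument there. Zeros of E4 and E6 are located
    without contour integrals: at heights from sqrt 3/2 on the nome is so small that the sum of
    sigma_k(n) q^n is injective in q, so a zero has the nome of the zero forced by a fixed point,
    namely rho for E4 and i for E6. *)

Definition box (n : nat) : seq (nat * nat) :=
  [seq (a, x) | a <- iota 1 n, x <- iota 1 n].

Lemma mem_box n p : (p \in box n) = [&& 0 < p.1 <= n & 0 < p.2 <= n]%N.
Proof.
apply/allpairsP/idP => [[[a x] /= [ha hx ->]]|].
  by move: ha hx; rewrite !mem_iota /=; lia.
by case: p => a x /= h; exists (a, x); split=> //=; rewrite mem_iota; lia.
Qed.

Lemma box_uniq n : uniq (box n).
Proof.
by apply: allpairs_uniq; rewrite ?iota_uniq // => p r _ _; case: p; case: r.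
Qed.

(* ((a, x), (b, y)) stands for the solution a x + b y = n. *)
Definition quads (n : nat) : seq ((nat * nat) * (nat * nat)) :=
  [seq t <- [seq (p, r) | p <- box n, r <- box n]
     | (t.1.1 * t.1.2 + t.2.1 * t.2.2 == n)%N].

Lemma mem_quads n t : (t \in quads n) =
  [&& 0 < t.1.1, 0 < t.1.2, 0 < t.2.1, 0 < t.2.2
    & t.1.1 * t.1.2 + t.2.1 * t.2.2 == n]%N.
Proof.
rewrite mem_filter; case: t => -[a x] [b y] /=.
apply/andP/idP => [[e /allpairsP[[p r] /= [hp hr epr]]]|].
  case: p r hp hr epr => p1 p2 [r1 r2]; rewrite !mem_box => + + [] /= ? ? ? ?; subst.
  by move=> /= h1 h2; rewrite e; lia.
case/and5P => a0 x0 b0 y0 e; split=> //.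
apply/allpairsP; exists ((a, x), (b, y)); split=> //=; rewrite mem_box /=; nia.
Qed.

Lemma quads_uniq n : uniq (quads n).
Proof.
apply: filter_uniq; apply: allpairs_uniq; rewrite ?box_uniq // => p r _ _.
by case: p; case: r.
Qed.

Lemma sum_seq_bij (V : nmodType) (T U : eqType) (r : seq T) (r' : seq U)
    (P : pred T) (Q : pred U) (h : T -> U) (h' : U -> T) (F : U -> V) :
  uniq r -> uniq r' ->
  (forall t, t \in r -> P t -> [/\ h t \in r', Q (h t) & h' (h t) = t]) ->
  (forall t, t \in r' -> Q t -> [/\ h' t \in r, P (h' t) & h (h' t) = t]) ->
  \sum_(t <- r' | Q t) F t = \sum_(t <- r | P t) F (h t).
Proof.
move=> ur ur' hh hh'; rewrite -big_filter -[RHS]big_filter -(big_map h predT).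
apply: perm_big; apply: uniq_perm; first exact: filter_uniq.
- rewrite map_inj_in_uniq ?filter_uniq // => t1 t2.
  rewrite !mem_filter => /andP[P1 r1] /andP[P2 r2] e.
  by have [_ _ <-] := hh _ r1 P1; have [_ _ <-] := hh _ r2 P2; rewrite e.
- move=> t; rewrite mem_filter; apply/andP/mapP => [[Qt rt]|[t0]].
    by have [r0 P0 <-] := hh' _ rt Qt; exists (h' t) => //; rewrite mem_filter P0.
  by rewrite mem_filter => /andP[P0 r0] ->; have [] := hh _ r0 P0.
Qed.

Section QuadIdentity.
Variable (V : comNzRingType) (n : nat).
Implicit Types s d : nat -> nat -> V.

Let tot s := \sum_(t <- quads n) s t.1.1 t.2.1.
Let xgt s := \sum_(t <- quads n | (t.2.2 < t.1.2)%N) s t.1.1 t.2.1.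
Let bgt s := \sum_(t <- quads n | (t.1.1 < t.2.1)%N) s t.1.1 t.2.1.
Let xeq s := \sum_(t <- quads n | t.1.2 == t.2.2) s t.1.1 t.2.1.
Let aeq s := \sum_(t <- quads n | t.1.1 == t.2.1) s t.1.1 t.2.1.

Let swap (t : (nat * nat) * (nat * nat)) := (t.2, t.1).

Let tot_x s : (forall a b, s a b = s b a) -> tot s = xgt s + xgt s + xeq s.
Proof.
move=> sC; rewrite /tot (bigID (fun t => t.2.2 < t.1.2)%N) /= -addrA; congr +%R.
rewrite (bigID (fun t => t.1.2 < t.2.2)%N) /=; congr +%R.
  symmetry; rewrite /xgt (@sum_seq_bij _ _ _ (quads n) (quads n)
    (fun t => ~~ (t.2.2 < t.1.2) && (t.1.2 < t.2.2))%N _ swap swap) ?quads_uniq //.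
  - by apply: eq_bigr => t _; rewrite sC.
  - by case=> -[a x] [b y]; rewrite !mem_quads /= => h1 h2; split=> //; lia.
  - by case=> -[a x] [b y]; rewrite !mem_quads /= => h1 h2; split=> //; lia.
by apply: eq_bigl => t; lia.
Qed.

Let tot_a s : (forall a b, s a b = s b a) -> tot s = bgt s + bgt s + aeq s.
Proof.
move=> sC; rewrite /tot (bigID (fun t => t.1.1 < t.2.1)%N) /= -addrA; congr +%R.
rewrite (bigID (fun t => t.2.1 < t.1.1)%N) /=; congr +%R.
  symmetry; rewrite /bgt (@sum_seq_bij _ _ _ (quads n) (quads n)
    (fun t => ~~ (t.1.1 < t.2.1) && (t.2.1 < t.1.1))%N _ swap swap) ?quads_uniq //.
  - by apply: eq_bigr => t _; rewrite sC.
  - by case=> -[a x] [b y]; rewrite !mem_quads /= => h1 h2; split=> //; lia.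
  - by case=> -[a x] [b y]; rewrite !mem_quads /= => h1 h2; split=> //; lia.
by apply: eq_bigl => t; lia.
Qed.

(* a x + b y = a (x - y) + (a + b) y *)
Let xgt_bgt s : xgt s = bgt (fun a b => s a (b - a)%N).
Proof.
symmetry.
rewrite /bgt (@sum_seq_bij _ _ _ (quads n) (quads n)
  (fun t => t.2.2 < t.1.2)%N _
  (fun t => ((t.1.1, t.1.2 - t.2.2), (t.1.1 + t.2.1, t.2.2))%N)
  (fun t => ((t.1.1, t.1.2 + t.2.2), (t.2.1 - t.1.1, t.2.2))%N)) ?quads_uniq //.
- by apply: eq_bigr => t _ /=; rewrite addKn.
- case=> -[a x] [b y]; rewrite !mem_quads /= => h1 h2.
  by split; [nia | lia | rewrite addKn subnK // ltnW].
- case=> -[a x] [b y]; rewrite !mem_quads /= => h1 h2.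
  by split; [nia | lia | rewrite addnK subnKC // ltnW].
Qed.

(** By symmetry the full sum of s is twice its part with x > y plus the diagonal x = y, and also
    twice its part with a < b plus the diagonal a = b. The bijection behind [xgt_bgt] turns the part
    x > y into a sum of s(a, b - a) over a < b, so the sum of d over a < b is half the difference of
    the two diagonals of s. *)
Lemma quad_identity s d :
  (forall a b, s a b = s b a) -> (forall a b, d a b = d b a) ->
  (forall a b, (0 < a)%N -> (a < b)%N -> d a b = s a b - s a (b - a)%N) ->
  \sum_(t <- quads n) d t.1.1 t.2.1 =
  \sum_(t <- quads n | t.1.2 == t.2.2) s t.1.1 t.2.1
  - \sum_(t <- quads n | t.1.1 == t.2.1) s t.1.1 t.2.1
  + \sum_(t <- quads n | t.1.1 == t.2.1) d t.1.1 t.2.1.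
Proof.
move=> sC dC sd; rewrite -/(tot d) -/(xeq s) -/(aeq s) -/(aeq d) tot_a //.
have -> : bgt d = bgt s - xgt s.
  rewrite xgt_bgt /bgt -sumrB big_seq_cond [RHS]big_seq_cond.
  by apply: eq_bigr => t /andP[]; rewrite mem_quads => /andP[t0 _] ?; exact: sd.
have := tot_x sC; rewrite tot_a // => /eqP; rewrite -subr_eq0 => /eqP e.
(* The first bracket is the difference of the two expansions of [tot s], hence zero; only the
   diagonals survive. *)
have -> : bgt s - xgt s + (bgt s - xgt s)
   = (bgt s + bgt s + aeq s - (xgt s + xgt s + xeq s)) + (xeq s - aeq s).
  by ring.
by rewrite e add0r.
Qed.
End QuadIdentity.

(** * Formal power series *)

(** A separate name for coefficient sequences, so that they can carry the Cauchy product: [ring]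
    then closes identities between q-series, while a coefficient is still read off by
    application. *)
Definition fps (K : Type) := nat -> K.

HB.instance Definition _ (K : Type) := gen_eqMixin (fps K).
HB.instance Definition _ (K : Type) := gen_choiceMixin (fps K).

Section FpsRing.
Variable K : comNzRingType.
Implicit Types f g h : fps K.

Definition fps_add f g : fps K := fun n => f n + g n.
Definition fps_opp f : fps K := fun n => - f n.
Definition fps_mul f g : fps K := fun n => \sum_(i < n.+1) f i * g (n - i)%N.
Definition fps_zero : fps K := fun=> 0.
Definition fps_one : fps K := fun n => (n == 0%N)%:R.

Let addA : associative fps_add.
Proof. by move=> f g h; apply/funext => n; rewrite /fps_add addrA. Qed.
Let addC : commutative fps_add.
Proof. by move=> f g; apply/funext => n; rewrite /fps_add addrC. Qed.
Let add0 : left_id fps_zero fps_add.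
Proof. by move=> f; apply/funext => n; rewrite /fps_add add0r. Qed.
Let addN : left_inverse fps_zero fps_opp fps_add.
Proof. by move=> f; apply/funext => n; rewrite /fps_add addNr. Qed.

HB.instance Definition _ := GRing.isZmodule.Build (fps K) addA addC add0 addN.

(** A coefficient of index below N of a product only sees these truncations, so commutativity and
    associativity of the Cauchy product are inherited from polynomials. *)
Let trunc N f : {poly K} := \poly_(i < N) f i.

Let fps_mulE N f g n : (n < N)%N -> fps_mul f g n = (trunc N f * trunc N g)`_n.
Proof.
move=> nN; rewrite coefM; apply: eq_bigr => i _; rewrite !coef_poly.
by rewrite !ifT //; [lia | case: i => i /= ?; lia].
Qed.

Let mulC : commutative fps_mul.
Proof.
by move=> f g; apply/funext => n; rewrite !(@fps_mulE n.+1) // mulrC.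
Qed.

Let mulA : associative fps_mul.
Proof.
move=> f g h; apply/funext => n.
have e u v m i : (i <= m)%N -> (trunc m.+1 (fps_mul u v))`_i = (trunc m.+1 u * trunc m.+1 v)`_i.
  by move=> im; rewrite coef_poly ltnS im (@fps_mulE m.+1).
rewrite !(@fps_mulE n.+1) // coefM [RHS]coefM.
transitivity ((trunc n.+1 f * (trunc n.+1 g * trunc n.+1 h))`_n).
  by rewrite coefM; apply: eq_bigr => i _; rewrite e // leq_subr.
by rewrite mulrA coefM; apply: eq_bigr => i _; rewrite e // -ltnS.
Qed.

Let mul1 : left_id fps_one fps_mul.
Proof.
move=> f; apply/funext => n; rewrite /fps_mul big_ord_recl /= subn0 mul1r.
by rewrite big1 ?addr0 // => i _; rewrite mul0r.
Qed.

Let mulD : left_distributive fps_mul fps_add.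
Proof.
move=> f g h; apply/funext => n; rewrite /fps_mul /fps_add -big_split.
by apply: eq_bigr => i _; rewrite mulrDl.
Qed.

Let one_neq0 : fps_one != fps_zero.
Proof.
by apply/eqP => /(congr1 (fun f => f 0%N)) /eqP; rewrite /fps_one /fps_zero oner_eq0.
Qed.

HB.instance Definition _ :=
  GRing.Zmodule_isComNzRing.Build (fps K) mulA mulC mul1 mulD one_neq0.

Lemma fpsD f g n : (f + g) n = f n + g n. Proof. by []. Qed.
Lemma fpsN f n : (- f) n = - f n. Proof. by []. Qed.
Lemma fpsB f g n : (f - g) n = f n - g n. Proof. by []. Qed.
Lemma fps0 n : (0 : fps K) n = 0. Proof. by []. Qed.
Lemma fps1 n : (1 : fps K) n = (n == 0%N)%:R. Proof. by []. Qed.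
Lemma fpsM f g n : (f * g) n = \sum_(i < n.+1) f i * g (n - i)%N.
Proof. by []. Qed.

Lemma fps_sum (I : Type) (r : seq I) (P : pred I) (F : I -> fps K) n :
  (\sum_(i <- r | P i) F i) n = \sum_(i <- r | P i) F i n.
Proof. by elim/big_rec2: _ => // i x y _ <-. Qed.

Lemma fps_nat k n : (k%:R : fps K) n = if n == 0%N then k%:R else 0.
Proof.
elim: k => [|k ih]; first by rewrite if_same.
by rewrite !mulrSr fpsD ih fps1; case: ifP; rewrite ?addr0.
Qed.

Lemma fpsMn k f n : (k%:R * f) n = k%:R * f n.
Proof.
rewrite fpsM big_ord_recl /= fps_nat subn0 big1 ?addr0 // => i _.
by rewrite fps_nat mul0r.
Qed.

Lemma fpsM0 f g : (f * g) 0%N = f 0%N * g 0%N.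
Proof. by rewrite fpsM big_ord_recl big_ord0 addr0. Qed.

Lemma fpsM1 f g : (f * g) 1%N = f 0%N * g 1%N + f 1%N * g 0%N.
Proof. by rewrite fpsM !big_ord_recl big_ord0 addr0. Qed.

Lemma fpsX0 f k : (f ^+ k) 0%N = f 0%N ^+ k.
Proof. by elim: k => // k ih; rewrite !exprS fpsM0 ih. Qed.

Lemma fpsX1 f k : (f ^+ k) 1%N = k%:R * f 0%N ^+ k.-1 * f 1%N.
Proof.
elim: k => [|k ih]; first by rewrite expr0 !mul0r.
rewrite exprS fpsM1 ih fpsX0; case: k {ih} => [|k] /=; first by rewrite !expr0; ring.
by rewrite exprS; ring.
Qed.

(** The derivation q d/dq, which becomes (1/2 pi i) d/dtau under q = e^(2 pi i tau). *)
Definition dq f : fps K := fun n => n%:R * f n.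

Lemma dqD f g : dq (f + g) = dq f + dq g.
Proof. by apply/funext => n; rewrite /dq !fpsD mulrDr. Qed.
Lemma dqN f : dq (- f) = - dq f.
Proof. by apply/funext => n; rewrite /dq !fpsN mulrN. Qed.
Lemma dqB f g : dq (f - g) = dq f - dq g.
Proof. by rewrite dqD dqN. Qed.
Lemma dqM f g : dq (f * g) = dq f * g + f * dq g.
Proof.
apply/funext => n; rewrite /dq fpsD !fpsM mulr_sumr -big_split /=.
apply: eq_bigr => -[i /=] ilt _.
have -> : n%:R = i%:R + (n - i)%:R :> K by rewrite -natrD subnKC.
by ring.
Qed.
Lemma dq_nat k : dq k%:R = 0.
Proof.
by apply/funext => n; rewrite /dq fps_nat; case: eqP => [->|]; rewrite ?mul0r ?mulr0.
Qed.
Lemma dq1 : dq 1 = 0. Proof. exact: (dq_nat 1). Qed.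
Lemma dqMn k f : dq (k%:R * f) = k%:R * dq f.
Proof. by rewrite dqM dq_nat mul0r add0r. Qed.
Lemma dqX f k : dq (f ^+ k) = k%:R * f ^+ k.-1 * dq f.
Proof.
elim: k => [|k ih]; first by rewrite expr0 dq1 !mul0r.
rewrite exprS dqM ih; case: k {ih} => [|k] /=; first by rewrite !expr0; ring.
by rewrite exprS; ring.
Qed.

(* The substitution q -> q^m, for m > 0. *)
Definition fps_sub m f : fps K := fun n => if (m %| n)%N then f (n %/ m)%N else 0.

Lemma fps_subD m f g : fps_sub m (f + g) = fps_sub m f + fps_sub m g.
Proof. by apply/funext => n; rewrite /fps_sub !fpsD; case: ifP; rewrite ?addr0. Qed.
Lemma fps_subN m f : fps_sub m (- f) = - fps_sub m f.
Proof. by apply/funext => n; rewrite /fps_sub !fpsN; case: ifP; rewrite ?oppr0. Qed.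
Lemma fps_subB m f g : fps_sub m (f - g) = fps_sub m f - fps_sub m g.
Proof. by rewrite fps_subD fps_subN. Qed.
Lemma fps_sub_nat m k : (0 < m)%N -> fps_sub m k%:R = k%:R.
Proof.
move=> m0; apply/funext => n; rewrite /fps_sub !fps_nat.
have [->|n0] := eqVneq n 0%N; first by rewrite dvdn0 div0n.
case: ifP => // /dvdnP[j e]; rewrite e mulnK // ifF //; apply/eqP => j0.
by move: n0; rewrite e j0 mul0n eqxx.
Qed.
Lemma fps_sub1 m : (0 < m)%N -> fps_sub m 1 = 1.
Proof. exact: (@fps_sub_nat m 1). Qed.
Lemma fps_subM m f g : (0 < m)%N -> fps_sub m (f * g) = fps_sub m f * fps_sub m g.
Proof.
move=> m0; apply/funext => n; rewrite fpsM /fps_sub; case: ifP => [|mn]; last first.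
  rewrite big1 // => -[i /= ilt] _; case: ifP => mi; last by rewrite mul0r.
  rewrite ifF ?mulr0 //; apply/negP => mni; have := dvdn_add mi mni.
  by rewrite subnKC // mn.
case/dvdnP => j ->; rewrite mulnK // fpsM.
rewrite -(big_mkord xpredT (fun i => f i * g (j - i)%N)).
rewrite -(big_mkord xpredT (fun i => (if (m %| i)%N then f (i %/ m)%N else 0) *
   (if (m %| j * m - i)%N then g ((j * m - i) %/ m)%N else 0))).
rewrite [RHS](bigID (fun i => m %| i)%N) /= [X in _ + X]big1 ?addr0; last first.
  by move=> i /negPf ->; rewrite mul0r.
transitivity (\sum_(i <- map (muln^~ m) (index_iota 0 j.+1))
   (if (m %| i)%N then f (i %/ m)%N else 0) *
   (if (m %| j * m - i)%N then g ((j * m - i) %/ m)%N else 0)).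
  rewrite big_map; apply: eq_bigr => i _.
  by rewrite dvdn_mull // -mulnBl dvdn_mull // !mulnK.
rewrite -[RHS]big_filter; apply: perm_big; apply: uniq_perm.
- by rewrite map_inj_uniq ?iota_uniq // => x y /eqP; rewrite eqn_pmul2r // => /eqP.
- by rewrite filter_uniq // iota_uniq.
move=> i; rewrite mem_filter mem_index_iota; apply/mapP/andP => [[k]|[/dvdnP[k ->] h]].
  by rewrite mem_index_iota => h ->; rewrite dvdn_mull //; split => //; nia.
by exists k => //; rewrite mem_index_iota; nia.
Qed.
Lemma fps_subX m f k : (0 < m)%N -> fps_sub m (f ^+ k) = fps_sub m f ^+ k.
Proof. by move=> m0; elim: k => [|k ih]; rewrite ?expr0 ?fps_sub1 // !exprS fps_subM ?ih. Qed.
Lemma fps_subMn m k f : (0 < m)%N -> fps_sub m (k%:R * f) = k%:R * fps_sub m f.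
Proof. by move=> m0; rewrite fps_subM // fps_sub_nat. Qed.
Lemma dq_sub m f : (0 < m)%N -> dq (fps_sub m f) = m%:R * fps_sub m (dq f).
Proof.
move=> m0; apply/funext => n; rewrite fpsMn /dq /fps_sub; case: ifP => [|]; last by rewrite !mulr0.
by case/dvdnP => j ->; rewrite mulnK // natrM; ring.
Qed.
Lemma fps_sub_0 m f : fps_sub m f 0%N = f 0%N.
Proof. by rewrite /fps_sub dvdn0 div0n. Qed.
Lemma fps_sub_1 m f : (1 < m)%N -> fps_sub m f 1%N = 0.
Proof. by rewrite /fps_sub dvdn1; case: eqP => // ->. Qed.

End FpsRing.

Section FpsField.
Variable K : numFieldType.
Implicit Types f g h : fps K.

Lemma fps_eq0 f g : f 0%N != 0 -> f * g = 0 -> g = 0.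
Proof.
move=> f0 e; apply/funext => n; elim/ltn_ind: n => n ih.
have := congr1 (fun u : fps K => u n) e; rewrite fpsM big_ord_recl subn0 big1 => [|[i ilt] _].
  by rewrite addr0 => /eqP; rewrite mulf_eq0 (negPf f0) => /eqP.
by rewrite /= ih ?mulr0 // /bump; lia.
Qed.

Lemma fps_mulI f g h : f 0%N != 0 -> f * g = f * h -> g = h.
Proof.
move=> f0 e; apply/eqP; rewrite -subr_eq0; apply/eqP; apply: (fps_eq0 f0).
by rewrite mulrBr e subrr.
Qed.

Lemma fps_natI k g h : (0 < k)%N -> k%:R * g = k%:R * h -> g = h.
Proof. by move=> k0; apply: fps_mulI; rewrite fps_nat pnatr_eq0 -lt0n. Qed.

(* A first-order equation u D y = c y determines y up to its coefficient of
   index c_0 / u_0. *)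
Lemma dq_linear_uniq (m : nat) (u c y z : fps K) : u 0%N != 0 ->
  c 0%N = m%:R * u 0%N -> u * dq y = c * y -> u * dq z = c * z ->
  (forall n, (n <= m)%N -> y n = z n) -> y = z.
Proof.
move=> u0 c0 ey ez yz; apply/funext => n; elim/ltn_ind: n => n ih.
have [/yz //|mn] := leqP n m.
have := congr1 (fun v : fps K => v n) ey; have := congr1 (fun v : fps K => v n) ez.
rewrite !fpsM ![\sum_(_ < _.+1) _]big_ord_recl /= !subn0 c0 /dq.
set U := \sum_(_ < _) _; set V := \sum_(_ < _) _ => hz.
set U' := \sum_(_ < _) _; set V' := \sum_(_ < _) _ => hy.
have UU : U' = U by apply: eq_bigr => -[i ilt] _; rewrite /= ih // /bump; lia.
have VV : V' = V by apply: eq_bigr => -[i ilt] _; rewrite /= ih // /bump; lia.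
(* The coefficient of index n of u Dy = c y reads (n - m) u_0 y_n = an expression in the earlier
   y_i; only n = m leaves y_n free. *)
have nm : (n%:R - m%:R) * u 0%N != 0 by rewrite mulf_neq0 // subr_eq0 eqr_nat; lia.
apply: (mulfI nm); move: hy; rewrite UU VV => /(canRL (addrK _)) hy.
move: hz => /(canRL (addrK _)) hz.
transitivity (u 0%N * (n%:R * y n) - m%:R * u 0%N * y n); first by ring.
rewrite hy; transitivity (u 0%N * (n%:R * z n) - m%:R * u 0%N * z n); last by ring.
by rewrite hz; ring.
Qed.

(** The recursion for y_n involves all earlier coefficients, so the structural recursion carries the
    whole list y_0, ..., y_n. *)
Fixpoint dqsol_seq (c : fps K) n : seq K :=
  if n is n'.+1 then
    rcons (dqsol_seq c n')
      (n%:R^-1 * \sum_(k < n) c k.+1 * (dqsol_seq c n')`_(n' - k)%N)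
  else [:: 1].

(* The solution y of D y = c y with y_0 = 1, when c_0 = 0. *)
Definition dqsol (c : fps K) : fps K := fun n => (dqsol_seq c n)`_n.

Lemma dqsol_0 (c : fps K) : dqsol c 0%N = 1. Proof. by []. Qed.

Lemma dqsol_S (c : fps K) n :
  n.+1%:R * dqsol c n.+1 = \sum_(k < n.+1) c k.+1 * dqsol c (n - k)%N.
Proof.
have sz m : size (dqsol_seq c m) = m.+1.
  by elim: m => //= m ih; rewrite size_rcons ih.
have nthS m k : (k <= m)%N -> (dqsol_seq c m)`_k = dqsol c k.
  elim: m k => [|m ih] k km; first by move: km; rewrite leqn0 => /eqP ->.
  have [km'|km'] := leqP k m; last by have -> : k = m.+1 by lia.
  by rewrite /= nth_rcons sz ltnS km' ih.
rewrite {1}/dqsol /= nth_rcons sz ltnn eqxx mulVKf ?pnatr_eq0 //.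
by apply: eq_bigr => k _; rewrite nthS // leq_subr.
Qed.

Lemma dq_dqsol (c : fps K) : c 0%N = 0 -> dq (dqsol c) = c * dqsol c.
Proof.
move=> c0; apply/funext => -[|n]; first by rewrite /dq fpsM0 c0 !mul0r.
rewrite /dq dqsol_S fpsM [RHS]big_ord_recl c0 mul0r add0r.
by apply: eq_bigr => i _; rewrite /= /bump add1n subSS.
Qed.
End FpsField.

(** * Convolutions of divisor sums *)

Section DivisorSums.
Variable K : numFieldType.
Implicit Types F : nat * nat -> K.

(** A divisor of n is encoded as a factorisation (divisor, codivisor), so that F may depend on both.
    At n = 0 the box is empty and the sum is 0, which gives the series [sig] a zero constant
    term. *)
Definition divsum n F : K := \sum_(p <- box n | (p.1 * p.2 == n)%N) F p.

Lemma divsum_widen N n F : (n <= N)%N ->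
  divsum n F = \sum_(p <- box N | (p.1 * p.2 == n)%N) F p.
Proof.
move=> nN; rewrite /divsum.
apply: (@sum_seq_bij _ _ _ (box N) (box n) _ _ id id); rewrite ?box_uniq //.
- by case=> a x; rewrite !mem_box /= => h e; split=> //; nia.
- by case=> a x; rewrite !mem_box /= => h e; split=> //; nia.
Qed.

Lemma eq_divsum n F1 F2 : (forall a x, (0 < a)%N -> (0 < x)%N -> (a * x = n)%N ->
  F1 (a, x) = F2 (a, x)) -> divsum n F1 = divsum n F2.
Proof.
move=> e; rewrite /divsum big_seq_cond [RHS]big_seq_cond.
apply: eq_bigr => -[a x] /andP[]; rewrite mem_box /= => h /eqP ax.
by apply: e => //; lia.
Qed.

Lemma divsumD n F1 F2 : divsum n (fun p => F1 p + F2 p) = divsum n F1 + divsum n F2.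
Proof. exact: big_split. Qed.

Lemma divsumB n F1 F2 : divsum n (fun p => F1 p - F2 p) = divsum n F1 - divsum n F2.
Proof. exact: sumrB. Qed.

Lemma divsumZ n c F : divsum n (fun p => c * F p) = c * divsum n F.
Proof. by rewrite /divsum mulr_sumr. Qed.

Lemma divsum1 F : divsum 1 F = F (1, 1)%N.
Proof. by rewrite /divsum /box /= big_cons /= big_nil addr0. Qed.

Definition sig k : fps K := fun n => divsum n (fun p => p.1%:R ^+ k).

Lemma sig_0 k : sig k 0%N = 0.
Proof. by rewrite /sig /divsum /box /= big_nil. Qed.

Lemma sig_1 k : sig k 1%N = 1.
Proof. by rewrite /sig divsum1 expr1n. Qed.

Lemma dq_sig k n : dq (sig k) n = divsum n (fun p => p.1%:R ^+ k.+1 * p.2%:R).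
Proof.
rewrite /dq /sig -divsumZ; apply: eq_divsum => a x _ _ <- /=.
by rewrite natrM exprS; ring.
Qed.

Lemma mul_divsum F1 F2 n :
  (((fun m => divsum m F1 : K) : fps K) * ((fun m => divsum m F2) : fps K)) n =
  \sum_(t <- quads n) F1 t.1 * F2 t.2.
Proof.
rewrite fpsM /quads big_filter [RHS]big_mkcond [RHS]big_allpairs_dep /=.
under [RHS]eq_bigr => p _ do rewrite -big_mkcond /=.
under eq_bigr => i _ do rewrite (@divsum_widen n) -1?ltnS // (@divsum_widen n) ?leq_subr //.
under eq_bigr => i _ do rewrite big_distrl /=.
rewrite -(big_mkord xpredT (fun i => \sum_(p <- box n | (p.1 * p.2)%N == i)
   F1 p * (\sum_(r <- box n | (r.1 * r.2)%N == (n - i)%N) F2 r))) /=.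
under eq_bigr => i _ do rewrite big_mkcond /=.
rewrite exchange_big /=; apply: eq_big_seq => -[a x]; rewrite mem_box /= => hp.
have [pn|pn] := leqP (a * x) n; last first.
  rewrite big1_seq => [|i]; last first.
    by rewrite mem_index_iota /= => h; rewrite ifF //; lia.
  by rewrite big1 // => -[b y] /= /eqP; lia.
rewrite (bigD1_seq (a * x)%N) ?iota_uniq ?mem_index_iota //=.
rewrite eqxx [X in _ + X]big1 ?addr0; last by move=> i ni; rewrite ifF //; lia.
by rewrite big_distrr /=; apply: eq_bigl => -[b y] /=; lia.
Qed.

(** On x = y the equation is (a + b) x = n: such a solution is a divisor of n together with a
    splitting of it into two positive parts. *)
Lemma sum_quads_xeq n (s : nat -> nat -> K) :
  \sum_(t <- quads n | t.1.2 == t.2.2) s t.1.1 t.2.1 =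
  divsum n (fun p => \sum_(1 <= a < p.1) s a (p.1 - a)%N).
Proof.
rewrite /divsum -[RHS]big_filter.
transitivity (\sum_(pa <- [seq (p, a) | p <- [seq p <- box n | (p.1 * p.2 == n)%N],
    a <- index_iota 1 p.1]) s pa.2 (pa.1.1 - pa.2)%N); last by rewrite big_allpairs_dep.
symmetry.
rewrite (@sum_seq_bij _ _ _ (quads n) _ (fun t => t.1.2 == t.2.2) predT
  (fun t : (nat * nat) * (nat * nat) => (((t.1.1 + t.2.1)%N, t.1.2), t.1.1))
  (fun pa : (nat * nat) * nat => ((pa.2, pa.1.2), ((pa.1.1 - pa.2)%N, pa.1.2)))).
- by apply: eq_bigr => t _ /=; rewrite addKn.
- exact: quads_uniq.
- apply: allpairs_uniq_dep; first by rewrite filter_uniq ?box_uniq.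
    by move=> p _; exact: iota_uniq.
  by case=> p a; case=> p' a' _ _ /= [-> ->].
- case=> -[a x] [b y]; rewrite mem_quads /= => h /eqP xy; subst y; split=> //; last by rewrite addKn.
  apply/allpairsPdep; exists ((a + b)%N, x); exists a.
  by split=> //; rewrite ?mem_filter ?mem_box ?mem_index_iota /=; nia.
- case=> -[d x] a /allpairsPdep[[p z] [b [+ +]]] [-> -> ->] _.
  rewrite mem_filter mem_box mem_index_iota /= mem_quads /= => h1 h2.
  by split=> //; [nia | rewrite subnKC //; lia].
Qed.

(** On a = b the equation is a (x + y) = n: the codivisor is split into two positive parts, in one
    way fewer than its value. *)
Lemma sum_quads_aeq n (s : nat -> nat -> K) :
  \sum_(t <- quads n | t.1.1 == t.2.1) s t.1.1 t.2.1 =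
  divsum n (fun p => (p.2%:R - 1) * s p.1 p.1).
Proof.
transitivity (divsum n (fun p => \sum_(1 <= x < p.2) s p.1 p.1)); last first.
  apply: eq_divsum => a x a0 x0 _ /=; rewrite sumr_const_nat -[LHS]mulr_natl; congr (_ * _).
  by rewrite natrB.
rewrite /divsum -[RHS]big_filter.
transitivity (\sum_(px <- [seq (p, x) | p <- [seq p <- box n | (p.1 * p.2 == n)%N],
    x <- index_iota 1 p.2]) s px.1.1 px.1.1); last by rewrite big_allpairs_dep.
symmetry.
rewrite (@sum_seq_bij _ _ _ (quads n) _ (fun t => t.1.1 == t.2.1) predT
  (fun t : (nat * nat) * (nat * nat) => ((t.1.1, (t.1.2 + t.2.2)%N), t.1.2))
  (fun px : (nat * nat) * nat => ((px.1.1, px.2), (px.1.1, (px.1.2 - px.2)%N)))).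
- by apply: eq_bigr => t /eqP <-.
- exact: quads_uniq.
- apply: allpairs_uniq_dep; first by rewrite filter_uniq ?box_uniq.
    by move=> p _; exact: iota_uniq.
  by case=> p a; case=> p' a' _ _ /= [-> ->].
- case=> -[a x] [b y]; rewrite mem_quads /= => h /eqP xy; subst b; split=> //; last by rewrite addKn.
  apply/allpairsPdep; exists (a, (x + y)%N); exists x.
  by split=> //; rewrite ?mem_filter ?mem_box ?mem_index_iota /=; nia.
- case=> -[d x] a /allpairsPdep[[p z] [b [+ +]]] [-> -> ->] _.
  rewrite mem_filter mem_box mem_index_iota /= mem_quads /= => h1 h2.
  by split=> //; [nia | rewrite subnKC //; lia].
Qed.

(* Liouville's method: a convolution of divisor sums becomes a divisor sum as
   soon as its summand d is a difference s(a,b) - s(a,b-a). *)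
Lemma sum_quads_divsum n (s d : nat -> nat -> K) (T : nat -> K) :
  (forall a b, s a b = s b a) -> (forall a b, d a b = d b a) ->
  (forall a b, (0 < a)%N -> (a < b)%N -> d a b = s a b - s a (b - a)%N) ->
  (forall m, (0 < m)%N -> \sum_(1 <= a < m) s a (m - a)%N = T m) ->
  \sum_(t <- quads n) d t.1.1 t.2.1 =
  divsum n (fun p => T p.1 + (p.2%:R - 1) * (d p.1 p.1 - s p.1 p.1)).
Proof.
move=> sC dC sd sT; rewrite (quad_identity _ sC dC sd).
rewrite sum_quads_xeq !sum_quads_aeq -divsumB -divsumD.
by apply: eq_divsum => a x a0 x0 _ /=; rewrite sT //; ring.
Qed.

End DivisorSums.

Section Convolutions.
Variable K : numFieldType.

(** Telescoping: each power sum below is settled by exhibiting an antidifference in a, with m kept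
    as a parameter, and letting [field] check it. *)
Lemma sum_antidiff (f P : nat -> K) : P 1%N = 0 ->
  forall m, (0 < m)%N -> (forall a, (0 < a < m)%N -> P a.+1 - P a = f a) ->
  \sum_(1 <= a < m) f a = P m.
Proof.
move=> P1 [//|m _]; elim: m => [|m ih] h; first by rewrite big_nil P1.
rewrite big_nat_recr //= ih => [|a ha]; last by apply: h; lia.
by rewrite -h ?subrKC //; lia.
Qed.

Lemma mul_sig i j n : (sig K i * sig K j) n =
  \sum_(t <- quads n) t.1.1%:R ^+ i * t.2.1%:R ^+ j.
Proof. exact: mul_divsum. Qed.

(** Liouville's method wants a symmetric summand; adding the product to itself with the factors
    exchanged provides one. *)
Lemma sig_mul_sym i j n : (sig K i * sig K j + sig K i * sig K j) n =
  \sum_(t <- quads n) (t.1.1%:R ^+ i * t.2.1%:R ^+ j + t.2.1%:R ^+ i * t.1.1%:R ^+ j).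
Proof.
rewrite big_split /= -mul_sig fpsD; congr (_ + _); rewrite mulrC mul_sig.
by apply: eq_bigr => t _; rewrite mulrC.
Qed.

(** The form s = a^2 + ab + b^2 drops by d = 2ab when b is replaced by b - a. On the diagonal d - s
    = - a^2, and its product with the codivisor produces the derivative term. In the next three
    lemmas s is again a symmetric form of the degree of d, fitted to the same difference
    equation. *)
Lemma sig11 : 12%:R * (sig K 1 * sig K 1) =
  5%:R * sig K 3 + sig K 1 - 6%:R * dq (sig K 1).
Proof.
apply: (@fps_natI K 2) => //; apply/funext => n.
have := @sum_quads_divsum K n
  (fun a b => a%:R ^+ 2 + a%:R * b%:R + b%:R ^+ 2) (fun a b => 2 * (a%:R * b%:R))
  (fun x => (5 / 6) * x%:R ^+ 3 + (- 1) * x%:R ^+ 2 + (1 / 6) * x%:R).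
rewrite -mulr_sumr -[\sum_(_ <- _) _](_ : (sig K 1 * sig K 1) n = _); last first.
  by rewrite mul_sig; apply: eq_bigr => t _; rewrite !expr1.
rewrite !(fpsD, fpsN, fpsMn) => e.
rewrite [2%:R * (12%:R * _)](_ : _ = 12 * (2 * (sig K 1 * sig K 1) n)); last by ring.
rewrite e.
- rewrite dq_sig /sig -!divsumZ -divsumD -divsumB -!divsumZ.
  by apply: eq_divsum => a x _ _ _ /=; field.
- by move=> a b; ring.
- by move=> a b; ring.
- by move=> a b _ ab; rewrite natrB; [ring | lia].
move=> m m0; set d : K := m%:R.
rewrite (@sum_antidiff _ (fun a => let x := a%:R in (1 / 3) * x ^+ 3 + (- 1 / 2) * x ^+ 2 * d
  + (- 1 / 2) * x ^+ 2 + (1 / 1) * x * d ^+ 2 + (1 / 2) * x * d + (1 / 6) * x + (- 1 / 1) * d ^+ 2)) //=.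
- by rewrite /d; field.
- by field.
- by move=> a ha; rewrite natrB; [rewrite -natr1 -/d; field | lia].
Qed.

Lemma sig31 : 240%:R * (sig K 3 * sig K 1) =
  21%:R * sig K 5 + 10%:R * sig K 3 - sig K 1 - 30%:R * dq (sig K 3).
Proof.
apply/funext => n.
have := @sum_quads_divsum K n
  (fun a b => a%:R ^+ 4 + b%:R ^+ 4 + 2 * a%:R ^+ 3 * b%:R + 2 * a%:R * b%:R ^+ 3
     + 3 * a%:R ^+ 2 * b%:R ^+ 2)
  (fun a b => 4 * (a%:R ^+ 3 * b%:R ^+ 1 + b%:R ^+ 3 * a%:R ^+ 1))
  (fun x => (7 / 10) * x%:R ^+ 5 + (- 1 / 1) * x%:R ^+ 4 + (1 / 3) * x%:R ^+ 3 + (- 1 / 30) * x%:R).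
rewrite -mulr_sumr -sig_mul_sym.
rewrite !(fpsD, fpsN, fpsMn) => e.
rewrite [240%:R * _](_ : _ = 30 * (4 * ((sig K 3 * sig K 1) n + (sig K 3 * sig K 1) n))); last by ring.
rewrite e.
- rewrite dq_sig /sig -!divsumZ -divsumD -!divsumB.
  by apply: eq_divsum => a x _ _ _ /=; field.
- by move=> a b; ring.
- by move=> a b; ring.
- by move=> a b _ ab; rewrite natrB; [ring | lia].
move=> m m0; set d : K := m%:R.
rewrite (@sum_antidiff _ (fun a => let x := a%:R in (1 / 5) * x ^+ 5 + (- 1 / 2) * x ^+ 4 * d + (- 1 / 2) * x ^+ 4 + (1 / 1) * x ^+ 3 * d ^+ 2 + (1 / 1) * x ^+ 3 * d + (1 / 3) * x ^+ 3 + (- 1 / 1) * x ^+ 2 * d ^+ 3 + (- 3 / 2) * x ^+ 2 * d ^+ 2 + (- 1 / 2) * x ^+ 2 * d + (1 / 1) * x * d ^+ 4 + (1 / 1) * x * d ^+ 3 + (1 / 2) * x * d ^+ 2 + (- 1 / 30) * x + (- 1 / 1) * d ^+ 4)) //=.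
- by rewrite /d; field.
- by field.
- by move=> a ha; rewrite natrB; [rewrite -natr1 -/d; field | lia].
Qed.

Lemma sig51 : 504%:R * (sig K 5 * sig K 1) =
  20%:R * sig K 7 + 21%:R * sig K 5 + sig K 1 - 42%:R * dq (sig K 5).
Proof.
apply/funext => n.
have := @sum_quads_divsum K n
  (fun a b => 2 * a%:R ^+ 6 + 2 * b%:R ^+ 6 + 6 * a%:R ^+ 5 * b%:R + 6 * a%:R * b%:R ^+ 5
     + 5 * a%:R ^+ 4 * b%:R ^+ 2 + 5 * a%:R ^+ 2 * b%:R ^+ 4)
  (fun a b => 12 * (a%:R ^+ 5 * b%:R ^+ 1 + b%:R ^+ 5 * a%:R ^+ 1))
  (fun x => (20 / 21) * x%:R ^+ 7 + (- 2 / 1) * x%:R ^+ 6 + (1 / 1) * x%:R ^+ 5 + (1 / 21) * x%:R).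
rewrite -mulr_sumr -sig_mul_sym.
rewrite !(fpsD, fpsN, fpsMn) => e.
rewrite [504%:R * _](_ : _ = 21 * (12 * ((sig K 5 * sig K 1) n + (sig K 5 * sig K 1) n))); last by ring.
rewrite e.
- rewrite dq_sig /sig -!divsumZ -!divsumD -!divsumB.
  by apply: eq_divsum => a x _ _ _ /=; field.
- by move=> a b; ring.
- by move=> a b; ring.
- by move=> a b _ ab; rewrite natrB; [ring | lia].
move=> m m0; set d : K := m%:R.
rewrite (@sum_antidiff _ (fun a => let x := a%:R in (2 / 7) * x ^+ 7 + (- 1 / 1) * x ^+ 6 * d + (- 1 / 1) * x ^+ 6 + (1 / 1) * x ^+ 5 * d ^+ 2 + (3 / 1) * x ^+ 5 * d + (1 / 1) * x ^+ 5 + (- 5 / 2) * x ^+ 4 * d ^+ 2 + (- 5 / 2) * x ^+ 4 * d + (5 / 3) * x ^+ 3 * d ^+ 4 + (5 / 3) * x ^+ 3 * d ^+ 2 + (- 1 / 3) * x ^+ 3 + (- 3 / 1) * x ^+ 2 * d ^+ 5 + (- 5 / 2) * x ^+ 2 * d ^+ 4 + (1 / 2) * x ^+ 2 * d + (2 / 1) * x * d ^+ 6 + (3 / 1) * x * d ^+ 5 + (5 / 6) * x * d ^+ 4 + (- 1 / 6) * x * d ^+ 2 + (1 / 21) * x + (- 2 / 1) * d ^+ 6)) //=.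
- by rewrite /d; field.
- by field.
- by move=> a ha; rewrite natrB; [rewrite -natr1 -/d; field | lia].
Qed.

(** This is E4^2 = E8 on coefficients. No derivative appears because d and s agree on the diagonal,
    both being 4 a^6 there. *)
Lemma sig33 : 120%:R * (sig K 3 * sig K 3) = sig K 7 - sig K 3.
Proof.
apply/funext => n.
have := @sum_quads_divsum K n
  (fun a b => 2 * a%:R ^+ 3 * b%:R ^+ 3 + a%:R ^+ 4 * b%:R ^+ 2 + a%:R ^+ 2 * b%:R ^+ 4)
  (fun a b => 4 * (a%:R ^+ 3 * b%:R ^+ 3))
  (fun x => (1 / 30) * x%:R ^+ 7 + (- 1 / 30) * x%:R ^+ 3).
rewrite -mulr_sumr -mul_sig.
rewrite !(fpsD, fpsN, fpsMn) => e.
rewrite [120%:R * _](_ : _ = 30 * (4 * (sig K 3 * sig K 3) n)); last by ring.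
rewrite e.
- rewrite /sig -!divsumZ -!divsumB.
  by apply: eq_divsum => a x _ _ _ /=; field.
- by move=> a b; ring.
- by move=> a b; ring.
- by move=> a b _ ab; rewrite natrB; [ring | lia].
move=> m m0; set d : K := m%:R.
rewrite (@sum_antidiff _ (fun a => let x := a%:R in (1 / 5) * x ^+ 5 * d ^+ 2 + (- 1 / 2) * x ^+ 4 * d ^+ 3 + (- 1 / 2) * x ^+ 4 * d ^+ 2 + (1 / 3) * x ^+ 3 * d ^+ 4 + (1 / 1) * x ^+ 3 * d ^+ 3 + (1 / 3) * x ^+ 3 * d ^+ 2 + (- 1 / 2) * x ^+ 2 * d ^+ 4 + (- 1 / 2) * x ^+ 2 * d ^+ 3 + (1 / 6) * x * d ^+ 4 + (- 1 / 30) * x * d ^+ 2)) //=.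
- by rewrite /d; field.
- by field.
- by move=> a ha; rewrite natrB; [rewrite -natr1 -/d; field | lia].
Qed.

(** The divisors of n that are multiples of 3 are the numbers 3b with b a divisor of n/3. *)
Lemma sub3_sig k n : (3%:R ^+ k * fps_sub 3 (sig K k)) n =
  divsum n (fun p => if (3 %| p.1)%N then p.1%:R ^+ k else 0).
Proof.
rewrite -natrX fpsMn /fps_sub /divsum -big_mkcondr /=.
case: ifP => [/dvdnP[m ->]|n3]; last first.
  rewrite mulr0 big1 // => -[a x] /= /andP[/eqP e a3].
  by move: n3; rewrite -e dvdn_mulr.
rewrite mulnK // /sig (@divsum_widen _ (m * 3) m) ?leq_pmulr //= mulr_sumr.
symmetry; rewrite (@sum_seq_bij _ _ _ (box (m * 3)) (box (m * 3)) (fun p => p.1 * p.2 == m)%N _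
  (fun p => (p.1 * 3, p.2)%N) (fun p => (p.1 %/ 3, p.2)%N)) ?box_uniq //.
- by apply: eq_bigr => p _ /=; rewrite natrM natrX exprMn mulrC.
- case=> a x; rewrite !mem_box /= => h e; rewrite dvdn_mull // mulnK // andbT.
  by split=> //; nia.
- case=> a x; rewrite !mem_box /= => h /andP[e /dvdnP[b eb]]; subst a.
  by rewrite mulnK //; split=> //; nia.
Qed.

(** The level 3 counterpart of the form in [sig11]: a quadratic form whose coefficients depend on
    the residues mod 3, arranged so that its difference is the product ab restricted to a and b
    prime to 3. *)
Let s3 (a b : nat) : K :=
  ((b %% 3 != 0)%N%:R * a%:R ^+ 2 + (a %% 3 != 0)%N%:R * b%:R ^+ 2 +
   (a %% 3 != 0)%N%:R * (b %% 3 != 0)%N%:R * (if (a %% 3 == b %% 3)%N then 1 else 2) * (a%:R * b%:R)) / 3.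

Let d3 (a b : nat) : K := (a %% 3 != 0)%N%:R * a%:R * ((b %% 3 != 0)%N%:R * b%:R).

Let mod3P (a : nat) : [\/ a %% 3 = 0, a %% 3 = 1 | a %% 3 = 2]%N.
Proof.
have : (a %% 3 < 3)%N by rewrite ltn_pmod.
by case: (a %% 3)%N => [|[|[|]]] // _; [constructor 1|constructor 2|constructor 3].
Qed.

Let s3C a b : s3 a b = s3 b a.
Proof. by rewrite /s3; case: (mod3P a) => ->; case: (mod3P b) => -> /=; ring. Qed.

Let s3_d3 a b : (0 < a)%N -> (a < b)%N -> d3 a b = s3 a b - s3 a (b - a)%N.
Proof.
move=> _ ab; have baE : ((b - a) %% 3 = (b %% 3 + 3 - a %% 3) %% 3)%N by lia.
rewrite /s3 /d3 natrB 1?ltnW // baE.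
by case: (mod3P a) => ->; case: (mod3P b) => -> /=; field.
Qed.

Let sum3 (f : nat -> K) (k : nat) :
  \sum_(0 <= a < 3 * k) f a = \sum_(j < k) (f (3 * j)%N + f (3 * j).+1 + f (3 * j).+2).
Proof.
elim: k => [|k ih]; first by rewrite muln0 big_nil big_ord0.
by rewrite mulnS !addSn add0n !big_nat_recr //= ih big_ord_recr /= !addrA.
Qed.

(** For a in a fixed residue class mod 3 the summand is a quadratic polynomial in a, so the range is
    cut into blocks of three, with m mod 3 terms left over. *)
Let sum_s3 m : (0 < m)%N -> \sum_(1 <= a < m) s3 a (m - a)%N =
  if (m %% 3 == 0)%N then 2 / 9 * m%:R ^+ 3 else (m%:R ^+ 3 - m%:R) / 6.
Proof.
move=> m0.
(* The term a = 0 vanishes; including it aligns the blocks of three with multiples of 3. *)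
have -> : \sum_(1 <= a < m) s3 a (m - a)%N = \sum_(0 <= a < m) s3 a (m - a)%N.
  rewrite [RHS]big_ltn // [s3 0 _](_ : _ = 0) ?add0r //.
  by rewrite /s3 mod0n /=; ring.
have : (m = 3 * (m %/ 3) + m %% 3)%N by rewrite mulnC -divn_eq.
move: (m %/ 3)%N => k mE; rewrite {1}mE.
have fE a r : (a < m)%N -> (a %% 3 = r)%N -> s3 a (m - a)%N =
   ((((m %% 3 + 3 - r) %% 3)%N != 0)%N%:R * a%:R ^+ 2 + (r != 0)%N%:R * (m%:R - a%:R) ^+ 2 +
   (r != 0)%N%:R * (((m %% 3 + 3 - r) %% 3)%N != 0)%N%:R *
   (if (r == (m %% 3 + 3 - r) %% 3)%N then 1 else 2) * (a%:R * (m%:R - a%:R))) / 3.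
  move=> am aE; rewrite /s3 natrB 1?ltnW //.
  have -> : ((m - a) %% 3 = (m %% 3 + 3 - r) %% 3)%N by lia.
  by rewrite aE.
have [m3|m3|m3] := mod3P m; rewrite m3 /=; rewrite m3 in mE fE.
- have -> : m%:R = 3 * k%:R :> K by rewrite mE addn0 natrM.
  rewrite addn0 sum3 (eq_bigr (fun=> 2 / 3 * m%:R ^+ 2)) => [|[j jk] _ /=].
    by rewrite sumr_const card_ord -[LHS]mulr_natl mE addn0 natrM; field.
  rewrite (fE (3 * j)%N 0%N) ?(fE (3 * j).+1 1%N) ?(fE (3 * j).+2 2%N) /=; try lia.
  by rewrite -!natr1; field.
- have mk : m%:R = 3 * k%:R + 1 :> K by rewrite mE natrD natrM.
  rewrite addn1 big_nat_recr //= sum3.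
  rewrite (eq_bigr (fun j : 'I_k => (27 * j%:R ^+ 2 + 18 * j%:R + 5 + 2 * m%:R ^+ 2
     - m%:R * (9 * j%:R + 4)) / 3)) => [|[j jk] _ /=]; last first.
    rewrite (fE (3 * j)%N 0%N) ?(fE (3 * j).+1 1%N) ?(fE (3 * j).+2 2%N) /=; try lia.
    by rewrite -!natr1 !natrM; field.
  rewrite (fE (3 * k)%N 0%N) /=; try lia.
  have -> : \sum_(j < k) (27 * j%:R ^+ 2 + 18 * j%:R + 5 + 2 * m%:R ^+ 2
     - m%:R * (9 * j%:R + 4)) / 3 = (27 / 6 * (k%:R - 1) * k%:R * (2 * k%:R - 1)
       + 9 * k%:R * (k%:R - 1) + 5 * k%:R + 2 * m%:R ^+ 2 * k%:R
       - m%:R * (9 / 2 * k%:R * (k%:R - 1) + 4 * k%:R)) / 3 :> K.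
    elim: {mE mk fE} k => [|k ih]; first by rewrite big_ord0; field.
    by rewrite big_ord_recr /= ih -natr1; field.
  by rewrite natrM mk; field.
- have mk : m%:R = 3 * k%:R + 2 :> K by rewrite mE natrD natrM.
  rewrite addn2 !big_nat_recr //= sum3.
  rewrite (eq_bigr (fun j : 'I_k => (27 * j%:R ^+ 2 + 18 * j%:R + 5 + 2 * m%:R ^+ 2
     - m%:R * (9 * j%:R + 5)) / 3)) => [|[j jk] _ /=]; last first.
    rewrite (fE (3 * j)%N 0%N) ?(fE (3 * j).+1 1%N) ?(fE (3 * j).+2 2%N) /=; try lia.
    by rewrite -!natr1 !natrM; field.
  rewrite (fE (3 * k)%N 0%N) ?(fE (3 * k).+1 1%N) /=; try lia.
  have -> : \sum_(j < k) (27 * j%:R ^+ 2 + 18 * j%:R + 5 + 2 * m%:R ^+ 2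
     - m%:R * (9 * j%:R + 5)) / 3 = (27 / 6 * (k%:R - 1) * k%:R * (2 * k%:R - 1)
       + 9 * k%:R * (k%:R - 1) + 5 * k%:R + 2 * m%:R ^+ 2 * k%:R
       - m%:R * (9 / 2 * k%:R * (k%:R - 1) + 5 * k%:R)) / 3 :> K.
    elim: {mE mk fE} k => [|k ih]; first by rewrite big_ord0; field.
    by rewrite big_ord_recr /= ih -natr1; field.
  by rewrite -natr1 natrM mk; field.
Qed.

(** With A = 1 + 12 S this says 10 A^2 = E4(tau) + 9 E4(3 tau). The coefficients of S sum the
    divisors prime to 3, so S^2 is the convolution with summand [d3]. *)
Lemma sig_level3 : let S := sig K 1 - 3%:R * fps_sub 3 (sig K 1) in
  6%:R * (S * S) = sig K 3 + 9%:R * fps_sub 3 (sig K 3) - S.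
Proof.
move=> S; have SE n : S n = divsum n (fun p => (p.1 %% 3 != 0)%N%:R * p.1%:R).
  rewrite /S fpsB -[3%:R * _]/(3%:R ^+ 1 * _) sub3_sig /sig -divsumB.
  apply: eq_divsum => a x _ _ _ /=; rewrite /dvdn expr1.
  by case: (a %% 3 == 0)%N => /=; ring.
clearbody S; apply: (@fps_natI K 3) => //; apply/funext => n.
(* The factor 3 turns 9 into 3^3, the weight with which [sub3_sig] applies to [sig K 3]. *)
have -> : 3%:R * (sig K 3 + 9%:R * fps_sub 3 (sig K 3) - S) =
  3%:R * sig K 3 + 3%:R ^+ 3 * fps_sub 3 (sig K 3) - 3%:R * S by ring.
have := @sum_quads_divsum K n s3 d3
  (fun m => if (m %% 3 == 0)%N then 2 / 9 * m%:R ^+ 3 else (m%:R ^+ 3 - m%:R) / 6) s3C _ s3_d3 sum_s3.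
have -> : \sum_(t <- quads n) d3 t.1.1 t.2.1 = (S * S) n.
  transitivity ((((fun m => divsum m (fun p => (p.1 %% 3 != 0)%N%:R * p.1%:R) : K) : fps K) *
      ((fun m => divsum m (fun p => (p.1 %% 3 != 0)%N%:R * p.1%:R)) : fps K)) n).
    by rewrite mul_divsum.
  by rewrite !fpsM; apply: eq_bigr => i _; rewrite -!SE.
move=> e; rewrite !(fpsD, fpsN) sub3_sig !fpsMn e => [|a b]; last by rewrite /d3; ring.
rewrite SE /sig -!divsumZ -divsumD -divsumB.
apply: eq_divsum => a x _ _ _ /=; rewrite /d3 /s3 /dvdn eqxx.
by case: (a %% 3 == 0)%N => /=; field.
Qed.
End Convolutions.

(** * The level 3 system of differential equations *)

Section Level3.
Variable K : numFieldType.
Local Notation S1 := (sig K 1).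
Local Notation S3 := (sig K 3).
Local Notation V := (fps_sub 3).

Definition fE2 : fps K := 1 - 24%:R * sig K 1.
Definition fE4 : fps K := 1 + 240%:R * sig K 3.
Definition fE6 : fps K := 1 - 504%:R * sig K 5.

Lemma ramanujan_E2 : 12%:R * dq fE2 = fE2 ^+ 2 - fE4.
Proof.
have e := sig11 K; rewrite /fE2 /fE4 dqB dq1 dqMn.
have -> : 12%:R * (0 - 24%:R * dq S1) = 48%:R * (12%:R * (S1 * S1))
  - 240%:R * S3 - 48%:R * S1 by rewrite e; ring.
by ring.
Qed.

Lemma ramanujan_E4 : 3%:R * dq fE4 = fE2 * fE4 - fE6.
Proof.
have e := sig31 K; rewrite /fE2 /fE4 /fE6 dqD dq1 dqMn.
have -> : 3%:R * (0 + 240%:R * dq S3) = 504%:R * sig K 5 + 240%:R * S3 - 24%:R * S1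
  - 24%:R * (240%:R * (S3 * S1)) by rewrite e; ring.
by ring.
Qed.

(** Both [sig51] and [sig33] produce the series of sigma_7; eliminating it expresses D E6 through E2
    E6 and E4^2. *)
Lemma ramanujan_E6 : 2%:R * dq fE6 = fE2 * fE6 - fE4 ^+ 2.
Proof.
have e := sig51 K; have e' := sig33 K; rewrite /fE2 /fE4 /fE6 dqB dq1 dqMn.
have -> : 2%:R * (0 - 504%:R * dq (sig K 5)) = 24%:R * (504%:R * (sig K 5 * S1))
  - 480%:R * (120%:R * (S3 * S3)) - 504%:R * sig K 5 - 480%:R * S3 - 24%:R * S1
  by rewrite e e'; ring.
by ring.
Qed.

(* a^2 and ab of the header, as Eisenstein series for Gamma_0(3) *)
Definition fA : fps K := 1 + 12%:R * (S1 - 3%:R * V S1).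
Definition fB : fps K := 1 - 3%:R * S3 + 243%:R * V S3.

Local Notation f2 := (V fE2).
Local Notation f4 := (V fE4).
Local Notation f6 := (V fE6).

Let f2E : f2 = 1 - 24%:R * V S1.
Proof. by rewrite fps_subB fps_subMn // fps_sub1. Qed.
Let f4E : f4 = 1 + 240%:R * V S3.
Proof. by rewrite fps_subD fps_subMn // fps_sub1. Qed.

Let HA : 3%:R * f2 = 2%:R * fA + fE2.
Proof. by rewrite f2E /fA /fE2; ring. Qed.

Let HB : fE4 = 9%:R * fA ^+ 2 - 8%:R * fB.
Proof.
have := sig_level3 K => /= e.
have -> : fA ^+ 2 = 1 + 24%:R * (S1 - 3%:R * V S1)
  + 24%:R * (6%:R * ((S1 - 3%:R * V S1) * (S1 - 3%:R * V S1))) by rewrite /fA; ring.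
by rewrite e /fE4 /fB; ring.
Qed.

Let HC : 9%:R * f4 = fA ^+ 2 + 8%:R * fB.
Proof.
have := sig_level3 K => /= e.
have -> : fA ^+ 2 = 1 + 24%:R * (S1 - 3%:R * V S1)
  + 24%:R * (6%:R * ((S1 - 3%:R * V S1) * (S1 - 3%:R * V S1))) by rewrite /fA; ring.
by rewrite e f4E /fB; ring.
Qed.

Let Df2 : 4%:R * dq f2 = f2 ^+ 2 - f4.
Proof.
apply: (@fps_natI K 3) => //; rewrite dq_sub //.
have -> : 3%:R * (4%:R * (3%:R * V (dq fE2))) = 3%:R * V (12%:R * dq fE2).
  by rewrite fps_subMn //; ring.
by rewrite ramanujan_E2 fps_subB fps_subX.
Qed.

Let Df4 : dq f4 = f2 * f4 - f6.
Proof. by rewrite dq_sub // -fps_subMn // ramanujan_E4 fps_subB fps_subM. Qed.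

Let Df6 : 2%:R * dq f6 = 3%:R * (f2 * f6 - f4 ^+ 2).
Proof.
rewrite dq_sub //; have -> : 2%:R * (3%:R * V (dq fE6)) = 3%:R * V (2%:R * dq fE6).
  by rewrite fps_subMn //; ring.
by rewrite ramanujan_E6 fps_subB fps_subM // fps_subX.
Qed.

(** Differentiate 3 E2(3 tau) = 2A + E2(tau) and apply the equation for D E2 both at tau and at 3
    tau. *)
Lemma dq_fA : 6%:R * dq fA = 3%:R * fA ^+ 2 + fA * fE2 - 4%:R * fB.
Proof.
apply: (@fps_natI K 4) => //.
have /(congr1 (@dq K)) := HA; rewrite dqD !dqMn => e.
have -> : 4%:R * (6%:R * dq fA) = 12%:R * (2%:R * dq fA + dq fE2) - 12%:R * dq fE2 by ring.
rewrite -e ramanujan_E2.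
have -> : 12%:R * (3%:R * dq f2) - (fE2 ^+ 2 - fE4) = 9%:R * (4%:R * dq f2) - fE2 ^+ 2 + fE4.
  by ring.
rewrite Df2; have -> : 9%:R * (f2 ^+ 2 - f4) = (3%:R * f2) ^+ 2 - 9%:R * f4 by ring.
by rewrite HA HC HB; ring.
Qed.

(** Differentiating E4(tau) + 9 E4(3 tau) = 10 A^2 brings in exactly this combination of the two
    values of E6. *)
Let E66 : fE6 + 27%:R * f6 = 56%:R * (fA * fB) - 28%:R * fA ^+ 3.
Proof.
have e : fE4 + 9%:R * f4 = 10%:R * fA ^+ 2 by rewrite HC HB; ring.
move/(congr1 (@dq K)): e; rewrite dqD !dqMn dqX Df4 /= expr1 => e.
have {}e : 3%:R * dq fE4 + 27%:R * (f2 * f4 - f6) = 10%:R * fA * (6%:R * dq fA).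
  transitivity (3%:R * (dq fE4 + 9%:R * (f2 * f4 - f6))); first by ring.
  by rewrite e; ring.
rewrite ramanujan_E4 dq_fA in e.
have -> : fE6 + 27%:R * f6 = fE2 * fE4 + (3%:R * f2) * (9%:R * f4)
  - (fE2 * fE4 - fE6 + 27%:R * (f2 * f4 - f6)) by ring.
by rewrite e HA HC HB; ring.
Qed.

Let HD : 24%:R * dq fB = 9%:R * fA * (6%:R * dq fA) - fE2 * fE4 + fE6.
Proof.
have := congr1 (@dq K) HB; rewrite dqB !dqMn dqX /= expr1 => e.
transitivity (3%:R * (9%:R * (2%:R * fA * dq fA)) - 3%:R * dq fE4); first by rewrite e; ring.
by rewrite ramanujan_E4; ring.
Qed.

Let fA0 : fA 0%N = 1.
Proof. by rewrite /fA fpsD fpsMn fpsB fpsMn fps_sub_0 sig_0 fps1 !mulr0 subr0 mulr0 addr0. Qed.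

(** [HD] gives D B in terms of E6. Differentiating [E66] gives a second relation, from which D B and
    E6(3 tau) are eliminated; what remains is linear in E6. *)
Let E6A : fA * fE6 = - 27%:R * fA ^+ 4 + 36%:R * fA ^+ 2 * fB - 8%:R * fB ^+ 2.
Proof.
have e : dq fE6 + 27%:R * dq f6 =
    56%:R * (dq fA * fB + fA * dq fB) - 28%:R * (3%:R * fA ^+ 2 * dq fA).
  by rewrite -dqMn -dqD E66 dqB !dqMn dqM dqX.
have e1 : 3%:R * (2%:R * dq fE6) + 81%:R * (2%:R * dq f6) =
   (6%:R * dq fA) * (56%:R * fB - 84%:R * fA ^+ 2) + 14%:R * fA * (24%:R * dq fB).
  transitivity (6%:R * (dq fE6 + 27%:R * dq f6)); first by ring.
  by rewrite e; ring.
rewrite ramanujan_E6 Df6 HD dq_fA in e1.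
have f6E : 27%:R * f6 = 56%:R * (fA * fB) - 28%:R * fA ^+ 3 - fE6 by rewrite -E66; ring.
have e2 : 3%:R * (fE2 * fE6 - fE4 ^+ 2) + 81%:R * (3%:R * (f2 * f6 - f4 ^+ 2)) =
   3%:R * (fE2 * fE6 - fE4 ^+ 2) + 3%:R * (3%:R * f2) * (27%:R * f6) - 3%:R * (9%:R * f4) ^+ 2.
  by ring.
rewrite e2 f6E HC HA in e1.
(* E6 occurs in [e1] with total coefficient 3 E2 - 3 (2A + E2) - 14 A = - 20 A. *)
apply: (@fps_natI K 20) => //; apply/eqP; rewrite -subr_eq0.
move/eqP: e1; rewrite -subr_eq0 HB => /eqP e1.
rewrite -oppr_eq0; apply/eqP; rewrite -[RHS]e1; ring.
Qed.

Let dq_fB : 3%:R * (fA * dq fB) = fB * (fA * fE2 - fB).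
Proof.
apply: (@fps_natI K 8) => //.
transitivity (fA * (24%:R * dq fB)); first by ring.
rewrite HD dq_fA HB mulrDr E6A; ring.
Qed.

(** Euler's product of the 1 - q^n, introduced through its logarithmic derivative - sum sigma_1(n)
    q^n; [fH] is its inverse. The product form is recovered in [euler_product]. *)
Definition fG : fps K := dqsol (- S1).
Definition fH : fps K := dqsol S1.

Lemma fG_0 : fG 0%N = 1. Proof. by []. Qed.
Lemma fH_0 : fH 0%N = 1. Proof. by []. Qed.

Lemma dq_fG : dq fG = - S1 * fG.
Proof. by apply: dq_dqsol; rewrite fpsN sig_0 oppr0. Qed.
Lemma dq_fH : dq fH = S1 * fH.
Proof. by apply: dq_dqsol; rewrite sig_0. Qed.

Lemma fGH : fG * fH = 1.
Proof.
apply: (@dq_linear_uniq K 0 1 0); rewrite ?fps1 ?fps0 ?mul0r ?oner_neq0 //.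
- by rewrite dqM dq_fG dq_fH; ring.
- by rewrite dq1 mulr0.
by move=> n; rewrite leqn0 => /eqP ->; rewrite fpsM0 fG_0 fH_0 mulr1.
Qed.

Let VGH : V fG * V fH = 1.
Proof. by rewrite -fps_subM // fGH fps_sub1. Qed.

Definition fX : fps K := fun n => (n == 1%N)%:R.
(* fa, fb3 and fs are the a, b and s of the header: at q = e^(2 pi i tau) the
   last one is 27 (eta(3 tau)/eta(tau))^12 = - 1/u. *)
Definition fs : fps K := 27%:R * fX * (V fG ^+ 12 * fH ^+ 12).
Definition fb3 : fps K := fG ^+ 9 * V fH ^+ 3.
Definition fb3i : fps K := fH ^+ 9 * V fG ^+ 3.
Definition fa : fps K := fB * fb3i.

Lemma fb3_fb3i : fb3 * fb3i = 1.
Proof.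
transitivity ((fG * fH) ^+ 9 * (V fG * V fH) ^+ 3); first by rewrite /fb3 /fb3i; ring.
by rewrite fGH VGH !expr1n mulr1.
Qed.

Let dqVG : dq (V fG) = - (3%:R * V S1) * V fG.
Proof. by rewrite dq_sub // dq_fG fps_subM // fps_subN; ring. Qed.
Let dqVH : dq (V fH) = (3%:R * V S1) * V fH.
Proof. by rewrite dq_sub // dq_fH fps_subM //; ring. Qed.

Lemma dq_fb3 : 4%:R * dq fb3 = fb3 * (fE2 - fA).
Proof. by rewrite /fb3 /fE2 /fA dqM !dqX dq_fG dqVH /=; ring. Qed.

Let dq_fb3i : 4%:R * dq fb3i = - fb3i * (fE2 - fA).
Proof. by rewrite /fb3i /fE2 /fA dqM !dqX dq_fH dqVG /=; ring. Qed.

Lemma dq_fs : dq fs = fA * fs.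
Proof.
have dX : dq fX = fX.
  by apply/funext => n; rewrite /dq /fX; case: eqP => [->|]; rewrite ?mul1r ?mulr0.
have -> : fs = 27%:R * (fX * (V fG ^+ 12 * fH ^+ 12)) by rewrite /fs; ring.
by rewrite dqMn [dq (fX * _)]dqM [dq (V fG ^+ 12 * _)]dqM !dqX dX dq_fH dqVG /fA /=; ring.
Qed.

Let fb3i0 : fb3i 0%N = 1.
Proof. by rewrite /fb3i fpsM0 !fpsX0 fps_sub_0 fG_0 fH_0 !expr1n mulr1. Qed.
Let fa0 : fa 0%N = 1.
Proof.
by rewrite /fa fpsM0 fb3i0 /fB fpsD fpsB !fpsMn fps_sub_0 sig_0 fps1 /=; ring.
Qed.

(** The series a is defined as the quotient of B by b. Both a^2 and A solve A Dy = (DA) y and start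
    with 1, so they coincide. *)
Lemma fa_sqr : fa ^+ 2 = fA.
Proof.
apply: (@dq_linear_uniq K 0 fA (dq fA)); rewrite ?fA0 ?oner_neq0 //.
- by rewrite /dq !mul0r.
- rewrite dqX /= expr1; apply: (@fps_natI K 6) => //.
  transitivity (fa * (12%:R * (fA * dq fa))); first by ring.
  have -> : 12%:R * (fA * dq fa) = 4%:R * (3%:R * (fA * dq fB)) * fb3i + 3%:R * fA * fB * (4%:R * dq fb3i).
    by rewrite /fa dqM; ring.
  rewrite dq_fB dq_fb3i.
  transitivity ((6%:R * dq fA) * fa ^+ 2); last by ring.
  by rewrite dq_fA /fa; ring.
- by rewrite mulrC.
by move=> n; rewrite leqn0 => /eqP ->; rewrite fpsX0 fa0 fA0 expr1n.
Qed.

Lemma fB_fa : fB = fa * fb3.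
Proof. by rewrite /fa -mulrA [fb3i * _]mulrC fb3_fb3i mulr1. Qed.

Lemma dq_fa : 12%:R * dq fa = fa * fE2 - 4%:R * fb3 + 3%:R * fa ^+ 3.
Proof.
have e := dq_fA; rewrite -fa_sqr dqX /= fB_fa in e.
apply: (@fps_mulI K fa); rewrite ?fa0 ?oner_neq0 //.
transitivity (6%:R * (2%:R * fa ^+ 1 * dq fa)); first by ring.
by rewrite e; ring.
Qed.

Lemma fE4_ab : fE4 = 9%:R * fa ^+ 4 - 8%:R * (fa * fb3).
Proof. by rewrite HB -fa_sqr fB_fa; ring. Qed.

Lemma fE6_ab : fE6 = 36%:R * fa ^+ 3 * fb3 - 27%:R * fa ^+ 6 - 8%:R * fb3 ^+ 2.
Proof.
have e := E6A; rewrite -fa_sqr fB_fa in e.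
apply: (@fps_mulI K (fa ^+ 2)); rewrite ?fpsX0 ?fa0 ?expr1n ?oner_neq0 //.
by rewrite e; ring.
Qed.

(** The cubic theta identity of the Borweins: [fb3] and [fb3 * fs] are the cubes of their b and
    c. *)
Lemma fa_cube : fa ^+ 3 = fb3 * (1 + fs).
Proof.
have sG : fG 1%N = - 1.
  rewrite -[LHS]mul1r [LHS](dqsol_S (- S1) 0) big_ord_recl big_ord0 dqsol_0.
  by rewrite fpsN sig_1; ring.
have sH : fH 1%N = 1.
  rewrite -[LHS]mul1r [LHS](dqsol_S S1 0) big_ord_recl big_ord0 dqsol_0.
  by rewrite sig_1; ring.
have X0 : fX 0%N = 0 by []. have X1 : fX 1%N = 1 by [].
suff e : fa ^+ 3 - fb3 = fs * fb3 by rewrite mulrDr mulr1 [fb3 * fs]mulrC -e addrC subrK.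
(* Both sides solve 4 Dy = (E2 + 3A) y. The constant term of E2 + 3A is 4, so coefficient 1 is left
   free by the equation and indices 0 and 1 are compared by hand. *)
apply: (@dq_linear_uniq K 1 4%:R (fE2 + 3%:R * fA)).
- by rewrite fps_nat pnatr_eq0.
- by rewrite fpsD fpsMn fA0 fps_nat /fE2 fpsB fpsMn sig_0 fps1 /=; ring.
- rewrite dqB dqX /=; transitivity (fa ^+ 2 * (12%:R * dq fa) - 4%:R * dq fb3); first by ring.
  by rewrite dq_fa dq_fb3 -fa_sqr; ring.
- rewrite dqM; transitivity (4%:R * dq fs * fb3 + fs * (4%:R * dq fb3)); first by ring.
  by rewrite dq_fb3 dq_fs; ring.
have fb30 : fb3 0%N = 1 by rewrite /fb3 fpsM0 !fpsX0 fps_sub_0 !expr1n mulr1.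
have fb31 : fb3 1%N = - 9.
  by rewrite /fb3 fpsM1 !fpsX0 !fpsX1 fps_sub_0 fps_sub_1 // fH_0 fG_0 sG !expr1n; ring.
have fb3i1 : fb3i 1%N = 9.
  by rewrite /fb3i fpsM1 !fpsX0 !fpsX1 fps_sub_0 fps_sub_1 // fH_0 fG_0 sH !expr1n; ring.
have fa1 : fa 1%N = 6.
  rewrite /fa fpsM1 fb3i0 fb3i1 /fB !fpsD !fpsN !fpsMn !fps_sub_0 fps_sub_1 // sig_0 sig_1 !fps1 /=; ring.
have s0 : fs 0%N = 0 by rewrite /fs fpsM0 fpsMn X0 mulr0 mul0r.
have s1 : fs 1%N = 27.
  rewrite /fs fpsM1 !fpsMn X0 X1 fpsM0 !fpsX0 fps_sub_0 fH_0 fG_0 !expr1n; ring.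
case=> [_|[_|//]].
  by rewrite fpsB fpsX0 fa0 fb30 fpsM0 s0; ring.
by rewrite fpsB fpsX1 fa0 fa1 fb31 fpsM1 s0 s1 fb30; ring.
Qed.

End Level3.

(** * Limits and series of complex numbers *)

Section Modulus.
Variable R : realType.
Implicit Types z w : R[i].

(** The norm of [R[i]] takes its values in [R[i]]; a modulus in R makes inequalities accessible to
    [lra] and [nra]. *)
Definition cmod z : R := Num.sqrt (complex.Re z ^+ 2 + complex.Im z ^+ 2).

Lemma normcE_cmod z : `|z| = (cmod z)%:C.
Proof. exact: normc_def. Qed.

Lemma cmod_ge0 z : 0 <= cmod z. Proof. exact: sqrtr_ge0. Qed.
Lemma cmodM z w : cmod (z * w) = cmod z * cmod w.
Proof. by apply: (@complexI R); rewrite rmorphM /= -!normcE_cmod normrM. Qed.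
Lemma cmod0 : cmod 0 = 0.
Proof. by apply: (@complexI R); rewrite -normcE_cmod normr0. Qed.
Lemma cmod1 : cmod 1 = 1.
Proof. by apply: (@complexI R); rewrite -normcE_cmod normr1. Qed.
Lemma cmodN z : cmod (- z) = cmod z.
Proof. by apply: (@complexI R); rewrite -!normcE_cmod normrN. Qed.
Lemma cmodV z : cmod z^-1 = (cmod z)^-1.
Proof. by apply: (@complexI R); rewrite fmorphV /= -!normcE_cmod normfV. Qed.
Lemma cmodX z n : cmod (z ^+ n) = cmod z ^+ n.
Proof. by apply: (@complexI R); rewrite rmorphXn /= -!normcE_cmod normrX. Qed.
Lemma cmodD z w : cmod (z + w) <= cmod z + cmod w.
Proof. by rewrite -lecR rmorphD /= -!normcE_cmod ler_normD. Qed.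
Lemma cmodB z w : cmod (z - w) <= cmod z + cmod w.
Proof. by rewrite -(cmodN w) cmodD. Qed.
Lemma cmodBC z w : cmod (z - w) = cmod (w - z).
Proof. by rewrite -opprB cmodN. Qed.
Lemma cmod_eq0 z : (cmod z == 0) = (z == 0).
Proof. by rewrite -[RHS]normr_eq0 normcE_cmod -(inj_eq (@complexI R)). Qed.
Lemma cmod_gt0 z : (0 < cmod z) = (z != 0).
Proof. by rewrite lt_def cmod_eq0 cmod_ge0 andbT. Qed.
Lemma cmodR (x : R) : cmod x%:C = `|x|.
Proof. by rewrite /cmod /= expr0n addr0 sqrtr_sqr. Qed.
Lemma cmod_nat n : cmod n%:R = n%:R.
Proof. by rewrite -(rmorph_nat (real_complex R)) cmodR normr_nat. Qed.
Lemma cmod_sqr z : cmod z ^+ 2 = complex.Re z ^+ 2 + complex.Im z ^+ 2.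
Proof. by rewrite sqr_sqrtr // addr_ge0 ?sqr_ge0. Qed.
Lemma Re_le_cmod z : `|complex.Re z| <= cmod z.
Proof.
rewrite -(ler_pXn2r (n := 2)) ?nnegrE ?cmod_ge0 ?normr_ge0 // cmod_sqr real_normK ?num_real //.
by rewrite lerDl sqr_ge0.
Qed.
Lemma Im_le_cmod z : `|complex.Im z| <= cmod z.
Proof.
rewrite -(ler_pXn2r (n := 2)) ?nnegrE ?cmod_ge0 ?normr_ge0 // cmod_sqr real_normK ?num_real //.
by rewrite lerDr sqr_ge0.
Qed.
Lemma cmod_le_ReIm z : cmod z <= `|complex.Re z| + `|complex.Im z|.
Proof.
rewrite {1}[z]complexE; apply: (le_trans (cmodD _ _)); rewrite cmodM !cmodR.
by rewrite (_ : cmod 'i%C = 1) ?mul1r // /cmod /= expr0n expr1n add0r sqrtr1.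
Qed.
Lemma cmod_sum (I : Type) (r : seq I) (P : pred I) (F : I -> R[i]) :
  cmod (\sum_(i <- r | P i) F i) <= \sum_(i <- r | P i) cmod (F i).
Proof.
elim/big_rec2: _ => [|i y x _ h]; first by rewrite cmod0.
by apply: (le_trans (cmodD _ _)); rewrite lerD2l.
Qed.
Lemma cmod_sub_ge z w : cmod z - cmod w <= cmod (z - w).
Proof. by rewrite lerBlDr; have := cmodD (z - w) w; rewrite subrK. Qed.

Lemma complexReD z w : complex.Re (z + w) = complex.Re z + complex.Re w.
Proof. by case: z; case: w. Qed.
Lemma complexImD z w : complex.Im (z + w) = complex.Im z + complex.Im w.
Proof. by case: z; case: w. Qed.
Lemma complexReN z : complex.Re (- z) = - complex.Re z. Proof. by case: z. Qed.
Lemma complexImN z : complex.Im (- z) = - complex.Im z. Proof. by case: z. Qed.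
Lemma complexReM z w : complex.Re (z * w) =
  complex.Re z * complex.Re w - complex.Im z * complex.Im w.
Proof. by case: z; case: w. Qed.
Lemma complexImM z w : complex.Im (z * w) =
  complex.Re z * complex.Im w + complex.Im z * complex.Re w.
Proof. by case: z; case: w. Qed.
Lemma complex_eqP z w :
  complex.Re z = complex.Re w -> complex.Im z = complex.Im w -> z = w.
Proof. by case: z; case: w => ? ? ? ? /= -> ->. Qed.
End Modulus.

Section Limits.
Variable R : realType.
Local Notation C := R[i].
Implicit Types (u w : nat -> C) (l : C) (v : nat -> R).

Definition clim u l := forall e : R, 0 < e ->
  exists n0 : nat, forall n, (n0 <= n)%N -> cmod (u n - l) < e.

Lemma clim_uniq u l l' : clim u l -> clim u l' -> l = l'.
Proof.
move=> h h'; apply/eqP; rewrite -subr_eq0 -cmod_eq0; apply/negPn/negP => n0.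
have e0 : 0 < cmod (l - l') / 2 by rewrite divr_gt0 // lt_def n0 cmod_ge0.
have [n1 h1] := h _ e0; have [n2 h2] := h' _ e0.
have := h1 (maxn n1 n2) (leq_maxl _ _); have := h2 (maxn n1 n2) (leq_maxr _ _).
set x := u _ => a b; have : cmod (l - l') <= cmod (x - l') + cmod (x - l).
  by rewrite (_ : l - l' = (x - l') - (x - l)) ?cmodB //; ring.
by lra.
Qed.

Lemma eq_clim u w l : (exists n0 : nat, forall n, (n0 <= n)%N -> u n = w n) ->
  clim u l -> clim w l.
Proof.
move=> [n0 uw] h e e0; have [n1 h1] := h e e0.
exists (maxn n0 n1) => n; rewrite geq_max => /andP[n0n n1n].
by rewrite -uw //; apply: h1.
Qed.

Lemma clim_cst l : clim (fun=> l) l.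
Proof. by move=> e e0; exists 0%N => n _; rewrite subrr cmod0. Qed.

Lemma climD u w l l' : clim u l -> clim w l' -> clim (fun n => u n + w n) (l + l').
Proof.
move=> h h' e e0; have e2 : 0 < e / 2 by rewrite divr_gt0.
have [n1 h1] := h _ e2; have [n2 h2] := h' _ e2.
exists (maxn n1 n2) => n; rewrite geq_max => /andP[/h1 a /h2 b].
rewrite (_ : _ - _ = (u n - l) + (w n - l')); last by ring.
by apply: le_lt_trans (cmodD _ _) _; lra.
Qed.

Lemma climMl c u l : clim u l -> clim (fun n => c * u n) (c * l).
Proof.
move=> h e e0; have c1 : 0 < cmod c + 1 by have := cmod_ge0 c; lra.
have [n1 h1] := h _ (divr_gt0 e0 c1); exists n1 => n /h1.
rewrite -mulrBr cmodM ltr_pdivlMr // => hh; apply: le_lt_trans hh.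
by rewrite mulrC ler_wpM2l ?cmod_ge0 //; have := cmod_ge0 c; lra.
Qed.

Lemma climN u l : clim u l -> clim (fun n => - u n) (- l).
Proof. by move=> h e /h[n0 h0]; exists n0 => n /h0; rewrite -opprD cmodN. Qed.

Lemma climB u w l l' : clim u l -> clim w l' -> clim (fun n => u n - w n) (l - l').
Proof. by move=> h /climN h'; exact: climD h h'. Qed.

Lemma clim_bounded u l : clim u l ->
  exists M : R, 0 < M /\ exists n0 : nat, forall n, (n0 <= n)%N -> cmod (u n) <= M.
Proof.
move=> h; have [n0 h0] := h 1 ltr01; exists (cmod l + 1).
split; first by have := cmod_ge0 l; lra.
exists n0 => n /h0 hn; have := cmodD (u n - l) l; rewrite subrK; lra.
Qed.

Lemma climM u w l l' : clim u l -> clim w l' -> clim (fun n => u n * w n) (l * l').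
Proof.
move=> h h'; have [M [M0 [n0 hM]]] := clim_bounded h.
have h1 : clim (fun n => u n * (w n - l')) 0.
  move=> e e0; have [n1 h1] := h' _ (divr_gt0 e0 M0).
  exists (maxn n0 n1) => n; rewrite geq_max => /andP[/hM a /h1].
  rewrite subr0 cmodM ltr_pdivlMr // => b; apply: le_lt_trans b.
  by rewrite mulrC ler_wpM2l ?cmod_ge0.
rewrite [l * l']mulrC -[l' * l]add0r; apply: eq_clim (climD h1 (climMl l' h)).
by exists 0%N => n _; ring.
Qed.

Lemma climX u l k : clim u l -> clim (fun n => u n ^+ k) (l ^+ k).
Proof.
move=> h; elim: k => [|k ih]; first exact: clim_cst.
rewrite exprS; apply: eq_clim (climM h ih).
by exists 0%N => n _; rewrite exprS.
Qed.

Lemma climV u l : l != 0 -> clim u l -> clim (fun n => (u n)^-1) l^-1.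
Proof.
move=> l0 h e e0; have L0 : 0 < cmod l by rewrite cmod_gt0.
have [n0 h0] := h _ (divr_gt0 L0 (ltr0n _ 2)).
have d0 : 0 < e * (cmod l * (cmod l / 2)) by rewrite !mulr_gt0 // invr_gt0.
have [n1 h1] := h _ d0; exists (maxn n0 n1) => n; rewrite geq_max => /andP[/h0 a /h1 b].
have U : cmod l / 2 <= cmod (u n).
  by have := cmod_sub_ge l (u n); rewrite cmodBC in a; lra.
have u0 : u n != 0 by rewrite -cmod_gt0; lra.
rewrite (_ : _ - _ = (l - u n) / (u n * l)); last by field; apply/andP.
rewrite cmodM cmodV cmodM cmodBC ltr_pdivrMr; last by rewrite mulr_gt0 // cmod_gt0.
apply: lt_le_trans b _; rewrite ler_pM2l // [leRHS]mulrC.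
by rewrite ler_pM2l.
Qed.

Lemma clim_shift u l k : clim u l -> clim (fun n => u (n + k)%N) l.
Proof. by move=> h e /h[n0 h0]; exists n0 => n nn; apply: h0; lia. Qed.

Lemma clim_unshift u l k : clim (fun n => u (n + k)%N) l -> clim u l.
Proof.
move=> h e /h[n0 h0]; exists (n0 + k)%N => n nn.
by have := h0 (n - k)%N; rewrite subnK; [apply; lia | lia].
Qed.

Lemma clim_cmod_le u l M : clim u l -> (forall n, cmod (u n) <= M) -> cmod l <= M.
Proof.
move=> h hM; apply/ler_addgt0Pr => e e0; have [n0 h0] := h e e0.
have := h0 n0 (leqnn _); have := hM n0; have := cmodD (u n0) (l - u n0).
rewrite addrC subrK cmodBC; lra.
Qed.

Lemma harmonic_small (e : R) : 0 < e -> exists n0 : nat, forall n, (n0 <= n)%N -> n.+1%:R^-1 < e.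
Proof.
move=> e0; exists (Num.truncn e^-1).+1 => n nn.
rewrite invf_plt ?posrE ?ltr0n //; apply: lt_trans (truncnS_gt _) _.
by rewrite ltr_nat.
Qed.

End Limits.

Section Series.
Variable R : realType.
Local Notation C := R[i].
Implicit Types (u w : nat -> C) (l : C) (v : nat -> R).

Definition summable v :=
  (forall n, 0 <= v n) /\ exists M : R, forall n, \sum_(i < n) v i <= M.

Lemma summable_cauchy v (e : R) : summable v -> 0 < e ->
  exists n0 : nat, forall n, (n0 <= n)%N -> \sum_(n0 <= i < n) v i < e.
Proof.
move=> [v0 [M hM]] e0.
pose S := [set x | exists n, x = \sum_(i < n) v i]%classic.
have hS : has_sup S.
  by split; [exists 0, 0%N; rewrite big_ord0 | exists M => x [n ->]].
have [x [n0 ->] hx] := sup_adherent e0 hS; exists n0 => n n0n.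
have : \sum_(i < n) v i <= sup S by apply: ub_le_sup; [case: hS | exists n].
rewrite -(big_mkord xpredT v) (big_cat_nat (n := n0)) //= big_mkord; lra.
Qed.

Lemma summable_le v v' : (forall n, 0 <= v n) -> (forall n, v n <= v' n) ->
  summable v' -> summable v.
Proof.
move=> v0 vv [_ [M hM]]; split => //; exists M => n.
by apply: le_trans (hM n); apply: ler_sum.
Qed.

Lemma summableZ c v : 0 <= c -> summable v -> summable (fun n => c * v n).
Proof.
move=> c0 [v0 [M hM]]; split => [n|]; first exact: mulr_ge0.
by exists (c * M) => n; rewrite -mulr_sumr ler_wpM2l.
Qed.

Lemma summableD v v' : summable v -> summable v' -> summable (fun n => v n + v' n).
Proof.
move=> [v0 [M hM]] [v0' [M' hM']]; split => [n|]; first exact: addr_ge0.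
by exists (M + M') => n; rewrite big_split; apply: lerD; [exact: hM | exact: hM'].
Qed.

Definition csums u l := clim (fun n => \sum_(i < n) u i) l.
(** Total by convention: the value is 0 when the partial sums do not converge. *)
Definition csum u : C := xget 0 [set l | csums u l]%classic.

Lemma csums_csum u l : csums u l -> csum u = l.
Proof.
move=> h; have : csums u (csum u) by exact: (@xgetPex _ 0 [set l' | csums u l']%classic (ex_intro _ l h)).
by move=> h'; exact: clim_uniq h' h.
Qed.

Lemma real_csums_ge0 v : summable v -> exists l : R, csums (fun n => (v n)%:C) l%:C.
Proof.
move=> sv; have [v0 [M hM]] := sv.
pose S := [set x | exists n, x = \sum_(i < n) v i]%classic.
have hS : has_sup S.
  by split; [exists 0, 0%N; rewrite big_ord0 | exists M => x [n ->]].
exists (sup S) => e e0; have [x [n0 ->] hx] := sup_adherent e0 hS; exists n0 => n n0n.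
have h1 : \sum_(i < n) v i <= sup S by apply: ub_le_sup; [case: hS | exists n].
have h2 : \sum_(i < n0) v i <= \sum_(i < n) v i.
  rewrite -!(big_mkord xpredT v) [leRHS](big_cat_nat (n := n0)) //= lerDl.
  by apply: sumr_ge0 => i _.
rewrite -rmorph_sum -rmorphB cmodR ltr_norml; lra.
Qed.

Lemma csumsD u w l l' : csums u l -> csums w l' -> csums (fun n => u n + w n) (l + l').
Proof.
move=> h h'; apply: eq_clim (climD h h').
by exists 0%N => n _; rewrite big_split.
Qed.

Lemma csumsMl c u l : csums u l -> csums (fun n => c * u n) (c * l).
Proof.
move=> h; apply: eq_clim (climMl c h).
by exists 0%N => n _; rewrite mulr_sumr.
Qed.

Lemma csumsN u l : csums u l -> csums (fun n => - u n) (- l).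
Proof.
move=> h; apply: eq_clim (climN h).
by exists 0%N => n _; rewrite sumrN.
Qed.

Definition dominated u := exists2 v, summable v & forall n, cmod (u n) <= v n.

Lemma dominatedD u w : dominated u -> dominated w -> dominated (fun n => u n + w n).
Proof.
move=> [v sv uv] [v' sv' wv']; exists (fun n => v n + v' n); first exact: summableD.
by move=> n; apply: le_trans (cmodD _ _) (lerD _ _).
Qed.

Lemma dominatedN u : dominated u -> dominated (fun n => - u n).
Proof. by move=> [v sv uv]; exists v => [//|n]; rewrite cmodN. Qed.

Lemma dominated_tail u : dominated u -> dominated (fun n => u n.+1).
Proof.
move=> [v [v0 [M hM]] uv]; exists (fun n => v n.+1) => [|n]; last exact: uv.
split=> [n|]; first exact: v0.
by exists M => n; apply: le_trans (hM n.+1); rewrite big_ord_recl lerDr; exact: v0.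
Qed.

Lemma dominated_csums u : dominated u -> csums u (csum u).
Proof.
move=> [v sv uv]; suff [l hl] : exists l, csums u l by rewrite (csums_csum hl).
have v0 n : 0 <= v n by apply: le_trans (uv n); apply: cmod_ge0.
have [lv hv] := real_csums_ge0 sv.
have aux (f : C -> R) : (forall z, `|f z| <= cmod z) ->
    exists l : R, csums (fun n => (f (u n))%:C) l%:C.
  move=> fz; have [|l hl] := @real_csums_ge0 (fun n => f (u n) + v n).
    have s2 : summable (fun n => v n + v n) by exact: summableD.
    by apply: summable_le s2 => n; have := le_trans (fz (u n)) (uv n); rewrite ler_norml; lra.
  exists (l - lv); rewrite rmorphB /=; apply: eq_clim (climB hl hv); exists 0%N => n _.
  rewrite -sumrB; apply: eq_bigr => i _; rewrite -rmorphB; congr (_%:C); ring.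
have [a ha] := aux _ (@Re_le_cmod R); have [b hb] := aux _ (@Im_le_cmod R).
exists (a%:C + 'i%C * b%:C); apply: eq_clim (csumsD ha (csumsMl 'i%C hb)).
by exists 0%N => n _; apply: eq_bigr => i _; rewrite -complexE.
Qed.

Lemma csum_finite u m : (forall n, (m <= n)%N -> u n = 0) -> csum u = \sum_(i < m) u i.
Proof.
move=> h; apply: csums_csum; apply: eq_clim (@clim_cst R _); exists m => n mn.
rewrite -!(big_mkord xpredT u) [RHS](big_cat_nat (n := m)) //= [X in _ = _ + X]big_nat [X in _ = _ + X]big1 ?addr0 //.
by move=> i /andP[/h].
Qed.

Lemma eq_csum u w : u =1 w -> csum u = csum w.
Proof. by move=> /funext ->. Qed.

Lemma csumD u w : dominated u -> dominated w -> csum (fun n => u n + w n) = csum u + csum w.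
Proof. by move=> /dominated_csums h /dominated_csums h'; apply: csums_csum (csumsD h h'). Qed.
Lemma csumMl c u : dominated u -> csum (fun n => c * u n) = c * csum u.
Proof. by move=> /dominated_csums h; apply: csums_csum (csumsMl c h). Qed.
Lemma csumN u : dominated u -> csum (fun n => - u n) = - csum u.
Proof. by move=> /dominated_csums h; apply: csums_csum (csumsN h). Qed.

Lemma csum_recl u : dominated u -> csum u = u 0%N + csum (fun n => u n.+1).
Proof.
move=> /dominated_csums h; apply/eqP; rewrite addrC -subr_eq eq_sym; apply/eqP.
apply: csums_csum; apply: eq_clim (climB (clim_shift 1 h) (clim_cst (u 0%N))).
by exists 0%N => n _; rewrite addn1 big_ord_recl /= addrC addKr.
Qed.

Lemma cmod_csum u v : summable v -> (forall n, cmod (u n) <= v n) ->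
  forall M, (forall n, \sum_(i < n) v i <= M) -> cmod (csum u) <= M.
Proof.
move=> sv uv M hM; have h := dominated_csums (ex_intro2 _ _ v sv uv).
apply: clim_cmod_le h _ => n; apply: le_trans (hM n).
by apply: le_trans (cmod_sum _ _ _) _; apply: ler_sum.
Qed.

(** Dominated convergence for series: the majorant makes all tails small at once, and the finitely
    many remaining terms converge one by one. Products, exchanges of sums, Euler's product and
    partial fractions all rest on it. *)
Lemma tannery (u : nat -> nat -> C) w v : summable v ->
  (exists k0 : nat, forall k n, (k0 <= k)%N -> cmod (u k n) <= v n) ->
  (forall n, clim (fun k => u k n) (w n)) ->
  clim (fun k => csum (u k)) (csum w).
Proof.
move=> sv [k0 uv] uw.
have wv n : cmod (w n) <= v n.
  apply: (clim_cmod_le (clim_shift k0 (uw n))) => k; apply: uv; lia.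
move=> e e0; have e3 : 0 < e / 4 by rewrite divr_gt0.
have [n0 hn0] := summable_cauchy sv e3.
have tail y : (forall n, cmod (y n) <= v n) -> cmod (csum y - \sum_(i < n0) y i) <= e / 4.
  move=> yv; have h := dominated_csums (ex_intro2 _ _ v sv yv).
  apply: (clim_cmod_le (clim_shift n0 (climB h (clim_cst (\sum_(i < n0) y i))))) => n.
  rewrite -!(big_mkord xpredT y) (big_cat_nat (n := n0)) ?leq_addl //= addrAC subrr add0r.
  apply: ltW; apply: le_lt_trans (hn0 _ (leq_addl n n0)).
  by apply: le_trans (cmod_sum _ _ _) _; apply: ler_sum.
have hsum : clim (fun k => \sum_(i < n0) u k i) (\sum_(i < n0) w i).
  elim: n0 {hn0 tail} => [|m ih].
    by apply: eq_clim (clim_cst _); exists 0%N => k _; rewrite !big_ord0.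
  rewrite big_ord_recr; apply: eq_clim (climD ih (uw m)).
  by exists 0%N => k _; rewrite big_ord_recr.
have [k1 hk1] := hsum _ e3; exists (maxn k0 k1) => k; rewrite geq_max => /andP[kk0 kk1].
have t1 := tail _ (fun n => uv k n kk0); have t2 := tail _ wv; have t3 := hk1 k kk1.
rewrite (_ : _ - _ = (csum (u k) - \sum_(i < n0) u k i) +
  ((\sum_(i < n0) u k i - \sum_(i < n0) w i) - (csum w - \sum_(i < n0) w i))); last by ring.
apply: le_lt_trans (cmodD _ _) _; have := cmodB (\sum_(i < n0) u k i - \sum_(i < n0) w i) (csum w - \sum_(i < n0) w i).
by lra.
Qed.

Lemma csum_sum m (u : nat -> nat -> C) : (forall k, dominated (u k)) ->
  csum (fun n => \sum_(k < m) u k n) = \sum_(k < m) csum (u k).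
Proof.
move=> hu; elim: m => [|m ih].
  by rewrite big_ord0 (@csum_finite _ 0) ?big_ord0 // => n _; rewrite big_ord0.
rewrite big_ord_recr /= -ih.
have hs : csums (fun n => \sum_(k < m) u k n) (csum (fun n => \sum_(k < m) u k n)).
  elim: m {ih} => [|m ih].
    apply: eq_clim (clim_cst _); exists 0%N => n _.
    by rewrite (@csum_finite _ 0) ?big_ord0 ?big1 // => *; rewrite big_ord0.
  have := csumsD ih (dominated_csums (hu m)) => h.
  have e : (fun n => \sum_(k < m) u k n + u m n) = (fun n => \sum_(k < m.+1) u k n).
    by apply/funext => n; rewrite big_ord_recr.
  by rewrite e in h; rewrite (csums_csum h).
have := csums_csum (csumsD hs (dominated_csums (hu m))) => <-.
by apply: eq_csum => n; rewrite big_ord_recr.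
Qed.

Lemma csum_exchange (g : nat -> nat -> C) (v v' : nat -> R) :
  summable v -> summable v' -> (forall m n, cmod (g m n) <= v m * v' n) ->
  csum (fun m => csum (g m)) = csum (fun n => csum (fun m => g m n)).
Proof.
move=> sv sv' gv; have [v0 [M hM]] := sv; have [v0' [M' hM']] := sv'.
have M0 : 0 <= M by apply: le_trans (hM 0%N); rewrite big_ord0.
have domr m : dominated (g m) by exists (fun n => v m * v' n) => //; apply: summableZ.
have doml n : dominated (fun m => g m n).
  by exists (fun m => v' n * v m); [exact: summableZ | move=> m; rewrite mulrC].
apply: csums_csum; apply: (@eq_clim _ (fun m => csum (fun n => \sum_(i < m) g i n))).
  by exists 0%N => m _; rewrite csum_sum.
apply: (@tannery _ _ (fun n => M * v' n)); first exact: summableZ.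
  exists 0%N => m n _; apply: le_trans (cmod_sum _ _ _) _.
  apply: (@le_trans _ _ (\sum_(i < m) v i * v' n)); first exact: ler_sum.
  by rewrite -mulr_suml ler_wpM2r.
by move=> n; apply: dominated_csums.
Qed.

End Series.

Section Geometric.
Variable R : realType.
Implicit Types r t : R.

Lemma geo_sumE r n : (1 - r) * \sum_(i < n) r ^+ i = 1 - r ^+ n.
Proof.
elim: n => [|n ih]; first by rewrite big_ord0 expr0 mulr0 subrr.
by rewrite big_ord_recr /= mulrDr ih exprS; ring.
Qed.

Lemma geo_sum_le r n : 0 <= r < 1 -> \sum_(i < n) r ^+ i <= (1 - r)^-1.
Proof.
move=> /andP[r0 r1]; have d0 : 0 < 1 - r by lra.
rewrite -[leRHS]mul1r ler_pdivlMr // mulrC geo_sumE.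
by rewrite gerBl exprn_ge0.
Qed.

Lemma summable_geo r : 0 <= r < 1 -> summable (fun n => r ^+ n).
Proof.
move=> h; split=> [n|]; first by rewrite exprn_ge0 //; lra.
by exists (1 - r)^-1 => n; exact: geo_sum_le.
Qed.

(** n r^n consists of n copies of r^n, each at most r^i for i < n. The bound yields the decay of r^n
    and absorbs the factor n created by [dq]. *)
Lemma natmul_geo_le r n : 0 <= r < 1 -> n%:R * r ^+ n <= (1 - r)^-1.
Proof.
move=> h; have /andP[r0 r1] := h; apply: le_trans (geo_sum_le n h).
have -> : n%:R * r ^+ n = \sum_(i < n) r ^+ n by rewrite sumr_const card_ord mulr_natl.
by apply: ler_sum => i _; rewrite (ler_wiXn2l r0 (ltW r1)) // ltnW.
Qed.

Lemma geo_small r (e : R) : 0 <= r < 1 -> 0 < e ->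
  exists n0 : nat, forall n, (n0 <= n)%N -> r ^+ n < e.
Proof.
move=> h e0; have /andP[r0 r1] := h.
have d0 : 0 < e * (1 - r) by rewrite mulr_gt0 // subr_gt0.
have [n0 h0] := harmonic_small d0; exists n0.+1 => -[//|n] nn.
have := natmul_geo_le n.+1 h; have := h0 n nn => h1 h2.
have n1 : 0 < n.+1%:R :> R by rewrite ltr0n.
have d1 : 0 < 1 - r by lra.
rewrite -(ltr_pM2l n1); apply: le_lt_trans h2 _.
rewrite -(ltr_pM2r d1) mulVf ?gt_eqF // -mulrA.
by move: h1; rewrite invf_plt ?posrE // -ltr_pdivrMr // mul1r.
Qed.

Lemma clim_geo (q : R[i]) : cmod q < 1 -> clim (fun n => q ^+ n) 0.
Proof.
move=> q1 e e0; have [|n0 h0] := @geo_small (cmod q) e _ e0; first by rewrite cmod_ge0.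
by exists n0 => n /h0; rewrite subr0 cmodX.
Qed.
End Geometric.

Lemma sum_triangle (V : nmodType) (F : nat -> nat -> V) N :
  \sum_(n < N) \sum_(i < n.+1) F i (n - i)%N = \sum_(i < N) \sum_(j < N - i) F i j.
Proof.
elim: N => [|N ih]; first by rewrite !big_ord0.
rewrite big_ord_recr /= ih [RHS]big_ord_recr /= subSnn [X in _ = _ + X]big_ord_recl big_ord0 addr0.
rewrite [X in _ + X = _]big_ord_recr /= subnn addrA; congr (_ + _).
rewrite -big_split /=; apply: eq_bigr => -[i iN] _ /=.
by rewrite subSn ?big_ord_recr // ltnW.
Qed.

(** * Evaluation of formal power series in the open unit disc *)

Section Evaluation.
Variable R : realType.
Local Notation C := R[i].
Implicit Types (f g : fps C) (q : C) (r : R).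

(* The radius of convergence of f is at least 1. *)
Definition rapid f := forall r, 0 <= r < 1 -> summable (fun n => cmod (f n) * r ^+ n).

Definition ev f q : C := csum (fun n => f n * q ^+ n).

Lemma rapid_le f g : (forall n, cmod (f n) <= cmod (g n)) -> rapid g -> rapid f.
Proof.
move=> fg hg r hr; have /andP[r0 r1] := hr; apply: summable_le (hg r hr) => n.
  by rewrite mulr_ge0 ?cmod_ge0 ?exprn_ge0.
by rewrite ler_wpM2r ?exprn_ge0.
Qed.

(** Boundedness at the intermediate radius s = (r + 1)/2 gives a geometric majorant of ratio r/s at
    radius r. *)
Lemma rapid_bounded f : (forall r, 0 < r < 1 -> exists M : R, forall n, cmod (f n) * r ^+ n <= M) ->
  rapid f.
Proof.
move=> h r /andP[r0 r1]; pose s := (r + 1) / 2.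
have s01 : 0 < s < 1 by rewrite /s; lra.
have [s0 s1] := andP s01; have [M hM] := h s s01.
have M0 : 0 <= M by apply: le_trans (hM 0%N); rewrite expr0 mulr1 cmod_ge0.
have rs : 0 <= r / s < 1.
  apply/andP; split; first by apply: divr_ge0; lra.
  by rewrite ltr_pdivrMr // mul1r /s; lra.
apply: summable_le (summableZ M0 (summable_geo rs)) => n.
  by rewrite mulr_ge0 ?cmod_ge0 ?exprn_ge0.
rewrite (_ : r ^+ n = s ^+ n * (r / s) ^+ n); last by rewrite -exprMn mulrC divfK ?gt_eqF.
by rewrite mulrA ler_wpM2r ?exprn_ge0 //; case/andP: rs.
Qed.

Lemma rapid_dominated f q : rapid f -> cmod q < 1 -> dominated (fun n => f n * q ^+ n).
Proof.
move=> hf q1; exists (fun n => cmod (f n) * cmod q ^+ n); last by move=> n; rewrite cmodM cmodX.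
by apply: hf; rewrite cmod_ge0.
Qed.

Lemma rapidD f g : rapid f -> rapid g -> rapid (f + g).
Proof.
move=> hf hg r hr; have /andP[r0 r1] := hr.
apply: summable_le (summableD (hf r hr) (hg r hr)) => n.
  by rewrite mulr_ge0 ?cmod_ge0 ?exprn_ge0.
by rewrite -mulrDl ler_wpM2r ?exprn_ge0 // cmodD.
Qed.

Lemma rapidN f : rapid f -> rapid (- f).
Proof. by apply: rapid_le => n; rewrite fpsN cmodN. Qed.
Lemma rapidB f g : rapid f -> rapid g -> rapid (f - g).
Proof. by move=> hf hg; apply: rapidD => //; exact: rapidN. Qed.

Lemma rapidM f g : rapid f -> rapid g -> rapid (f * g).
Proof.
move=> hf hg r hr; have /andP[r0 r1] := hr.
have [v0 [M hM]] := hf r hr; have [w0 [M' hM']] := hg r hr.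
have M0 : 0 <= M' by apply: le_trans (hM' 0%N); rewrite big_ord0.
split=> [n|]; first by rewrite mulr_ge0 ?cmod_ge0 ?exprn_ge0.
exists (M * M') => N.
apply: (@le_trans _ _ (\sum_(n < N) \sum_(i < n.+1)
   (cmod (f i) * r ^+ i) * (cmod (g (n - i)%N) * r ^+ (n - i)))).
  apply: ler_sum => n _; rewrite fpsM.
  apply: (@le_trans _ _ ((\sum_(i < n.+1) cmod (f i * g (n - i)%N)) * r ^+ n)).
    by rewrite ler_wpM2r ?exprn_ge0 // cmod_sum.
  rewrite mulr_suml; apply: ler_sum => -[i ilt] _ /=.
  have -> : r ^+ n = r ^+ i * r ^+ (n - i) by rewrite -exprD subnKC.
  by rewrite cmodM le_eqVlt; apply/orP; left; apply/eqP; ring.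
rewrite (sum_triangle (fun i j => (cmod (f i) * r ^+ i) * (cmod (g j) * r ^+ j))).
apply: (@le_trans _ _ (\sum_(i < N) (cmod (f i) * r ^+ i) * M')).
  by apply: ler_sum => i _; rewrite -mulr_sumr ler_wpM2l.
by rewrite -mulr_suml ler_wpM2r.
Qed.

Lemma rapid_nat k : rapid k%:R.
Proof.
apply: rapid_bounded => r /andP[r0 r1]; exists k%:R => n; rewrite fps_nat.
case: eqP => [->|_]; first by rewrite expr0 mulr1 cmod_nat.
by rewrite cmod0 mul0r ler0n.
Qed.
Lemma rapid1 : rapid 1. Proof. exact: (rapid_nat 1). Qed.
Lemma rapidX f k : rapid f -> rapid (f ^+ k).
Proof.
move=> hf; elim: k => [|k ih]; first by rewrite expr0; exact: rapid1.
by rewrite exprS; exact: rapidM.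
Qed.
Lemma rapidMn k f : rapid f -> rapid (k%:R * f).
Proof. by apply: rapidM; exact: rapid_nat. Qed.

Lemma rapid_dq f : rapid f -> rapid (dq f).
Proof.
move=> hf r /andP[r0 r1]; pose s := (r + 1) / 2.
have [s0 s1] : 0 < s /\ s < 1 by rewrite /s; lra.
have rs : 0 <= r / s < 1.
  apply/andP; split; first by apply: divr_ge0; lra.
  by rewrite ltr_pdivrMr // mul1r /s; lra.
have K0 : 0 <= (1 - r / s)^-1 by rewrite invr_ge0 subr_ge0 ltW //; case/andP: rs.
have hs : 0 <= s < 1 by rewrite (ltW s0).
apply: summable_le (summableZ K0 (hf s hs)) => n.
  by rewrite mulr_ge0 ?cmod_ge0 ?exprn_ge0.
rewrite /dq cmodM cmod_nat.
rewrite (_ : r ^+ n = s ^+ n * (r / s) ^+ n); last by rewrite -exprMn mulrC divfK ?gt_eqF.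
rewrite (_ : _ * _ = (n%:R * (r / s) ^+ n) * (cmod (f n) * s ^+ n)); last by ring.
by rewrite ler_wpM2r ?natmul_geo_le // mulr_ge0 ?cmod_ge0 ?exprn_ge0 // ltW.
Qed.

Lemma rapid_const1 : rapid (fun=> 1).
Proof.
apply: rapid_bounded => r /andP[r0 r1]; exists 1 => n.
by rewrite cmod1 mul1r exprn_ile1 // ltW.
Qed.

Lemma rapid_poly (f : fps C) k : (forall n, cmod (f n) <= n%:R ^+ k) -> rapid f.
Proof.
move=> h; apply: (@rapid_le _ (fun n => n%:R ^+ k)) => [n|].
  by rewrite cmodX cmod_nat.
elim: k {h} => [|k ih]; first by apply: rapid_le rapid_const1 => n; rewrite expr0.
by apply: rapid_le (rapid_dq ih) => n; rewrite /dq exprS.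
Qed.

Lemma rapid_sub m f : (0 < m)%N -> rapid f -> rapid (fps_sub m f).
Proof.
move=> m0 hf; apply: rapid_bounded => r /andP[r0 r1].
have hrm : 0 <= r ^+ m < 1 by rewrite exprn_ge0 ?ltW //= exprn_ilt1 ?ltW // -lt0n.
have [v0 [M hM]] := hf _ hrm; exists M => n; rewrite /fps_sub.
have M0 : 0 <= M by apply: le_trans (hM 0%N); rewrite big_ord0.
case: ifP => [/dvdnP[j ->]|_]; last by rewrite cmod0 mul0r.
rewrite mulnK // mulnC exprM; apply: le_trans (hM j.+1).
by rewrite big_ord_recr /= lerDr sumr_ge0.
Qed.

Lemma evD f g q : rapid f -> rapid g -> cmod q < 1 -> ev (f + g) q = ev f q + ev g q.
Proof.
move=> hf hg q1; rewrite /ev -csumD; try exact: rapid_dominated.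
by apply: eq_csum => n; rewrite fpsD mulrDl.
Qed.
Lemma evN f q : rapid f -> cmod q < 1 -> ev (- f) q = - ev f q.
Proof.
move=> hf q1; rewrite /ev -csumN; try exact: rapid_dominated.
by apply: eq_csum => n; rewrite fpsN mulNr.
Qed.
Lemma evB f g q : rapid f -> rapid g -> cmod q < 1 -> ev (f - g) q = ev f q - ev g q.
Proof. by move=> hf hg q1; rewrite evD // ?evN //; exact: rapidN. Qed.

Lemma ev_nat k q : ev k%:R q = k%:R.
Proof.
rewrite /ev (@csum_finite _ _ 1) => [|[//|n] _]; last by rewrite fps_nat mul0r.
by rewrite big_ord_recl big_ord0 fps_nat expr0 mulr1 addr0.
Qed.
Lemma ev1 q : ev 1 q = 1. Proof. exact: (ev_nat 1). Qed.

Lemma ev_at0 f : ev f 0 = f 0%N.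
Proof.
rewrite /ev (@csum_finite _ _ 1) => [|[//|n] _]; last by rewrite expr0n mulr0.
by rewrite big_ord_recl big_ord0 expr0 mulr1 addr0.
Qed.

(** Partial sums of the Cauchy product are triangular sums; read as a series in the outer index i
    with inner sums truncated at N - i, they converge by [tannery]. *)
Lemma evM f g q : rapid f -> rapid g -> cmod q < 1 -> ev (f * g) q = ev f q * ev g q.
Proof.
move=> hf hg q1; have df := rapid_dominated hf q1; have dg := rapid_dominated hg q1.
have hq : 0 <= cmod q < 1 by rewrite cmod_ge0.
have [_ [M hM]] := hg _ hq.
have M0 : 0 <= M by apply: le_trans (hM 0%N); rewrite big_ord0.
apply: csums_csum.
apply: (@eq_clim _ (fun N => csum (fun i => if (i < N)%N then
   f i * q ^+ i * \sum_(j < N - i) g j * q ^+ j else 0))).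
  exists 0%N => N _; rewrite (@csum_finite _ _ N) => [|n]; last by rewrite ltnNge => ->.
  transitivity (\sum_(i < N) \sum_(j < N - i) (f i * q ^+ i) * (g j * q ^+ j)).
    by apply: eq_bigr => i _; rewrite ltn_ord mulr_sumr.
  rewrite -(sum_triangle (fun i j => (f i * q ^+ i) * (g j * q ^+ j))).
  apply: eq_bigr => n _; rewrite fpsM mulr_suml; apply: eq_bigr => -[i ilt] _ /=.
  have -> : q ^+ n = q ^+ i * q ^+ (n - i) by rewrite -exprD subnKC.
  by ring.
rewrite [ev f q * _](_ : _ = csum (fun i => f i * q ^+ i * ev g q)); last first.
  by rewrite mulrC -csumMl //; apply: eq_csum => n; rewrite mulrC.
apply: (@tannery _ _ _ (fun n => M * (cmod (f n) * cmod q ^+ n))).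
- by apply: summableZ => //; exact: hf.
- exists 0%N => N i _; case: ifP => _; last first.
    by rewrite cmod0 mulr_ge0 // mulr_ge0 ?cmod_ge0 // exprn_ge0 ?cmod_ge0.
  rewrite cmodM [leRHS]mulrC cmodM cmodX ler_wpM2l ?(mulr_ge0, cmod_ge0, exprn_ge0) //.
  apply: le_trans (hM (N - i)%N); apply: le_trans (cmod_sum _ _ _) _.
  by apply: ler_sum => j _; rewrite cmodM cmodX.
move=> i; apply: (@eq_clim _ (fun N => f i * q ^+ i * \sum_(j < N - i) g j * q ^+ j)).
  by exists i.+1 => N ->.
apply: climMl; apply: (@clim_unshift _ _ _ i).
by apply: eq_clim (dominated_csums dg); exists 0%N => n _; rewrite addnK.
Qed.

Lemma evX f k q : rapid f -> cmod q < 1 -> ev (f ^+ k) q = ev f q ^+ k.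
Proof.
move=> hf q1; elim: k => [|k ih]; first by rewrite !expr0 ev1.
by rewrite !exprS evM ?ih //; exact: rapidX.
Qed.

Lemma evMn f k q : rapid f -> cmod q < 1 -> ev (k%:R * f) q = k%:R * ev f q.
Proof. by move=> hf q1; rewrite evM ?ev_nat //; exact: rapid_nat. Qed.

Lemma cmod_expr_lt1 q m : (0 < m)%N -> cmod q < 1 -> cmod (q ^+ m) < 1.
Proof. by move=> m0 q1; rewrite cmodX exprn_ilt1 ?cmod_ge0 // -lt0n. Qed.

Lemma ev_sub m f q : (0 < m)%N -> rapid f -> cmod q < 1 ->
  ev (fps_sub m f) q = ev f (q ^+ m).
Proof.
move=> m0 hf q1; have q1m := cmod_expr_lt1 m0 q1.
have := dominated_csums (rapid_dominated (rapid_sub m0 hf) q1) => h.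
apply: (@clim_uniq _ (fun n => \sum_(i < n * m) fps_sub m f i * q ^+ i)).
  move=> e e0; have [n0 h0] := h e e0; exists n0 => n nn.
  by apply: h0; apply: leq_trans nn _; rewrite leq_pmulr.
apply: eq_clim (dominated_csums (rapid_dominated hf q1m)); exists 0%N => n _.
elim: n => [|n ih]; first by rewrite mul0n !big_ord0.
rewrite big_ord_recr /= ih mulSn -[RHS](big_mkord xpredT (fun i => fps_sub m f i * q ^+ i)).
rewrite addnC (big_cat_nat (n := (n * m)%N)) ?leq_addr //= big_mkord; congr (_ + _).
rewrite big_ltn; last by lia.
rewrite {1}/fps_sub dvdn_mull // mulnK // -exprM mulnC big_nat big1 ?addr0 // => i ilt.
rewrite /fps_sub ifF ?mul0r //; apply/negP => /dvdnP[j ej]; subst i.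
by move: ilt; rewrite ltn_mul2r /=; nia.
Qed.

Lemma rapid_fX : rapid (fX C).
Proof.
apply: (@rapid_poly _ 1) => n; rewrite /fX expr1; case: eqP => [->|_]; first by rewrite cmod1.
by rewrite cmod0 ler0n.
Qed.

Lemma ev_fX q : ev (fX C) q = q.
Proof.
rewrite /ev (@csum_finite _ _ 2) => [|[|[|n]] // _]; last by rewrite /fX mul0r.
by rewrite !big_ord_recl big_ord0 /fX /= mul0r mul1r add0r addr0 expr1.
Qed.

Lemma divsum_cmod_le n (F : nat * nat -> C) (M : R) : 0 <= M ->
  (forall p, p \in box n -> cmod (F p) <= M) -> cmod (divsum n F) <= n%:R ^+ 2 * M.
Proof.
move=> M0 h; rewrite /divsum big_seq_cond; apply: le_trans (cmod_sum _ _ _) _.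
apply: (@le_trans _ _ (\sum_(p <- box n) M)).
  rewrite big_seq_cond [leRHS]big_seq; apply: le_trans (ler_sum _ (G := fun=> M) _) _.
    by move=> p /andP[/h].
  rewrite -big_seq_cond -[leRHS]big_seq big_mkcond; apply: ler_sum => p _.
  by case: ifP.
by rewrite big_const_seq count_predT size_allpairs !size_iota iter_addr_0 -[leLHS]mulr_natl natrM expr2.
Qed.

Lemma rapid_sig k : rapid (sig C k).
Proof.
apply: (@rapid_poly _ (2 + k)) => n; rewrite exprD; apply: divsum_cmod_le.
  by rewrite exprn_ge0 ?ler0n.
move=> -[a x]; rewrite mem_box /= => h; rewrite cmodX cmod_nat.
by rewrite lerXn2r ?nnegrE ?ler0n // ler_nat; lia.
Qed.

Lemma clim_comp (u : nat -> C) l (m : nat -> nat) : clim u l ->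
  (forall n0, exists k0 : nat, forall k, (k0 <= k)%N -> (n0 <= m k)%N) ->
  clim (fun k => u (m k)) l.
Proof.
move=> h hm e /h[n0 h0]; have [k0 hk] := hm n0.
by exists k0 => k /hk; apply: h0.
Qed.

Lemma csums_geo (z : C) : cmod z < 1 -> csums (fun n => z ^+ n) (1 - z)^-1.
Proof.
move=> z1; have z0 : 1 - z != 0.
  by rewrite subr_eq0; apply/eqP => e; rewrite -e cmod1 ltxx in z1.
rewrite (_ : (1 - z)^-1 = (1 - 0) * (1 - z)^-1); last by rewrite subr0 mul1r.
apply: eq_clim (climM (climB (clim_cst 1) (clim_geo z1)) (clim_cst (1 - z)^-1)).
exists 0%N => n _; apply: (mulIf z0); rewrite divfK //.
elim: n => [|n ih]; first by rewrite big_ord0 expr0 mul0r subrr.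
by rewrite big_ord_recr /= mulrDl -ih exprS; ring.
Qed.

Lemma clim_lambert_inner (a : nat) q : (0 < a)%N -> cmod q < 1 ->
  clim (fun M => \sum_(x <- iota 1 M | (a * x < M)%N) q ^+ (a * x)) (q ^+ a / (1 - q ^+ a)).
Proof.
move=> a0 q1; have qa := cmod_expr_lt1 a0 q1.
have h := climMl (q ^+ a) (csums_geo qa).
apply: (@eq_clim _ (fun M => q ^+ a * \sum_(j < M.-1 %/ a) (q ^+ a) ^+ j)); last first.
  apply: (clim_comp (m := fun M => (M.-1 %/ a)%N) h) => n0.
  by exists (n0 * a).+1 => k hk; rewrite leq_divRL //; lia.
exists 1%N => M M0; set m := (M.-1 %/ a)%N.
have mM : (m <= M)%N by rewrite /m; apply: leq_trans (leq_div _ _) _; lia.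
have xm x : (a * x < M)%N = (x <= m)%N by rewrite /m leq_divRL // mulnC; lia.
rewrite -[M in iota 1 M](subnKC mM) iotaD big_cat /= [X in _ = _ + X]big_seq_cond.
rewrite [X in _ = _ + X]big1 ?addr0 => [|x]; last first.
  by rewrite mem_iota xm; lia.
rewrite mulr_sumr -(big_mkord xpredT (fun j => q ^+ a * (q ^+ a) ^+ j)).
rewrite /index_iota subn0 (iotaDl 1 0) big_map big_seq [RHS]big_seq_cond.
apply: eq_big => x; first by rewrite mem_iota xm; lia.
by move=> _; rewrite -exprM -exprD; congr (_ ^+ _); lia.
Qed.

(** Cutting the double series of a^k q^(ax) along ax < M gives exactly the M-th partial sum of the
    sigma_k series, and termwise in a it tends to the Lambert series. *)
Lemma lambert_csums k q : cmod q < 1 ->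
  csum (fun n => if n == 0%N then 0 else n%:R ^+ k * (q ^+ n / (1 - q ^+ n))) = ev (sig C k) q.
Proof.
move=> q1; apply: esym; apply: csums_csum.
have hq : 0 <= cmod q < 1 by rewrite cmod_ge0.
have c0 : 0 < 1 - cmod q by rewrite subr_gt0.
pose u M a := if (0 < a <= M)%N then
  a%:R ^+ k * \sum_(x <- iota 1 M | (a * x < M)%N) q ^+ (a * x) else 0.
apply: (@eq_clim _ (fun M => csum (u M))).
  exists 0%N => M _; rewrite (@csum_finite _ _ M.+1) => [|n]; last first.
    by rewrite /u => Mn; rewrite ifF //; lia.
  rewrite -(big_mkord xpredT (u M)) big_ltn // {1}/u add0r /index_iota subn1 /=.
  transitivity (\sum_(p <- box M | (p.1 * p.2 < M)%N) p.1%:R ^+ k * q ^+ (p.1 * p.2)).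
    rewrite [RHS]big_mkcond [RHS]big_allpairs_dep /=; apply: eq_big_seq => a; rewrite mem_iota => ha.
    rewrite /u ifT; last by lia.
    rewrite big_mkcond mulr_sumr; apply: eq_bigr => x _ /=.
    by case: (a * x < M)%N; rewrite ?mulr0.
  transitivity (\sum_(p <- box M) \sum_(m < M | (p.1 * p.2)%N == m) p.1%:R ^+ k * q ^+ m).
    rewrite big_mkcond /=; apply: eq_bigr => p _; case: ifP => hp.
      by rewrite (big_pred1 (Ordinal hp)) // => m; rewrite eq_sym.
    by rewrite big_pred0 // => -[m mM]; apply/negP => /eqP /= e; rewrite e mM in hp.
  rewrite (exchange_big_dep xpredT) //=; apply: eq_bigr => -[m mM] _ /=.
  by rewrite /sig (@divsum_widen _ M) 1?ltnW // mulr_suml.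
apply: (@tannery _ _ _ (fun a => (1 - cmod q)^-1 * (a%:R ^+ k * cmod q ^+ a))).
- apply: summableZ; first by rewrite invr_ge0 ltW.
  have hp : rapid (fun n => n%:R ^+ k) by apply: (@rapid_poly _ k) => n; rewrite cmodX cmod_nat.
  apply: summable_le (hp _ hq) => n; last by rewrite cmodX cmod_nat.
  by rewrite mulr_ge0 ?exprn_ge0 ?ler0n ?cmod_ge0.
- exists 0%N => M a _; rewrite /u; case: ifP => [/andP[a0 aM]|_]; last first.
    by rewrite cmod0 mulr_ge0 ?invr_ge0 ?(ltW c0) // mulr_ge0 ?exprn_ge0 ?ler0n ?cmod_ge0.
  rewrite cmodM cmodX cmod_nat mulrCA ler_wpM2l ?exprn_ge0 ?ler0n //.
  apply: le_trans (cmod_sum _ _ _) _.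
  apply: (@le_trans _ _ (\sum_(x <- iota 1 M) cmod q ^+ (a * x))).
    rewrite big_mkcond; apply: ler_sum => x _; case: ifP => _; first by rewrite cmodX.
    by rewrite exprn_ge0 ?cmod_ge0.
  rewrite (iotaDl 1 0) big_map.
  have -> : iota 0 M = index_iota 0 M by rewrite /index_iota subn0.
  rewrite big_mkord; apply: (@le_trans _ _ (\sum_(j < M) cmod q ^+ j * cmod q ^+ a)).
    apply: ler_sum => j _; rewrite -exprD; apply: ler_wiXn2l; rewrite ?cmod_ge0 ?ltW //; nia.
  by rewrite -mulr_suml ler_wpM2r ?exprn_ge0 ?cmod_ge0 // geo_sum_le.
case=> [|a] /=; first by apply: eq_clim (clim_cst _); exists 0%N.
apply: eq_clim (climMl (a.+1%:R ^+ k) (clim_lambert_inner (ltn0Sn a) q1)).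
by exists a.+1 => M aM; rewrite /u ifT.
Qed.
End Evaluation.

(** * Complex derivatives and Euler's product *)

Section ComplexDerivative.
Variable R : realType.
Local Notation C := R[i].
Implicit Types (f g : C -> C) (z w l m h : C).

(** Differentiability as an error estimate with real constants and no quotient, which makes the
    chain and product rules plain inequalities. *)
Definition cderiv f z l := forall e : R, 0 < e -> exists2 d : R, 0 < d &
  forall h, cmod h < d -> cmod (f (z + h) - f z - l * h) <= e * cmod h.

Definition ccont f z := forall e : R, 0 < e -> exists2 d : R, 0 < d &
  forall h, cmod h < d -> cmod (f (z + h) - f z) < e.

Definition cnear (P : C -> Prop) z := exists2 d : R, 0 < d &
  forall h, cmod h < d -> P (z + h).

Lemma cnear_and (P Q : C -> Prop) z : cnear P z -> cnear Q z -> cnear (fun w => P w /\ Q w) z.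
Proof.
move=> [d d0 hd] [d' d0' hd']; exists (Num.min d d'); first by rewrite lt_min d0.
by move=> h; rewrite lt_min => /andP[/hd ? /hd' ?].
Qed.

Lemma cnear_point (P : C -> Prop) z : cnear P z -> P z.
Proof. by move=> [d d0 /(_ 0)]; rewrite cmod0 addr0; apply. Qed.

Lemma eq_cderiv f g z l : cnear (fun w => f w = g w) z -> cderiv f z l -> cderiv g z l.
Proof.
move=> fg hf e e0; have fgz := cnear_point fg; have [d d0 hd] := fg.
have [d' d0' hd'] := hf e e0; exists (Num.min d d'); first by rewrite lt_min d0.
by move=> h; rewrite lt_min => /andP[/hd <- /hd' ?]; rewrite -fgz.
Qed.

Lemma cderiv_cst (c : C) z : cderiv (fun=> c) z 0.
Proof.
move=> e e0; exists 1 => // h _.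
by rewrite mul0r !subrr cmod0 mulr_ge0 ?cmod_ge0 // ltW.
Qed.

Lemma cderiv_id z : cderiv id z 1.
Proof.
move=> e e0; exists 1 => // h _.
by rewrite /= mul1r [z + h]addrC addrK subrr cmod0 mulr_ge0 ?cmod_ge0 // ltW.
Qed.

Lemma cderivD f g z l m : cderiv f z l -> cderiv g z m ->
  cderiv (fun w => f w + g w) z (l + m).
Proof.
move=> hf hg e e0; have e2 : 0 < e / 2 by rewrite divr_gt0.
have [d d0 hd] := hf _ e2; have [d' d0' hd'] := hg _ e2.
exists (Num.min d d'); first by rewrite lt_min d0.
move=> h; rewrite lt_min => /andP[/hd a /hd' b].
rewrite (_ : _ - _ = (f (z + h) - f z - l * h) + (g (z + h) - g z - m * h)); last by ring.
apply: le_trans (cmodD _ _) _; lra.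
Qed.

Lemma cderiv_lip f z l : cderiv f z l -> exists2 d : R, 0 < d &
  forall h, cmod h < d -> cmod (f (z + h) - f z) <= (cmod l + 1) * cmod h.
Proof.
move=> /(_ 1 ltr01)[d d0 hd]; exists d => // h /hd hh.
rewrite (_ : _ - _ = (f (z + h) - f z - l * h) + l * h); last by ring.
by apply: le_trans (cmodD _ _) _; rewrite cmodM; lra.
Qed.

Lemma cderiv_cont f z l : cderiv f z l -> ccont f z.
Proof.
move=> /cderiv_lip[d d0 hd] e e0.
have l1 : 0 < cmod l + 1 by have := cmod_ge0 l; lra.
exists (Num.min d (e / (cmod l + 1))); first by rewrite lt_min d0 divr_gt0.
move=> h; rewrite lt_min => /andP[/hd a b]; apply: le_lt_trans a _.
by rewrite mulrC -ltr_pdivlMr.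
Qed.

Lemma ccont_neq0 f z : ccont f z -> f z != 0 -> cnear (fun w => f w != 0) z.
Proof.
move=> hf fz0; have F0 : 0 < cmod (f z) by rewrite cmod_gt0.
have [d d0 hd] := hf _ F0; exists d => // h /hd; apply: contraTneq => ->.
by rewrite sub0r cmodN ltxx.
Qed.

Lemma ccont_cmod_lt f z r : ccont f z -> cmod (f z) < r -> cnear (fun w => cmod (f w) < r) z.
Proof.
move=> hf fz; have F0 : 0 < r - cmod (f z) by rewrite subr_gt0.
have [d d0 hd] := hf _ F0; exists d => // h /hd.
have := cmodD (f (z + h) - f z) (f z); rewrite subrK; lra.
Qed.

Lemma cderivM f g z l m : cderiv f z l -> cderiv g z m ->
  cderiv (fun w => f w * g w) z (l * g z + f z * m).
Proof.
move=> hf hg e e0.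
pose A := cmod (g z) + cmod l + cmod (f z) + 1.
have A0 : 0 < A by rewrite /A; have := cmod_ge0 (g z); have := cmod_ge0 l; have := cmod_ge0 (f z); lra.
pose e' := Num.min 1 (e / (3 * A)).
have e0' : 0 < e' by rewrite lt_min ltr01 divr_gt0 // mulr_gt0.
have [d d0 hd] := hf _ e0'; have [d' d0' hd'] := hg _ e0'.
have [d'' d0'' hd''] := cderiv_cont hg e0'.
exists (Num.min d (Num.min d' d'')); first by rewrite !lt_min d0 d0'.
move=> h; rewrite !lt_min => /and3P[/hd a /hd' b /hd'' c].
rewrite (_ : _ - _ = (f (z + h) - f z - l * h) * g (z + h) + l * h * (g (z + h) - g z)
   + f z * (g (z + h) - g z - m * h)); last by ring.
have G : cmod (g (z + h)) <= A.
  have := cmodD (g (z + h) - g z) (g z); rewrite subrK.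
  have : e' <= 1 by rewrite ge_min lexx.
  rewrite /A; have := cmod_ge0 l; have := cmod_ge0 (f z); lra.
have eA : 3 * (e' * A) <= e.
  have : e' <= e / (3 * A) by rewrite ge_min lexx orbT.
  by rewrite ler_pdivlMr ?mulr_gt0 //; lra.
have hh := cmod_ge0 h.
apply: le_trans (cmodD _ _) _; apply: le_trans (lerD (cmodD _ _) (lexx _)) _.
rewrite !cmodM.
have t1 : cmod (f (z + h) - f z - l * h) * cmod (g (z + h)) <= (e' * cmod h) * A.
  by apply: ler_pM => //; exact: cmod_ge0.
have t2 : cmod l * cmod h * cmod (g (z + h) - g z) <= A * cmod h * e'.
  apply: ler_pM; rewrite ?mulr_ge0 ?cmod_ge0 //; last exact: ltW.
  by rewrite ler_wpM2r // /A; have := cmod_ge0 (g z); have := cmod_ge0 (f z); lra.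
have t3 : cmod (f z) * cmod (g (z + h) - g z - m * h) <= A * (e' * cmod h).
  apply: ler_pM; rewrite ?cmod_ge0 //.
  by rewrite /A; have := cmod_ge0 (g z); have := cmod_ge0 l; lra.
have := ler_wpM2r hh eA; lra.
Qed.

Lemma cderivMl (c : C) f z l : cderiv f z l -> cderiv (fun w => c * f w) z (c * l).
Proof. by move=> h; have := cderivM (cderiv_cst c z) h; rewrite mul0r add0r. Qed.

Lemma cderivN f z l : cderiv f z l -> cderiv (fun w => - f w) z (- l).
Proof.
move=> h; rewrite -mulN1r; apply: eq_cderiv (cderivMl (-1) h).
by exists 1 => // h' _; rewrite mulN1r.
Qed.

Lemma cderivB f g z l m : cderiv f z l -> cderiv g z m ->
  cderiv (fun w => f w - g w) z (l - m).
Proof. by move=> hf hg; exact: cderivD hf (cderivN hg). Qed.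

Lemma cderivX f z l k : cderiv f z l ->
  cderiv (fun w => f w ^+ k) z (k%:R * f z ^+ k.-1 * l).
Proof.
move=> hf; elim: k => [|k ih]; first by rewrite !mul0r; exact: cderiv_cst.
have -> : k.+1%:R * f z ^+ k.+1.-1 * l = l * f z ^+ k + f z * (k%:R * f z ^+ k.-1 * l).
  by case: k {ih} => [|k] /=; rewrite ?expr0 -?natr1 ?exprS; ring.
by apply: eq_cderiv (cderivM hf ih); exists 1 => // h _; rewrite exprS.
Qed.

Lemma cderiv_inv z : z != 0 -> cderiv (fun w => w^-1) z (- (z ^+ 2)^-1).
Proof.
move=> z0 e e0; have Z0 : 0 < cmod z by rewrite cmod_gt0.
have K0 : 0 < e * cmod z ^+ 3 / 2 by rewrite !mulr_gt0 ?invr_gt0 ?exprn_gt0.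
exists (Num.min (cmod z / 2) (e * cmod z ^+ 3 / 2)); first by rewrite lt_min K0 divr_gt0.
move=> h; rewrite lt_min => /andP[a b].
have zh : cmod z / 2 <= cmod (z + h) by have := cmod_sub_ge z (- h); rewrite cmodN opprK; lra.
have zh0 : z + h != 0 by rewrite -cmod_gt0; lra.
rewrite (_ : _ - _ = (h / (z ^+ 2 * (z + h))) * h); last by field; apply/andP.
rewrite cmodM ler_wpM2r ?cmod_ge0 // cmodM cmodV cmodM cmodX ler_pdivrMr; last first.
  by rewrite mulr_gt0 ?exprn_gt0 // cmod_gt0.
apply: le_trans (ltW b) _.
rewrite (_ : _ / 2 = e * (cmod z ^+ 2 * (cmod z / 2))); last by ring.
by rewrite ler_pM2l // ler_pM2l // exprn_gt0.
Qed.

Lemma cderiv_comp f g z l m : cderiv g z l -> cderiv f (g z) m ->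
  cderiv (fun w => f (g w)) z (m * l).
Proof.
move=> hg hf e e0.
have l1 : 0 < cmod l + 1 by have := cmod_ge0 l; lra.
have m1 : 0 < cmod m + 1 by have := cmod_ge0 m; lra.
have [d1 d10 hd1] := hf _ (divr_gt0 (divr_gt0 e0 (ltr0n _ 2)) l1).
have [d2 d20 hd2] := hg _ (divr_gt0 (divr_gt0 e0 (ltr0n _ 2)) m1).
have [d3 d30 hd3] := cderiv_lip hg.
exists (Num.min d2 (Num.min d3 (d1 / (cmod l + 1)))); first by rewrite !lt_min d20 d30 divr_gt0.
move=> h; rewrite !lt_min => /and3P[/hd2 a /hd3 b]; rewrite ltr_pdivlMr // mulrC => c.
pose k := g (z + h) - g z.
have kd : cmod k < d1 by apply: le_lt_trans b c.
have gk : g (z + h) = g z + k by rewrite /k subrKC.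
have := hd1 _ kd; rewrite -gk => A.
rewrite (_ : _ - _ = (f (g (z + h)) - f (g z) - m * k) + m * (k - l * h)); last by rewrite /k; ring.
apply: le_trans (cmodD _ _) _; rewrite cmodM.
have t1 : e / 2 / (cmod l + 1) * cmod k <= e / 2 * cmod h.
  by rewrite -mulrA ler_pM2l ?divr_gt0 // mulrC ler_pdivrMr // mulrC.
have t2 : cmod m * cmod (k - l * h) <= e / 2 * cmod h.
  apply: (@le_trans _ _ ((cmod m + 1) * (e / 2 / (cmod m + 1) * cmod h))).
    by apply: ler_pM; rewrite ?cmod_ge0 //; lra.
  by rewrite mulrA (mulrC (cmod m + 1)) divfK // gt_eqF.
lra.
Qed.

Lemma cderivV f z l : f z != 0 -> cderiv f z l ->
  cderiv (fun w => (f w)^-1) z (- (l / f z ^+ 2)).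
Proof.
move=> fz hf; have := cderiv_comp hf (cderiv_inv fz).
by rewrite mulNr [_^-1 * l]mulrC.
Qed.

Lemma cderiv_div f g z l m : g z != 0 -> cderiv f z l -> cderiv g z m ->
  cderiv (fun w => f w / g w) z ((l * g z - f z * m) / g z ^+ 2).
Proof.
move=> gz hf hg; have := cderivM hf (cderivV gz hg).
by rewrite (_ : _ + _ = (l * g z - f z * m) / g z ^+ 2) //; field.
Qed.

(** The second order remainder of (q + h)^n is at most n^2 r^(n-2) |h|^2. Multiplying by r^2 and
    writing n q^n / q keeps truncated subtraction out of the exponents. *)
Lemma pow_taylor_bound (q h : C) (r : R) n : q != 0 -> 0 <= r <= 1 ->
  cmod q <= r -> cmod (q + h) <= r ->
  r ^+ 2 * cmod ((q + h) ^+ n - q ^+ n - n%:R * q ^+ n / q * h)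
    <= n%:R ^+ 2 * r ^+ n * cmod h ^+ 2.
Proof.
move=> q0 /andP[r0 r1] hq hqh; elim: n => [|n ih].
  by rewrite !expr0 !mul0r subr0 subrr cmod0 mulr0 expr0n !mul0r.
rewrite (_ : _ - _ = (q + h) * ((q + h) ^+ n - q ^+ n - n%:R * q ^+ n / q * h)
   + n%:R * q ^+ n / q * h ^+ 2); last by rewrite -natr1 !exprS; field.
have t2 : r ^+ 2 * cmod (n%:R * q ^+ n / q * h ^+ 2) <= n%:R * r ^+ n.+1 * cmod h ^+ 2.
  case: n {ih} => [|n]; first by rewrite !mul0r cmod0 mulr0.
  rewrite (_ : _ / q = n.+1%:R * q ^+ n); last by rewrite exprS; field.
  rewrite !cmodM !cmodX cmod_nat (_ : r ^+ 2 * _ = n.+1%:R * (r ^+ 2 * cmod q ^+ n) * cmod h ^+ 2).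
    rewrite ler_wpM2r ?exprn_ge0 ?cmod_ge0 // ler_wpM2l ?ler0n //.
    rewrite -[n.+2]/(2 + n)%N exprD ler_wpM2l ?exprn_ge0 //.
    by rewrite lerXn2r ?nnegrE ?cmod_ge0.
  by ring.
have t1 : r ^+ 2 * cmod ((q + h) * ((q + h) ^+ n - q ^+ n - n%:R * q ^+ n / q * h))
   <= n%:R ^+ 2 * r ^+ n.+1 * cmod h ^+ 2.
  rewrite cmodM mulrCA; apply: (@le_trans _ _ (r * (n%:R ^+ 2 * r ^+ n * cmod h ^+ 2))).
    by apply: ler_pM; rewrite ?cmod_ge0 ?mulr_ge0 ?exprn_ge0 ?cmod_ge0.
  by rewrite [r ^+ n.+1]exprS le_eqVlt; apply/orP; left; apply/eqP; ring.
apply: le_trans (ler_wpM2l (exprn_ge0 2 r0) (cmodD _ _)) _; rewrite mulrDr.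
apply: le_trans (lerD t1 t2) _; rewrite -!mulrDl ler_wpM2r ?exprn_ge0 ?cmod_ge0 //.
rewrite ler_wpM2r ?exprn_ge0 // -natr1; have := ler0n R n; nra.
Qed.

(** The remainders from [pow_taylor_bound] are dominated by the coefficients of D^2 f at a radius r
    halfway between |q| and 1. *)
Lemma cderiv_ev (f : fps C) q : rapid f -> q != 0 -> cmod q < 1 ->
  cderiv (ev f) q (ev (dq f) q / q).
Proof.
move=> hf q0 q1 e e0; pose r := (cmod q + 1) / 2.
have cq := cmod_ge0 q.
have r01 : 0 <= r < 1 by rewrite /r; lra.
have r0 : 0 < r by rewrite /r; lra.
have hr2 := rapid_dq (rapid_dq hf) r01; have [v0 [M hM]] := hr2.
have M0 : 0 <= M by apply: le_trans (hM 0%N); rewrite big_ord0.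
have M1 : 0 < M + 1 by lra.
have r20 : 0 < r ^+ 2 by rewrite exprn_gt0.
exists (Num.min (r - cmod q) (e * r ^+ 2 / (M + 1))).
  by rewrite lt_min subr_gt0 /r; apply/andP; split; [lra | rewrite divr_gt0 // mulr_gt0].
move=> h; rewrite lt_min => /andP[a b].
have qh : cmod (q + h) <= r by have := cmodD q h; lra.
have qh1 : cmod (q + h) < 1 by move: r01; lra.
have d1 := rapid_dominated hf qh1; have d2 := rapid_dominated hf q1.
have d3 := rapid_dominated (rapid_dq hf) q1.
have E : ev f (q + h) - ev f q - ev (dq f) q / q * h =
  csum (fun n => f n * ((q + h) ^+ n - q ^+ n - n%:R * q ^+ n / q * h)).
  apply/esym/csums_csum.
  have := csumsD (csumsD (dominated_csums d1) (csumsN (dominated_csums d2)))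
     (csumsN (csumsMl (h / q) (dominated_csums d3))).
  rewrite -/(ev f (q + h)) -/(ev f q) -/(ev (dq f) q).
  rewrite [h / q * _]mulrC [_ * (h / q)]mulrA mulrAC.
  apply: eq_clim; exists 0%N => n _; apply: eq_bigr => i _; rewrite /dq; ring.
rewrite E -(ler_pM2l r20).
have sv := summableZ (sqr_ge0 (cmod h)) hr2.
have csr : cmod (csum (fun n => (r ^+ 2)%:C * (f n * ((q + h) ^+ n - q ^+ n - n%:R * q ^+ n / q * h))))
     <= cmod h ^+ 2 * M.
  apply: (cmod_csum sv) => n; last by rewrite -mulr_sumr ler_wpM2l ?sqr_ge0.
  rewrite cmodM cmodR (ger0_norm (ltW r20)) cmodM mulrCA /dq !cmodM cmod_nat.
  have := @pow_taylor_bound q h r n q0 _ _ qh.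
  move=> /(_ _ _)/wrap[]; [by move: r01; lra | by rewrite /r; lra | move=> hb].
  apply: le_trans (ler_wpM2l (cmod_ge0 (f n)) hb) _.
  by rewrite le_eqVlt; apply/orP; left; apply/eqP; ring.
have dE : dominated (fun n => f n * ((q + h) ^+ n - q ^+ n - n%:R * q ^+ n / q * h)).
  exists (fun n => (r ^+ 2)^-1 * (cmod h ^+ 2 * (cmod (dq (dq f) n) * r ^+ n))).
    by apply: summableZ => //; rewrite invr_ge0 ltW.
  move=> n; rewrite [leRHS]mulrC ler_pdivlMr // [leLHS]mulrC cmodM mulrCA /dq !cmodM cmod_nat.
  have := @pow_taylor_bound q h r n q0 _ _ qh.
  move=> /(_ _ _)/wrap[]; [by move: r01; lra | by rewrite /r; lra | move=> hb].
  apply: le_trans (ler_wpM2l (cmod_ge0 (f n)) hb) _.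
  by rewrite le_eqVlt; apply/orP; left; apply/eqP; ring.
move: csr; rewrite csumMl // cmodM cmodR (ger0_norm (ltW r20)) => csr; apply: le_trans csr _.
rewrite expr2 -mulrA [leLHS]mulrC mulrA.
have hh := cmod_ge0 h.
have t : M * cmod h <= r ^+ 2 * e.
  by move: b; rewrite ltr_pdivlMr // => b; lra.
have := ler_wpM2r hh t; lra.
Qed.

(** Continuity also at q = 0, where [cderiv_ev] does not apply; limits at the cusp are read from
    constant terms this way. *)
Lemma ev_clim (f : fps C) (u : nat -> C) q : rapid f -> cmod q < 1 -> clim u q ->
  clim (fun k => ev f (u k)) (ev f q).
Proof.
move=> hf q1 hu; pose r := (cmod q + 1) / 2; have cq := cmod_ge0 q.
have r01 : 0 <= r < 1 by rewrite /r; lra.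
apply: (@tannery _ _ _ (fun n => cmod (f n) * r ^+ n)); first exact: hf.
  have d0 : 0 < r - cmod q by rewrite /r; lra.
  have [k0 hk] := hu _ d0; exists k0 => k n /hk hkn; rewrite cmodM cmodX.
  rewrite ler_wpM2l ?cmod_ge0 // lerXn2r ?nnegrE ?cmod_ge0 //; first by move: r01; lra.
  by have := cmodD (u k - q) q; rewrite subrK; lra.
by move=> n; apply: climMl; exact: climX.
Qed.

End ComplexDerivative.

Section EulerProduct.
Variable R : realType.
Local Notation C := R[i].
Implicit Types (c d f g : fps C).

(** With weights r^n the recursion bounds n |y_n| r^n by K times the maximum of the earlier terms, K
    being the sum for c at radius r. Once n exceeds K the maximum stops growing. *)
Lemma rapid_dqsol c : rapid c -> rapid (dqsol c).
Proof.
move=> hc; apply: rapid_bounded => r /andP[r0 r1].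
have hr : 0 <= r < 1 by rewrite ltW.
have [v0 [K hK]] := hc r hr; have K0 : 0 <= K by apply: le_trans (hK 0%N); rewrite big_ord0.
pose N := (Num.truncn K).+1.
have KN : K <= N%:R by apply: ltW; exact: truncnS_gt.
pose y n := cmod (dqsol c n) * r ^+ n.
have y0 n : 0 <= y n by rewrite mulr_ge0 ?cmod_ge0 ?exprn_ge0 // ltW.
exists (\sum_(i < N.+1) y i); set M := \sum_(_ < _) _ => n; rewrite -/(y n).
have M0 : 0 <= M by apply: sumr_ge0.
elim/ltn_ind: n => n ih; have [nN|Nn] := ltnP n N.+1.
  by rewrite /M (bigD1 (Ordinal nN)) //= lerDl sumr_ge0.
case: n Nn ih => // n Nn ih; have n1 : 0 < n.+1%:R :> R by rewrite ltr0n.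
rewrite -(ler_pM2l n1).
apply: (@le_trans _ _ (\sum_(k < n.+1) (cmod (c k.+1) * r ^+ k.+1) * M)).
  rewrite /y mulrA -[n.+1%:R]cmod_nat -cmodM dqsol_S.
  apply: le_trans (ler_wpM2r (exprn_ge0 _ (ltW r0)) (cmod_sum _ _ _)) _.
  rewrite mulr_suml; apply: ler_sum => -[k kn] _ /=.
  have -> : r ^+ n.+1 = r ^+ k.+1 * r ^+ (n - k) by rewrite -exprD; congr (_ ^+ _); lia.
  rewrite cmodM mulrACA ler_wpM2l ?mulr_ge0 ?cmod_ge0 ?exprn_ge0 ?(ltW r0) //.
  by apply: (ih (n - k)%N); lia.
rewrite -mulr_suml ler_wpM2r //.
apply: (@le_trans _ _ K); last by apply: le_trans KN _; rewrite ler_nat ltnW.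
apply: le_trans (hK n.+2); rewrite [leRHS]big_ord_recl /= lerDr.
by rewrite mulr_ge0 ?cmod_ge0 ?exprn_ge0 // ltW.
Qed.

(** The recursion has nonnegative weights, so majorants pass from c to the solution. The real
    majorant y is existential because [dqsol] is taken over the complex numbers. *)
Lemma dqsol_majorant c (e : nat -> R) : (forall n, cmod (c n) <= e n) ->
  forall n, exists2 y : R, dqsol (fun n => (e n)%:C) n = y%:C & cmod (dqsol c n) <= y.
Proof.
move=> ce; pose d : fps C := fun n => (e n)%:C; rewrite -/d.
elim/ltn_ind => -[_|n ih]; first by exists 1; rewrite dqsol_0 ?cmod1.
have n1 : n.+1%:R != 0 :> R by rewrite pnatr_eq0.
have n1C : n.+1%:R != 0 :> C by rewrite pnatr_eq0.
have hy k : (k < n.+1)%N -> dqsol d k = (complex.Re (dqsol d k))%:C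
    /\ cmod (dqsol c k) <= complex.Re (dqsol d k).
  by move=> /ih[y -> cy].
exists (n.+1%:R^-1 * \sum_(k < n.+1) e k.+1 * complex.Re (dqsol d (n - k)%N)).
  apply: (mulfI n1C); rewrite dqsol_S rmorphM /= fmorphV /= rmorph_nat mulVKf //.
  rewrite rmorph_sum; apply: eq_bigr => -[k kn] _ /=; rewrite rmorphM /=.
  by have [<- _] := hy (n - k)%N (leq_subr _ _).
have N0 : 0 < n.+1%:R :> R by rewrite ltr0n.
rewrite mulrC ler_pdivlMr // mulrC -[n.+1%:R]cmod_nat -cmodM dqsol_S.
apply: le_trans (cmod_sum _ _ _) _; apply: ler_sum => -[k kn] _ /=; rewrite cmodM.
have [_ h2] := hy (n - k)%N (leq_subr _ _).
by apply: ler_pM; rewrite ?cmod_ge0.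
Qed.

Lemma dqsol_local c d n : (forall m, (m <= n)%N -> c m = d m) -> dqsol c n = dqsol d n.
Proof.
elim/ltn_ind: n => -[//|n] ih cd.
have n1C : n.+1%:R != 0 :> C by rewrite pnatr_eq0.
apply: (mulfI n1C); rewrite !dqsol_S; apply: eq_bigr => -[k kn] _ /=.
by rewrite cd // ih //; [lia | move=> m mk; apply: cd; lia].
Qed.

Lemma fpsMX f n : (f * fX C) n = if n is m.+1 then f m else 0.
Proof.
rewrite fpsM; case: n => [|n]; first by rewrite big_ord_recl big_ord0 /fX mulr0 addr0.
rewrite big_ord_recr big_ord_recr /= big1 ?add0r => [|[i ilt] _ /=].
  by rewrite subnn subSnn /fX /= mulr1 mulr0 addr0.
by rewrite /fX (_ : (n.+1 - i == 1)%N = false) ?mulr0 //; lia.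
Qed.

Lemma fpsMXn f j n : (f * fX C ^+ j) n = if (j <= n)%N then f (n - j)%N else 0.
Proof.
elim: j n => [|j ih] n; first by rewrite expr0 mulr1 subn0.
by rewrite exprSr mulrA fpsMX; case: n => [//|n]; rewrite ih ltnS subSS.
Qed.

(** The expansion of j q^j / (1 - q^j), which is minus the logarithmic derivative D of 1 - q^j. *)
Let lterm j : fps C := fun m => if (0 < m)%N && (j %| m)%N then j%:R else 0.

Let ltermE j : (0 < j)%N -> lterm j * (1 - fX C ^+ j) = j%:R * fX C ^+ j.
Proof.
move=> j0; apply/funext => n; rewrite mulrBr mulr1 fpsB fpsMXn fpsMn.
rewrite -[fX C ^+ j]mul1r fpsMXn fps1 /lterm.
have [jn|jn] := leqP j n; last first.
  rewrite mulr0 subr0; case: ifP => // /andP[n0 /dvdn_leq h]; have := h n0; lia.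
rewrite -[in (j %| n)%N](subnK jn) dvdn_addl // (_ : (0 < n)%N = true); last by lia.
have [e|nj] := posnP (n - j)%N; first by rewrite e dvdn0 /= subr0 mulr1.
by rewrite /= mulr0 subrr.
Qed.

Let ccoef N : fps C := - \sum_(1 <= j < N.+1) lterm j.
Let pprod N : fps C := \prod_(1 <= j < N.+1) (1 - fX C ^+ j).

Let fXn0 j : (0 < j)%N -> (1 - fX C ^+ j) 0%N = 1.
Proof. by case: j => // j _; rewrite fpsB fps1 fpsX0 /fX expr0n subr0. Qed.

Let dq_pprod N : dq (pprod N) = ccoef N * pprod N.
Proof.
elim: N => [|N ih]; first by rewrite /ccoef /pprod !big_nil oppr0 mul0r dq1.
have dqfX : dq (fX C) = fX C.
  by apply/funext => n; rewrite /dq /fX; case: eqP => [->|]; rewrite ?mul1r ?mulr0.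
have -> : pprod N.+1 = pprod N * (1 - fX C ^+ N.+1) by rewrite /pprod big_nat_recr.
have -> : ccoef N.+1 = ccoef N - lterm N.+1 by rewrite /ccoef big_nat_recr //= opprD.
rewrite dqM ih dqB dq1 dqX dqfX /=.
have e := ltermE (ltn0Sn N).
have -> : N.+1%:R * fX C ^+ N * fX C = N.+1%:R * fX C ^+ N.+1 by rewrite exprSr mulrA.
by rewrite -e; ring.
Qed.

Let pprod_dqsol N : pprod N = dqsol (ccoef N).
Proof.
have c0 : ccoef N 0%N = 0.
  by rewrite /ccoef fpsN fps_sum big1 ?oppr0.
apply: (@dq_linear_uniq _ 0 1 (ccoef N)); rewrite ?fps1 ?mul0r ?oner_neq0 ?mul1r //.
- exact: dq_dqsol.
move=> n; rewrite leqn0 => /eqP ->; rewrite dqsol_0 /pprod big_seq.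
elim/big_rec: _ => [|j y]; first by rewrite fps1.
by rewrite mem_index_iota => /andP[j0 _] h; rewrite fpsM0 h fXn0 // mulr1.
Qed.

Let sig1E m N : (0 < m)%N -> (m <= N)%N -> sig C 1 m = \sum_(1 <= j < N.+1) lterm j m.
Proof.
move=> m0 mN; rewrite /sig (divsum_widen _ mN) big_mkcond big_allpairs_dep.
rewrite /index_iota subn1 /=; apply: eq_big_seq => a; rewrite mem_iota => ha.
rewrite /lterm m0 /=; case: ifP => [/dvdnP[x xm]|am]; last first.
  rewrite big1 // => x _; rewrite ifF //; apply/negP => /eqP e.
  by move: am; rewrite -e dvdn_mulr.
have xE y : (a * y == m)%N = (y == x) by rewrite xm mulnC eqn_pmul2r //; lia.
rewrite (bigD1_seq x) ?iota_uniq //=; last by rewrite mem_iota; nia.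
rewrite xE eqxx expr1 big1 ?addr0 // => y /negPf yx.
by rewrite xE yx.
Qed.

Let ccoef_le N m : cmod (ccoef N m) <= complex.Re (sig C 1 m).
Proof.
have [->|m0] := posnP m.
  by rewrite sig_0 /ccoef fpsN fps_sum big1 ?oppr0 ?cmod0.
pose M := maxn m N; rewrite (@sig1E m M) // ?leq_maxl // /ccoef fpsN cmodN fps_sum.
have -> : \sum_(1 <= j < M.+1) lterm j m = (\sum_(1 <= j < M.+1) cmod (lterm j m))%:C.
  rewrite rmorph_sum; apply: eq_bigr => j _; rewrite /lterm.
  by case: ifP => _; rewrite ?cmod_nat ?cmod0 /= ?rmorph_nat.
apply: le_trans (cmod_sum _ _ _) _ => /=.
rewrite (big_cat_nat (n := N.+1) (p := M.+1)) ?ltnS ?leq_maxr //= lerDl.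
by apply: sumr_ge0 => j _; exact: cmod_ge0.
Qed.

Let sig_real m : sig C 1 m = (complex.Re (sig C 1 m))%:C.
Proof.
have [->|m0] := posnP m; first by rewrite sig_0.
rewrite (@sig1E m m) // -[X in X = _]/(\sum_(1 <= j < m.+1) lterm j m).
have -> : \sum_(1 <= j < m.+1) lterm j m = (\sum_(1 <= j < m.+1) cmod (lterm j m))%:C.
  rewrite rmorph_sum; apply: eq_bigr => j _; rewrite /lterm.
  by case: ifP => _; rewrite ?cmod_nat ?cmod0 /= ?rmorph_nat.
by [].
Qed.

Lemma rapid_fG : rapid (fG C).
Proof. by apply: rapid_dqsol; apply: rapidN; exact: rapid_sig. Qed.
Lemma rapid_fH : rapid (fH C).
Proof. by apply: rapid_dqsol; exact: rapid_sig. Qed.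

Let rapid_pprod N : rapid (pprod N).
Proof.
rewrite /pprod; elim/big_rec: _ => [|j f _ hf]; first exact: rapid1.
by apply: rapidM => //; apply: rapidB; [exact: rapid1 | apply: rapidX; exact: rapid_fX].
Qed.

(** The N-th partial product solves Dy = c y with c a truncation of - sum sigma_1(n) q^n. Its
    coefficients agree with those of [fG] up to index N and are bounded by those of [fH] uniformly
    in N, as [tannery] requires. *)
Lemma euler_product q : cmod q < 1 ->
  clim (fun N => \prod_(1 <= j < N.+1) (1 - q ^+ j)) (ev (fG C) q).
Proof.
move=> q1.
apply: (@eq_clim _ (fun N => ev (pprod N) q)).
  exists 0%N => N _; rewrite /pprod; elim: (index_iota _ _) => [|j r ih].
    by rewrite !big_nil ev1.
  have rX : rapid (1 - fX C ^+ j) by apply: rapidB; [exact: rapid1 | apply: rapidX; exact: rapid_fX].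
  rewrite !big_cons evM //; last first.
    elim: r {ih} => [|i r ih]; first by rewrite big_nil; exact: rapid1.
    rewrite big_cons; apply: rapidM => //.
    by apply: rapidB; [exact: rapid1 | apply: rapidX; exact: rapid_fX].
  by rewrite ih evB ?ev1 ?evX ?ev_fX //; [exact: rapid_fX | exact: rapid1 | apply: rapidX; exact: rapid_fX].
apply: (@tannery _ _ _ (fun n => cmod (fH C n) * cmod q ^+ n)).
- by apply: rapid_fH; rewrite cmod_ge0.
- exists 0%N => N n _; rewrite cmodM cmodX ler_wpM2r ?exprn_ge0 ?cmod_ge0 //.
  rewrite pprod_dqsol; have [y ey hy] := dqsol_majorant (ccoef_le N) n.
  apply: (le_trans hy); rewrite /fH (_ : sig C 1 = fun n => (complex.Re (sig C 1 n))%:C).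
    by rewrite ey cmodR ler_norm.
  by apply/funext => m; rewrite -sig_real.
move=> n; apply: eq_clim (clim_cst _); exists n => N nN; congr (_ * _).
rewrite pprod_dqsol; apply: dqsol_local => m mn; rewrite fpsN.
have [->|m0] := posnP m.
  by rewrite sig_0 /ccoef fpsN fps_sum big1 ?oppr0.
by rewrite (@sig1E m N) // ?(leq_trans mn nN) // /ccoef fpsN fps_sum.
Qed.

Lemma ev_fG_neq0 q : cmod q < 1 -> ev (fG C) q != 0.
Proof.
move=> q1; have := ev1 q; rewrite -(fGH C) evM //; try exact: rapid_fG; try exact: rapid_fH.
by move=> e; apply: contra_eq_neq e => ->; rewrite mul0r eq_sym oner_neq0.
Qed.
End EulerProduct.

(** * Passage to library limits and derivatives; elementary bounds for exp, sin and cos *)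

Section Links.

Lemma is_derive_estimate (K : numFieldType) (f : K -> K) (z l : K) :
  (forall e : K, 0 < e -> exists2 d : K, 0 < d &
    forall h, `|h| < d -> `|f (z + h) - f z - l * h| <= e * `|h|) ->
  is_derive (z : K^o) 1 (f : K^o -> K^o) l.
Proof.
move=> hf; have cv : (fun h : K^o => h^-1 *: ((f : K^o -> K^o) (h *: 1 + z) - f z)) @ 0^' --> (l : K^o).
  apply/cvgrPdist_le => e e0; have [d d0 hd] := hf e e0.
  near=> h.
  have h0 : h != 0 by near: h; exact: nbhs_dnbhs_neq.
  have hh : `|h| < d by near: h; exact: dnbhs0_lt.
  have H0 : 0 < `|h| by rewrite normr_gt0.
  have := hd h hh; rewrite -ler_pdivrMr // => hd'; apply: le_trans hd'.
  rewrite -[h *: 1]/(h * 1) mulr1 -[_ *: _]/(h^-1 * _) [h + z]addrC.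
  rewrite (_ : l - _ = - ((f (z + h) - f z - l * h) / h)); last by field.
  by rewrite normrN normf_div.
split; first exact: cvgP cv.
exact: cvg_lim cv.
Unshelve. all: by end_near.
Qed.

Variable R : realType.
Local Notation C := R[i].
Implicit Types (z w : C).

Lemma cderiv_derive1 (f : C -> C) z l : cderiv f z l ->
  derive1 (f : C^o -> C^o) (z : C^o) = l.
Proof.
move=> hf; rewrite derive1E; apply: derive_val; apply: is_derive_estimate => e e0.
have /complex_realP[r er] := gtr0_real e0; subst e; rewrite ltcR in e0.
have [d d0 hd] := hf r e0; exists d%:C; first by rewrite ltcR.
move=> h; rewrite !normcE_cmod ltcR => /hd hh.
by rewrite -rmorphM lecR.
Qed.

Lemma clim_cvg (u : nat -> C) l : clim u l -> (u : nat -> C^o) @ \oo --> (l : C^o).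
Proof.
move=> h; apply/cvgrPdist_lt => e e0.
have /complex_realP[r er] := gtr0_real e0; subst e; rewrite ltcR in e0.
have [n0 h0] := h r e0; exists n0 => // n /= n0n.
by rewrite normcE_cmod ltcR cmodBC; apply: h0.
Qed.

Lemma clim_lim (u : nat -> C) l : clim u l -> lim ((u : nat -> C^o) @ \oo) = (l : C^o).
Proof. by move=> /clim_cvg h; exact: cvg_lim h. Qed.

Lemma real_mvt (f df : R -> R) (a b : R) : (forall x : R, is_derive x 1 f (df x)) ->
  exists2 c, `|c - a| <= `|b - a| & f b - f a = df c * (b - a).
Proof.
move=> hf; have cf (x : R) : {for x, continuous f}.
  apply: differentiable_continuous; apply/derivable1_diffP.
  by have [] := hf x.
have cw (x y : R) : {within `[x, y], continuous f}.
  by apply: continuous_subspaceT => t; exact: cf.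
have [ab|ba|->] := ltgtP a b.
- have [c] := MVT ab (fun x _ => hf x) (cw a b).
  rewrite in_itv /= => hc e; exists c => //.
  rewrite !ger0_norm; lra.
- have [c] := MVT ba (fun x _ => hf x) (cw b a).
  rewrite in_itv /= => hc e; exists c; last by rewrite -opprB e; ring.
  rewrite !ler0_norm; lra.
- by exists b; rewrite ?subrr ?mulr0.
Qed.

(** The mean value theorem on the segment from z to w, applied to the real and imaginary parts
    separately. *)
Lemma cderiv0_const (f : C -> C) z w :
  (forall t : R, 0 <= t <= 1 -> cderiv f (z + t%:C * (w - z)) 0) -> f w = f z.
Proof.
move=> hf; pose g t := f (z + t%:C * (w - z)).
have aux (p : C -> R) : (forall x y, p (x - y) = p x - p y) -> (forall x, `|p x| <= cmod x) ->
    p (f w) = p (f z).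
  move=> pB pc; have hg (t : R) : 0 <= t <= 1 -> is_derive t 1 (p \o g) 0.
    move=> /hf h; apply: is_derive_estimate => e e0.
    pose A := cmod (w - z) + 1; have A0 : 0 < A by rewrite /A; have := cmod_ge0 (w - z); lra.
    have [d d0 hd] := h _ (divr_gt0 e0 A0); exists (d / A); first exact: divr_gt0.
    move=> s hs; have hsd : cmod (s%:C * (w - z)) < d.
      rewrite cmodM cmodR; move: hs; rewrite ltr_pdivlMr //; apply: le_lt_trans.
      by rewrite ler_wpM2l // /A; lra.
    have := hd _ hsd; rewrite !mul0r !subr0 => hh.
    rewrite /= -pB; apply: le_trans (pc _) _; rewrite /g rmorphD /= mulrDl addrA.
    apply: le_trans hh _; rewrite cmodM cmodR mulrAC ler_pdivrMr //.
    rewrite -mulrA ler_pM2l //; apply: ler_wpM2l => //; rewrite /A; lra.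
  have cg : {within `[(0 : R), 1], continuous (p \o g)}.
    apply: derivable_within_continuous => t; rewrite in_itv /= => /hg ht.
    by have [] := ht.
  have hd (t : R) : t \in `](0 : R), 1[ -> is_derive t 1 (p \o g) ((fun=> 0) t).
    by rewrite in_itv /= => ht; apply: hg; lra.
  have [c _] := MVT_segment ler01 hd cg.
  rewrite mul0r /g /= => /eqP; rewrite subr_eq0 => /eqP.
  by rewrite rmorph1 mul1r subrKC rmorph0 mul0r addr0.
apply: complex_eqP; apply: aux.
- by move=> x y; rewrite complexReD complexReN.
- exact: Re_le_cmod.
- by move=> x y; rewrite complexImD complexImN.
- exact: Im_le_cmod.
Qed.

Lemma abs_sin_le (x : R) : `|sin x| <= `|x|.
Proof.
have [c _] := real_mvt 0 x (@is_derive_sin R).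
rewrite sin0 !subr0 => ->; rewrite normrM ler_piMl ?normr_ge0 //; exact: cos_max.
Qed.

Lemma abs_cos_sub1_le (x : R) : `|cos x - 1| <= x ^+ 2.
Proof.
have [c hc] := real_mvt 0 x (@is_derive_cos R).
rewrite cos0 subr0 => ->; rewrite normrM normrN -[x ^+ 2]real_normK ?num_real // expr2.
rewrite ler_wpM2r //; apply: le_trans (abs_sin_le _) _.
by rewrite !subr0 in hc.
Qed.

Lemma abs_sin_subx_le (x : R) : `|sin x - x| <= `|x| ^+ 3.
Proof.
have hd (y : R) : is_derive y 1 (fun t => sin t - t) (cos y - 1) by apply: is_deriveB.
have [c hc] := real_mvt 0 x hd.
rewrite sin0 !subr0 => ->; rewrite normrM exprSr ler_wpM2r //.
apply: le_trans (abs_cos_sub1_le c) _; rewrite -(real_normK (num_real c)).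
by rewrite lerXn2r ?nnegrE // -[c]subr0 -[x]subr0.
Qed.

(** Only 1 + x <= exp x is used, at x and at - x, which encloses exp x between 1 + x and 1/(1 -
    x). *)
Lemma expR_estimate (x : R) : `|x| <= 1 / 2 -> `|expR x - 1 - x| <= 2 * x ^+ 2.
Proof.
rewrite ler_norml => /andP[x1 x2]; have h1 := expR_ge1Dx x.
have h2 := expR_ge1Dx (- x); rewrite expRN in h2.
have E0 := expR_gt0 x.
have h3 : expR x * (1 - x) <= 1 by rewrite -ler_pdivlMl // mulr1.
rewrite ger0_norm; last by lra.
nra.
Qed.

Lemma cexpD z w : cexp (z + w) = cexp z * cexp w.
Proof.
rewrite /cexp complexReD complexImD expRD cosD sinD; case: z w => a b [c d] /=.
apply: complex_eqP; rewrite /= ?complexReM ?complexImM /=; ring.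
Qed.

Lemma cexp0 : cexp (0 : C) = 1.
Proof. by rewrite /cexp /= expR0 cos0 sin0 mul1r. Qed.

Lemma cmod_cexp z : cmod (cexp z) = expR (complex.Re z).
Proof.
rewrite /cexp cmodM cmodR ger0_norm ?expR_ge0 //.
by rewrite /cmod /= cos2Dsin2 sqrtr1 mulr1.
Qed.

Lemma cexp_neq0 z : cexp z != 0.
Proof. by rewrite -cmod_gt0 cmod_cexp expR_gt0. Qed.

Lemma cexpX z n : cexp (n%:R * z) = cexp z ^+ n.
Proof.
elim: n => [|n ih]; first by rewrite mul0r expr0 cexp0.
by rewrite -natr1 mulrDl mul1r cexpD ih exprSr.
Qed.

Lemma cexp_estimate z : cmod z <= 1 / 2 -> cmod (cexp z - 1 - z) <= 10 * cmod z ^+ 2.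
Proof.
move=> hz; set r := cmod z.
have hx := Re_le_cmod z; have hy := Im_le_cmod z; rewrite -/r in hz hx hy.
set x := complex.Re z in hx *; set y := complex.Im z in hy *.
have r0 : 0 <= r by exact: cmod_ge0.
have ax : 0 <= `|x| by []. have ay : 0 <= `|y| by [].
have e1 := @expR_estimate x; have {}e1 : `|expR x - 1 - x| <= 2 * r ^+ 2.
  apply: (le_trans (e1 _)); first by lra.
  rewrite ler_pM2l // -(real_normK (num_real x)) lerXn2r ?nnegrE //.
have y2 : y ^+ 2 <= r ^+ 2 by rewrite -(real_normK (num_real y)) lerXn2r ?nnegrE.
have e2 := abs_cos_sub1_le y; have e3 := abs_sin_subx_le y.
have r2 : r ^+ 2 <= r / 2 by rewrite expr2; nra.
have e4 : `|expR x - 1| <= 2 * r.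
  rewrite (_ : _ - 1 = (expR x - 1 - x) + x); last by ring.
  apply: le_trans (ler_normD _ _) _; lra.
have e5 : `|sin y - y| <= r ^+ 2.
  apply: (le_trans e3); apply: (@le_trans _ _ (r ^+ 3)); first by rewrite lerXn2r ?nnegrE.
  by rewrite exprS; nra.
have e6 := abs_sin_le y.
have e7 : expR x <= 2 by have : expR x - 1 <= 2 * r := le_trans (ler_norm _) e4; lra.
apply: le_trans (cmod_le_ReIm _) _.
rewrite !complexReD !complexImD !complexReN !complexImN -/x -/y /cexp complexReM complexImM /= -/x -/y !mul0r subr0 addr0 oppr0 addr0.
have t1 : `|expR x * cos y - 1 - x| <= 4 * r ^+ 2.
  rewrite (_ : _ - x = (expR x - 1 - x) + expR x * (cos y - 1)); last by ring.
  apply: le_trans (ler_normD _ _) _; rewrite normrM (ger0_norm (expR_ge0 x)).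
  have := ler_pM (expR_ge0 x) (normr_ge0 _) e7 (le_trans e2 y2); lra.
have t2 : `|expR x * sin y - y| <= 3 * r ^+ 2.
  rewrite (_ : _ - y = (expR x - 1) * sin y + (sin y - y)); last by ring.
  apply: le_trans (ler_normD _ _) _; rewrite normrM.
  have := ler_pM (normr_ge0 _) (normr_ge0 _) e4 (le_trans e6 hy); rewrite expr2 in e5 *; lra.
have := sqr_ge0 r; lra.
Qed.

Lemma cderiv_cexp z : cderiv (@cexp R) z (cexp z).
Proof.
move=> e e0; have E0 : 0 < cmod (cexp z) by rewrite cmod_gt0 cexp_neq0.
exists (Num.min (1 / 2) (e / (10 * cmod (cexp z)))).
  by rewrite lt_min !divr_gt0 // mulr_gt0.
move=> h; rewrite lt_min => /andP[/ltW/cexp_estimate h1 h2].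
rewrite cexpD (_ : _ - _ = cexp z * (cexp h - 1 - h)); last by ring.
rewrite cmodM; apply: le_trans (ler_wpM2l (ltW E0) h1) _.
move: h2; rewrite ltr_pdivlMr ?mulr_gt0 // => /ltW h2.
rewrite expr2; have := ler_wpM2r (cmod_ge0 h) h2; lra.
Qed.
End Links.

(** * Values at a point of the upper half-plane *)

Section Nome.
Variable R : realType.
Local Notation C := R[i].
Implicit Types (z w tau q : C).

Definition twopii : C := (2 * pi)%:C * 'i%C.

Lemma twopii_neq0 : twopii != 0.
Proof.
rewrite /twopii mulf_neq0 //; last by rewrite eq_complex /= oner_eq0 andbF.
by rewrite -cmod_gt0 cmodR normr_gt0 mulf_neq0 // gt_eqF // pi_gt0.
Qed.

Lemma cexp2piD z w : cexp2pi (z + w) = cexp2pi z * cexp2pi w.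
Proof. by rewrite /cexp2pi mulrDr cexpD. Qed.
Lemma cexp2piX z n : cexp2pi (n%:R * z) = cexp2pi z ^+ n.
Proof. by rewrite /cexp2pi mulrCA cexpX. Qed.

Lemma cexp2pi_neq0 z : cexp2pi z != 0. Proof. exact: cexp_neq0. Qed.

Lemma cexp2pi1 : cexp2pi (1 : C) = 1.
Proof.
rewrite /cexp2pi mulr1 /cexp complexReM complexImM /= !mul0r !mulr0 mulr1 subr0 addr0.
by rewrite expR0 mul1r mulr_natl cos2pi sin2pi.
Qed.

Lemma cexp2pi0 : cexp2pi (0 : C) = 1.
Proof. by rewrite /cexp2pi mulr0 cexp0. Qed.

Lemma cexp2pi_nat n : cexp2pi (n%:R : C) = 1.
Proof. by rewrite -[n%:R]mulr1 cexp2piX cexp2pi1 expr1n. Qed.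

Lemma cexp2piD1 z : cexp2pi (z + 1) = cexp2pi z.
Proof. by rewrite cexp2piD cexp2pi1 mulr1. Qed.

Lemma cmod_cexp2pi z : cmod (cexp2pi z) = expR (- (2 * pi * complex.Im z)).
Proof.
rewrite /cexp2pi cmod_cexp -mulrA complexReM /= complexReM complexImM /=; congr expR; ring.
Qed.

Lemma cexp2pi_lt1 z : 0 < complex.Im z -> cmod (cexp2pi z) < 1.
Proof.
move=> z0; rewrite cmod_cexp2pi -expR0 ltr_expR oppr_lt0.
by rewrite !mulr_gt0 // pi_gt0.
Qed.

Lemma cderiv_cexp2pi z : cderiv (@cexp2pi R) z (twopii * cexp2pi z).
Proof.
rewrite mulrC; apply: (cderiv_comp (f := @cexp R)); last exact: cderiv_cexp.
by rewrite -[X in cderiv _ _ X]mulr1; apply: cderivMl; exact: cderiv_id.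
Qed.

Lemma cderiv_ev_nome (f : fps C) tau : rapid f -> 0 < complex.Im tau ->
  cderiv (fun z => ev f (cexp2pi z)) tau (twopii * ev (dq f) (cexp2pi tau)).
Proof.
move=> hf t0; have q0 := cexp2pi_neq0 tau.
have := cderiv_comp (cderiv_cexp2pi tau) (cderiv_ev hf q0 (cexp2pi_lt1 t0)).
move: (cexp2pi tau) (ev (dq f) (cexp2pi tau)) q0 => y x y0.
by rewrite (_ : x / y * _ = twopii * x) //; field.
Qed.

Lemma lambertE k q : cmod q < 1 -> lambert k q = ev (sig C k) q.
Proof.
move=> q1; apply: clim_lim.
have h := lambert_csums k q1.
have hd : dominated (fun n => if n == 0%N then 0 else n%:R ^+ k * (q ^+ n / (1 - q ^+ n))).
  have c0 : 0 < 1 - cmod q by rewrite subr_gt0.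
  have hq : 0 <= cmod q < 1 by rewrite cmod_ge0.
  exists (fun n => (1 - cmod q)^-1 * (cmod (n%:R ^+ k : C) * cmod q ^+ n)).
    apply: summableZ; first by rewrite invr_ge0 ltW.
    have hp : rapid (fun n => n%:R ^+ k : C) by apply: (@rapid_poly _ _ k) => n; rewrite cmodX cmod_nat.
    exact: hp.
  move=> [|n] /=.
    by rewrite cmod0 mulr_ge0 ?invr_ge0 ?(ltW c0) // mulr_ge0 ?cmod_ge0 ?exprn_ge0 ?cmod_ge0.
  rewrite cmodM [leRHS]mulrCA ler_wpM2l ?cmod_ge0 // cmodM cmodV [leRHS]mulrC cmodX.
  rewrite ler_wpM2l ?exprn_ge0 ?cmod_ge0 // lef_pV2 ?posrE //.
    apply: le_trans (cmod_sub_ge _ _); rewrite cmod1 lerB // cmodX exprS.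
    by rewrite ler_piMr ?cmod_ge0 // exprn_ile1 ?cmod_ge0 // ltW.
  apply: lt_le_trans (cmod_sub_ge _ _); rewrite cmod1 subr_gt0 cmodX.
  by rewrite exprn_ilt1 ?cmod_ge0.
rewrite -h; apply: eq_clim (dominated_csums hd); exists 1%N => -[//|n] _.
rewrite -(big_mkord xpredT (fun n => if n == 0%N then 0 else n%:R ^+ k * (q ^+ n / (1 - q ^+ n)))).
rewrite big_ltn // add0r big_nat [RHS]big_nat; apply: eq_bigr => i /andP[i0 _].
by rewrite ifN // -lt0n.
Qed.

Variable tau : C.
Hypothesis tau0 : 0 < complex.Im tau.
Let q1 := cexp2pi_lt1 tau0.
Local Notation q := (cexp2pi tau).

Lemma E2_ev : E2 tau = ev (fE2 C) q.
Proof.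
rewrite /E2 lambertE // /fE2 evB ?ev1 ?evMn //; [exact: rapid_sig | exact: rapid1 |].
by apply: rapidMn; exact: rapid_sig.
Qed.
Lemma E4_ev : E4 tau = ev (fE4 C) q.
Proof.
rewrite /E4 lambertE // /fE4 evD ?ev1 ?evMn //; [exact: rapid_sig | exact: rapid1 |].
by apply: rapidMn; exact: rapid_sig.
Qed.
Lemma E6_ev : E6 tau = ev (fE6 C) q.
Proof.
rewrite /E6 lambertE // /fE6 evB ?ev1 ?evMn //; [exact: rapid_sig | exact: rapid1 |].
by apply: rapidMn; exact: rapid_sig.
Qed.

Lemma eta_ev : Defs.eta tau = cexp2pi (tau / 24) * ev (fG C) q.
Proof.
rewrite /Defs.eta [X in _ * X](_ : _ = ev (fG C) q) //; apply: clim_lim.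
apply: (@clim_unshift _ _ _ 1); apply: eq_clim (euler_product q1).
by exists 0%N => n _; rewrite addn1.
Qed.
End Nome.

Section Level3Values.
Variable R : realType.
Local Notation C := R[i].
Variable tau : C.
Hypothesis tau0 : 0 < complex.Im tau.
Let q1 := cexp2pi_lt1 tau0.
Local Notation q := (cexp2pi tau).

Lemma rapid_fs : rapid (fs C).
Proof.
apply: rapidM; first by apply: rapidMn; exact: rapid_fX.
apply: rapidM; apply: rapidX; last exact: rapid_fH.
by apply: rapid_sub => //; exact: rapid_fG.
Qed.

Lemma rapid_fb3 : rapid (fb3 C).
Proof.
apply: rapidM; apply: rapidX; first exact: rapid_fG.
by apply: rapid_sub => //; exact: rapid_fH.
Qed.

Lemma rapid_fb3i : rapid (fb3i C).
Proof.
apply: rapidM; apply: rapidX; first exact: rapid_fH.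
by apply: rapid_sub => //; exact: rapid_fG.
Qed.

Lemma rapid_fB : rapid (fB C).
Proof.
apply: rapidD; first by apply: rapidB; [exact: rapid1 | apply: rapidMn; exact: rapid_sig].
by apply: rapidMn; apply: rapid_sub => //; exact: rapid_sig.
Qed.

Lemma rapid_fa : rapid (fa C).
Proof. by apply: rapidM; [exact: rapid_fB | exact: rapid_fb3i]. Qed.

Lemma rapid_fE2 : rapid (fE2 C).
Proof. by apply: rapidB; [exact: rapid1 | apply: rapidMn; exact: rapid_sig]. Qed.
Lemma rapid_fE4 : rapid (fE4 C).
Proof. by apply: rapidD; [exact: rapid1 | apply: rapidMn; exact: rapid_sig]. Qed.
Lemma rapid_fE6 : rapid (fE6 C).
Proof. by apply: rapidB; [exact: rapid1 | apply: rapidMn; exact: rapid_sig]. Qed.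

Lemma ev_fGH : ev (fG C) q * ev (fH C) q = 1.
Proof. by rewrite -evM ?fGH ?ev1 //; [exact: rapid_fG | exact: rapid_fH]. Qed.

Lemma ev_fs : ev (fs C) q = 27 * (Defs.eta (3 * tau) / Defs.eta tau) ^+ 12.
Proof.
have t3 : 0 < complex.Im (3 * tau).
  have -> : 3 * tau = tau + tau + tau by ring.
  by rewrite !complexImD !addr_gt0.
rewrite !eta_ev // (cexp2piX tau 3).
have rG : rapid (fG C) by exact: rapid_fG.
have rH : rapid (fH C) by exact: rapid_fH.
have rX : rapid (fX C) by exact: rapid_fX.
have rV : rapid (fps_sub 3 (fG C)) by exact: rapid_sub.
rewrite /fs evM //; last first.
- by apply: rapidM; exact: rapidX.
- by apply: rapidMn.
rewrite evMn // ev_fX evM //; try exact: rapidX.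
rewrite !evX // ev_sub //.
have e := ev_fGH; have G0 := ev_fG_neq0 q1.
have -> : ev (fH C) q = (ev (fG C) q)^-1 by apply: (mulfI G0); rewrite e divff.
(* In the twelfth power of the eta quotient the excess 2 tau/24 contributes e(tau/24)^24 = q, the
   factor [fX] of [fs]. *)
have -> : 3 * tau / 24 = tau / 24 + 2%:R * (tau / 24) by field.
rewrite cexp2piD cexp2piX.
have h0 := cexp2pi_neq0 (tau / 24).
have qE : q = cexp2pi (tau / 24) ^+ 24 by rewrite -cexp2piX; congr cexp2pi; field.
rewrite [in X in X * _](_ : q = cexp2pi (tau / 24) ^+ 24) //.
move: (ev (fG C) q) (ev (fG C) (q ^+ 3)) G0 => x y x0.
by field; apply/andP.
Qed.
End Level3Values.

(** * Evaluation of the differential system, for arbitrary series satisfying its relations *)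

Section AbstractValues.
Variables (R : realType) (q : R[i]) (a b c s x y z : fps R[i]).
Hypotheses (q1 : cmod q < 1) (ra : rapid a) (rb : rapid b) (rc : rapid c) (rs : rapid s).
Hypotheses (rx : rapid x) (ry : rapid y) (rz : rapid z).
Local Notation C := R[i].
Local Notation "f ^v" := (ev f q) (at level 2, format "f ^v").

Lemma ev_inverse : b * c = 1 -> b^v != 0.
Proof.
move=> h; have : ev (b * c) q = 1 by rewrite h ev1.
rewrite evM // => e; apply/eqP => b0; move: e; rewrite b0 mul0r => /eqP.
by rewrite eq_sym oner_eq0.
Qed.

Lemma ev_cube : a ^+ 3 = b * (1 + s) -> a^v ^+ 3 = b^v * (1 + s^v).
Proof.
have r1 : rapid (1 : fps C) by exact: rapid1.
have r1s : rapid (1 + s) by exact: rapidD.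
by move=> h; rewrite -evX // h evM // evD // ev1.
Qed.

Lemma ev_e4 : y = 9%:R * a ^+ 4 - 8%:R * (a * b) -> y^v = 9 * a^v ^+ 4 - 8 * (a^v * b^v).
Proof.
have r4 : rapid (a ^+ 4) by exact: rapidX. have rab : rapid (a * b) by exact: rapidM.
have r94 : rapid (9%:R * a ^+ 4) by exact: rapidMn.
have r8 : rapid (8%:R * (a * b)) by exact: rapidMn.
by move=> ->; rewrite evB // !evMn // evX // evM.
Qed.

Lemma ev_e6 : z = 36%:R * a ^+ 3 * b - 27%:R * a ^+ 6 - 8%:R * b ^+ 2 ->
  z^v = 36 * a^v ^+ 3 * b^v - 27 * a^v ^+ 6 - 8 * b^v ^+ 2.
Proof.
have r3 : rapid (a ^+ 3) by exact: rapidX. have r6 : rapid (a ^+ 6) by exact: rapidX.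
have r2 : rapid (b ^+ 2) by exact: rapidX.
have r33 : rapid (36%:R * a ^+ 3) by exact: rapidMn.
have r3b : rapid (36%:R * a ^+ 3 * b) by exact: rapidM.
have r66 : rapid (27%:R * a ^+ 6) by exact: rapidMn.
have r22 : rapid (8%:R * b ^+ 2) by exact: rapidMn.
have rr : rapid (36%:R * a ^+ 3 * b - 27%:R * a ^+ 6) by exact: rapidB.
by move=> ->; rewrite evB // evB // evM // !evMn // !evX.
Qed.

Lemma ev_dq_s : dq s = a ^+ 2 * s -> ev (dq s) q = a^v ^+ 2 * s^v.
Proof.
have r2 : rapid (a ^+ 2) by exact: rapidX.
by move=> ->; rewrite evM // evX.
Qed.

Lemma ev_dq_a : 12%:R * dq a = a * x - 4%:R * b + 3%:R * a ^+ 3 ->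
  ev (dq a) q = (a^v * x^v - 4 * b^v + 3 * a^v ^+ 3) / 12.
Proof.
have r3 : rapid (a ^+ 3) by exact: rapidX. have rax : rapid (a * x) by exact: rapidM.
have r33 : rapid (3%:R * a ^+ 3) by exact: rapidMn. have r4 : rapid (4%:R * b) by exact: rapidMn.
have rd : rapid (dq a) by exact: rapid_dq. have rr : rapid (a * x - 4%:R * b) by exact: rapidB.
move=> h; have : ev (12%:R * dq a) q = a^v * x^v - 4 * b^v + 3 * a^v ^+ 3.
  by rewrite h evD // evB // !evMn // evM // evX.
by rewrite evMn // => <-; rewrite [12 * _]mulrC mulfK // pnatr_eq0.
Qed.

Lemma ev_dq_e2 : 12%:R * dq x = x ^+ 2 - y -> ev (dq x) q = (x^v ^+ 2 - y^v) / 12.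
Proof.
have r2 : rapid (x ^+ 2) by exact: rapidX. have rd : rapid (dq x) by exact: rapid_dq.
move=> h; have : ev (12%:R * dq x) q = x^v ^+ 2 - y^v by rewrite h evB // evX.
by rewrite evMn // => <-; rewrite [12 * _]mulrC mulfK // pnatr_eq0.
Qed.

Lemma ev_dq_e4 : 3%:R * dq y = x * y - z -> ev (dq y) q = (x^v * y^v - z^v) / 3.
Proof.
have r2 : rapid (x * y) by exact: rapidM. have rd : rapid (dq y) by exact: rapid_dq.
move=> h; have : ev (3%:R * dq y) q = x^v * y^v - z^v by rewrite h evB // evM.
by rewrite evMn // => <-; rewrite [3 * _]mulrC mulfK // pnatr_eq0.
Qed.

Lemma ev_dq_b : 4%:R * dq b = b * (x - a ^+ 2) -> ev (dq b) q = b^v * (x^v - a^v ^+ 2) / 4.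
Proof.
have r2 : rapid (a ^+ 2) by exact: rapidX. have rd : rapid (dq b) by exact: rapid_dq.
have r3 : rapid (x - a ^+ 2) by exact: rapidB.
move=> h; have : ev (4%:R * dq b) q = b^v * (x^v - a^v ^+ 2) by rewrite h evM // evB // evX.
by rewrite evMn // => <-; rewrite [4 * _]mulrC mulfK // pnatr_eq0.
Qed.
End AbstractValues.

Section Values.
Variable R : realType.
Local Notation C := R[i].

Definition ma (tau : C) : C := ev (fa C) (cexp2pi tau).
Definition mb (tau : C) : C := ev (fb3 C) (cexp2pi tau).
Definition ms (tau : C) : C := ev (fs C) (cexp2pi tau).
Definition e2 (tau : C) : C := ev (fE2 C) (cexp2pi tau).
Definition e4 (tau : C) : C := ev (fE4 C) (cexp2pi tau).
Definition e6 (tau : C) : C := ev (fE6 C) (cexp2pi tau).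

Variable tau : C.
Hypothesis tau0 : 0 < complex.Im tau.
Let q1 := cexp2pi_lt1 tau0.
Local Notation q := (cexp2pi tau).
Local Notation a := (ma tau).
Local Notation b := (mb tau).
Local Notation s := (ms tau).

Let r_fa : rapid (fa C). Proof. exact: rapid_fa. Qed.
Let r_fb3 : rapid (fb3 C). Proof. exact: rapid_fb3. Qed.
Let r_fb3i : rapid (fb3i C). Proof. exact: rapid_fb3i. Qed.
Let r_fs : rapid (fs C). Proof. exact: rapid_fs. Qed.
Let r_fE2 : rapid (fE2 C). Proof. exact: rapid_fE2. Qed.
Let r_fE4 : rapid (fE4 C). Proof. exact: rapid_fE4. Qed.
Let r_fE6 : rapid (fE6 C). Proof. exact: rapid_fE6. Qed.

Lemma mb_neq0 : b != 0.
Proof. exact: (ev_inverse q1 r_fb3 r_fb3i (fb3_fb3i C)). Qed.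

Lemma ms_eta : s = 27 * (Defs.eta (3 * tau) / Defs.eta tau) ^+ 12.
Proof. exact: ev_fs. Qed.

Lemma eta_neq0 (z : C) : 0 < complex.Im z -> Defs.eta z != 0.
Proof.
move=> z0; rewrite eta_ev // mulf_neq0 ?cexp2pi_neq0 //.
by apply: ev_fG_neq0; exact: cexp2pi_lt1.
Qed.

Let t30 : 0 < complex.Im (3 * tau).
Proof.
have -> : 3 * tau = tau + tau + tau by ring.
by rewrite !complexImD !addr_gt0.
Qed.

Lemma ms_neq0 : s != 0.
Proof.
rewrite ms_eta mulf_neq0 ?pnatr_eq0 // expf_neq0 // mulf_neq0 ?invr_eq0 ?eta_neq0 //.
Qed.

Lemma u3_ms : u3 tau = - s^-1.
Proof.
rewrite ms_eta /u3; have h := eta_neq0 tau0; have h3 := eta_neq0 t30.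
move: (Defs.eta tau) (Defs.eta (3 * tau)) h h3 => x y x0 y0.
by field; apply/andP.
Qed.

Lemma w3_ms : w3 tau = (1 + s) ^+ 2 / (4 * s).
Proof.
rewrite ms_eta /w3; have h := eta_neq0 tau0; have h3 := eta_neq0 t30.
move: (Defs.eta tau) (Defs.eta (3 * tau)) h h3 => x y x0 y0.
by field; apply/andP.
Qed.

Lemma ma_cube : a ^+ 3 = b * (1 + s).
Proof. exact: (ev_cube q1 r_fa r_fb3 r_fs (fa_cube C)). Qed.

Lemma e4_ab : e4 tau = 9 * a ^+ 4 - 8 * (a * b).
Proof. exact: (ev_e4 q1 r_fa r_fb3 (fE4_ab C)). Qed.

Lemma e6_ab : e6 tau = 36 * a ^+ 3 * b - 27 * a ^+ 6 - 8 * b ^+ 2.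
Proof. exact: (ev_e6 q1 r_fa r_fb3 (fE6_ab C)). Qed.

Lemma cderiv_ms : cderiv ms tau (twopii R * (a ^+ 2 * s)).
Proof.
have h : dq (fs C) = fa C ^+ 2 * fs C by rewrite fa_sqr dq_fs.
rewrite /ma -(ev_dq_s q1 r_fa r_fs h).
exact: (cderiv_ev_nome r_fs tau0).
Qed.

Lemma cderiv_ma : cderiv ma tau (twopii R * ((a * e2 tau - 4 * b + 3 * a ^+ 3) / 12)).
Proof.
rewrite -(ev_dq_a q1 r_fa r_fb3 r_fE2 (dq_fa C)).
exact: (cderiv_ev_nome r_fa tau0).
Qed.

Lemma cderiv_mb : cderiv mb tau (twopii R * (b * (e2 tau - a ^+ 2) / 4)).
Proof.
have h : 4%:R * dq (fb3 C) = fb3 C * (fE2 C - fa C ^+ 2) by rewrite fa_sqr dq_fb3.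
rewrite -(ev_dq_b q1 r_fa r_fb3 r_fE2 h).
exact: (cderiv_ev_nome r_fb3 tau0).
Qed.

Lemma cderiv_e2 : cderiv e2 tau (twopii R * ((e2 tau ^+ 2 - e4 tau) / 12)).
Proof.
rewrite -(ev_dq_e2 q1 r_fE2 r_fE4 (ramanujan_E2 C)).
exact: (cderiv_ev_nome r_fE2 tau0).
Qed.

Lemma cderiv_e4 : cderiv e4 tau (twopii R * ((e2 tau * e4 tau - e6 tau) / 3)).
Proof.
rewrite -(ev_dq_e4 q1 r_fE2 r_fE4 r_fE6 (ramanujan_E4 C)).
exact: (cderiv_ev_nome r_fE4 tau0).
Qed.
End Values.

(** * Eisenstein series as lattice sums *)

Section PartialFractions.
Variable R : realType.
Local Notation C := R[i].
Local Notation e := (@cexp2pi R).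
Implicit Types (z w : C).

Lemma pi_le4 : pi <= 4 :> R.
Proof. by have := pihalf_lt2 R; lra. Qed.

(** The cubic remainder gives slope 3/4 on [0, 1/2]; beyond, monotonicity and the reflection t -> pi
    - t keep sin t above sin(1/2) >= 3/8, and 3/8 >= t/8 because t <= 3 pi/4 <= 3. *)
Lemma sin_ge_lin (t : R) : 0 <= t <= 3 * pi / 4 -> t / 8 <= sin t.
Proof.
move=> /andP[t0 t1]; have p2 := pi_ge2 R; have p4 := pi_le4.
have small (x : R) : 0 <= x <= 1 / 2 -> 3 / 4 * x <= sin x.
  move=> /andP[x0 x1]; have := abs_sin_subx_le x; rewrite (ger0_norm x0) ler_norml => /andP[h _].
  have h1 : x ^+ 3 <= x / 4 by rewrite exprS expr2; nra.
  lra.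
have [h|h] := leP t (1 / 2); first by have := small t; lra.
have s12 : 3 / 8 <= sin (1 / 2 : R) by have := small (1 / 2); lra.
suff : sin (1 / 2) <= sin t by lra.
have mono (x : R) : 1 / 2 <= x <= pi / 2 -> sin (1 / 2) <= sin x.
  move=> /andP[x0 x1]; rewrite leNgt ltr_sin ?in_itv /=; last 2 first.
  - lra.
  - lra.
  by rewrite -leNgt.
have [h2|h2] := leP t (pi / 2); first by apply: mono; lra.
have -> : sin t = sin (pi - t) by rewrite sinB sinpi cospi; ring.
by apply: mono; lra.
Qed.

Lemma cmod_sub1_sqr w : let r := cmod (e w) in let ss := sin (pi * complex.Re w) in
  cmod (1 - e w) ^+ 2 = (1 - r) ^+ 2 + 4 * r * ss ^+ 2.
Proof.
move=> r ss; rewrite {}/ss; set x := complex.Re w; set y := complex.Im w; set ss := sin (pi * x).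
have rE : r = expR (- (2 * pi * y)) by rewrite /r cmod_cexp2pi.
have eE : e w = r%:C * (cos (2 * (pi * x)) +i* sin (2 * (pi * x))).
  rewrite rE /cexp2pi /cexp -mulrA !complexReM !complexImM /= -/x -/y.
  by congr ((expR _)%:C * (cos _ +i* sin _)); ring.
rewrite cmod_sqr complexReD complexImD complexReN complexImN eE complexReM complexImM /=.
rewrite !mul0r subr0 addr0.
have -> : 2 * (pi * x) = (pi * x) *+ 2 by rewrite mulr_natl.
rewrite cos_mulr2n sin_mulr2n.
have cs := cos2sin2 (pi * x); rewrite -/ss in cs *; set cc := cos _ in cs *.
have -> : (0 - r * ((cc * ss) *+ 2)) ^+ 2 = 4 * r ^+ 2 * cc ^+ 2 * ss ^+ 2 by ring.
by rewrite cs; ring.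
Qed.

(** The width 3/4 < 1 leaves w = 0 as the only zero of 1 - e(w) in the region, and it is simple. In
    [cmod_sub1_sqr] the term (1 - r)^2 controls Im w and the sine term controls Re w. *)
Lemma cmod_le_sub1 : exists2 K : R, 0 < K & forall w,
  `|complex.Re w| <= 3 / 4 -> 0 <= complex.Im w <= 1 -> cmod w <= K * cmod (1 - e w).
Proof.
have p2 := pi_ge2 R; have p4 := pi_le4.
(* A lower bound for |e(w)|, since 2 pi Im w <= 8 when Im w <= 1 and pi <= 4. *)
pose r0 : R := expR (- 8); have r00 : 0 < r0 by exact: expR_gt0.
exists (2 / r0 + 9 / 4); first by rewrite addr_gt0 // divr_gt0.
move=> w hx /andP[y0 y1]; have := cmod_sub1_sqr w.
set x := complex.Re w in hx *; set y := complex.Im w in y0 y1.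
set M := cmod (1 - e w); set r := cmod (e w) => /= ME.
have M0 : 0 <= M by exact: cmod_ge0.
have rE : r = expR (- (2 * pi * y)) by rewrite /r cmod_cexp2pi.
have r1 : 0 < r by rewrite rE expR_gt0.
have py : 2 * pi * y <= 8 by nra.
have py0 : 0 <= 2 * pi * y by nra.
have rr0 : r0 <= r by rewrite rE ler_expR lerN2; exact: py.
have r2 : r <= 1 by rewrite rE -[leRHS]expR0 ler_expR oppr_le0.
have hy : y <= 9 / 4 * M.
  have M1 : 1 - r <= M by have := cmod_sub_ge 1 (e w); rewrite cmod1.
  have h := expR_ge1Dx (2 * pi * y).
  have hr : r * (1 + 2 * pi * y) <= 1.
    have e1 : r * expR (2 * pi * y) = 1 by rewrite rE -expRD addNr expR0.
    by rewrite -[leRHS]e1 ler_pM2l.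
  have h4 : 4 * y <= 2 * pi * y by nra.
  move: (2 * pi * y) py py0 hr h4 => u *; nra.
have hxx : `|x| <= 2 / r0 * M.
  have ax : 0 <= `|x| by [].
  have sx : `|x| / 4 <= `|sin (pi * x)|.
    have -> : `|sin (pi * x)| = `|sin (pi * `|x|)|.
      by have [hx0|hx0] := leP 0 x; rewrite ?(ger0_norm hx0) ?(ltr0_norm hx0) // mulrN sinN normrN.
    have h3 : 0 <= pi * `|x| <= 3 * pi / 4 by apply/andP; split; nra.
    have h4 := sin_ge_lin h3; apply: le_trans (ler_norm _); apply: le_trans h4; nra.
  have hM : 2 * (r0 * `|sin (pi * x)|) <= M.
    rewrite -(ler_pXn2r (n := 2)) ?nnegrE ?mulr_ge0 ?(ltW r00) //.
    rewrite ME !exprMn real_normK ?num_real //.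
    have s0 := sqr_ge0 (sin (pi * x)); have h1 := sqr_ge0 (1 - r).
    have h2 : r0 ^+ 2 <= r by rewrite expr2; nra.
    have h5 := ler_wpM2r s0 h2; rewrite -[2 ^+ 2]/(2 * 2); lra.
  rewrite mulrAC ler_pdivlMr // mulrC; nra.
apply: le_trans (cmod_le_ReIm w) _; rewrite -/x -/y (ger0_norm y0) mulrDl; lra.
Qed.

(** Herglotz's trick: iterating the duplication formula turns G(z) into a sum over 2^n rescaled
    points, whose limit is a partial fraction expansion. *)
Lemma dup_iter (G : C -> C) (k : C) :
  (forall w, e w != 1 -> G w = k * (G (w / 2) + G ((w + 1) / 2))) ->
  forall n z, e z != 1 -> G z = k ^+ n * \sum_(j < 2 ^ n) G ((z + j%:R) / 2 ^+ n).
Proof.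
move=> hG; elim=> [|n ih] z z1.
  by rewrite expn0 big_ord_recl big_ord0 !expr0 mul1r addr0 divr1 addr0.
have n2 : 2 ^+ n != 0 :> C by rewrite expf_neq0 // pnatr_eq0.
rewrite ih // exprSr -mulrA; congr (_ * _); rewrite mulr_sumr expnS mul2n -addnn big_split_ord /=.
rewrite -big_split /=; apply: eq_bigr => j _; rewrite hG.
  rewrite mulrDr; congr (_ * G _ + _ * G _); first by rewrite exprSr; field.
  by rewrite exprSr natrD natrX; field.
apply: contra z1 => /eqP h.
have : e ((2 ^ n)%:R * ((z + j%:R) / 2 ^+ n)) = 1 by rewrite cexp2piX h expr1n.
by rewrite natrX mulrC divfK // cexp2piD cexp2pi_nat mulr1 => ->.
Qed.

(** The upper half of the sample points is moved down by one period, so that they surround 0 and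
    only the pole at 0 matters. *)
Lemma dup_sym (G : C -> C) (k : C) :
  (forall w, e w != 1 -> G w = k * (G (w / 2) + G ((w + 1) / 2))) ->
  (forall w, G (w + 1) = G w) ->
  forall n z, e z != 1 -> G z = k ^+ n.+1 * \sum_(j < 2 ^ n)
    (G ((z + j%:R) / 2 ^+ n.+1) + G ((z - j.+1%:R) / 2 ^+ n.+1)).
Proof.
move=> hG G1 n z z1; rewrite (dup_iter hG n.+1 z1); congr (_ * _).
rewrite expnS mul2n -addnn big_split_ord /= big_split /=; congr (_ + _).
rewrite (reindex_inj rev_ord_inj) /=; apply: eq_bigr => j _.
rewrite -[RHS]G1; congr G; rewrite natrD natrB // natrX.
have -> : 2 ^+ n.+1 = 2 * 2 ^+ n :> C by rewrite exprS.
have n2' : 2 ^+ n != 0 :> C by rewrite expf_neq0 // pnatr_eq0.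
move: (j.+1%:R) (2 ^+ n) n2' => x y y0; by field.
Qed.

Lemma clim_2expV : clim (fun n => (2 ^+ n)^-1 : C) 0.
Proof.
have h2 : cmod (2^-1 : C) < 1 by rewrite cmodV cmod_nat; lra.
by apply: eq_clim (clim_geo h2); exists 0%N => n _; rewrite exprVn.
Qed.

Lemma clim_cexp2pi_dilate w :
  clim (fun n => 2 ^+ n * (1 - e (w / 2 ^+ n))) (- (twopii R * w)).
Proof.
move=> ep ep0; have W1 : 0 < cmod w + 1 by have := cmod_ge0 w; lra.
have := @cderiv_cexp2pi R 0; rewrite cexp2pi0 mulr1 => /(_ _ (divr_gt0 ep0 W1)) [d d0 hd].
have := climMl w clim_2expV; rewrite mulr0 => /(_ d d0)[n0 h0]; exists n0 => n /h0.
rewrite subr0 => hw; have := hd _ hw; rewrite add0r cexp2pi0.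
have n2 : 2 ^+ n != 0 :> C by rewrite expf_neq0 // pnatr_eq0.
have N2 : 0 < cmod (2 ^+ n : C) by rewrite cmod_gt0.
move=> h; rewrite (_ : _ - - _ = - (2 ^+ n * (e (w / 2 ^+ n) - 1 - twopii R * (w / 2 ^+ n)))); last first.
  move: (twopii R) (2 ^+ n) n2 (e _) => y t t0 x; by field.
rewrite cmodN cmodM.
apply: le_lt_trans (ler_wpM2l (ltW N2) h) _.
have -> : cmod (w / 2 ^+ n) = cmod w / cmod (2 ^+ n : C) by rewrite cmodM cmodV.
move: (cmod w) (cmod (2 ^+ n : C)) W1 N2 => x t x0 t0.
rewrite (_ : t * _ = ep * x / (x + 1)); last by field; rewrite !gt_eqF.
by rewrite ltr_pdivrMr // ltr_pM2l //; lra.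
Qed.

Lemma clim_cexp2pi_small w : clim (fun n => e (w / 2 ^+ n)) 1.
Proof.
have := climB (clim_cst 1) (climM clim_2expV (clim_cexp2pi_dilate w)).
rewrite mul0r subr0; apply: eq_clim; exists 0%N => n _.
have n2 : 2 ^+ n != 0 :> C by rewrite expf_neq0 // pnatr_eq0.
by rewrite mulrA mulVf // mul1r subKr.
Qed.

Lemma sum_inv_sqr n : \sum_(j < n) (j.+1%:R ^+ 2)^-1 <= 2 - n%:R^-1 :> R.
Proof.
elim: n => [|[|n] ih]; first by rewrite big_ord0 invr0; lra.
  by rewrite big_ord_recr big_ord0 /= expr1n invr1; lra.
rewrite big_ord_recr /=; apply: le_trans (lerD ih (lexx _)) _.
have n1 : 0 < n.+1%:R :> R by rewrite ltr0n.
have -> : n.+2%:R = n.+1%:R + 1 :> R by rewrite -natr1.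
move: (n.+1%:R) n1 => x x0; have x1 : 0 < x + 1 by lra.
rewrite -subr_ge0 (_ : _ - _ = (x * (x + 1) ^+ 2)^-1); last by field; rewrite !gt_eqF.
by rewrite invr_ge0 mulr_ge0 ?exprn_ge0 // ltW.
Qed.

Lemma summable_inv_sqr : summable (fun j => (j.+1%:R ^+ 2)^-1 : R).
Proof.
split=> [n|]; first by rewrite invr_ge0 exprn_ge0 ?ler0n.
exists 2 => n; apply: le_trans (sum_inv_sqr n) _.
by rewrite gerBl invr_ge0 ler0n.
Qed.

Lemma cexp2pi_half_sqr w : e w = e (w / 2) ^+ 2.
Proof. by rewrite -cexp2piX; congr e; field. Qed.

Lemma cexp2pi_half : e 2^-1 = -1.
Proof.
have -> : e 2^-1 = cexp (0 +i* pi).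
  rewrite /cexp2pi; congr cexp.
  have -> : 2^-1 = (2^-1)%:C :> C by rewrite fmorphV /= rmorph_nat.
  by apply: complex_eqP; rewrite !(complexReM, complexImM) /=; field.
by rewrite /cexp /= expR0 cospi sinpi mul1r; apply: complex_eqP; rewrite /= ?oppr0.
Qed.

Lemma cexp2pi_half_opp w : e ((w + 1) / 2) = - e (w / 2).
Proof. by rewrite mulrDl mul1r cexp2piD cexp2pi_half mulrN1. Qed.

Lemma cexp2pi_half_neq w : e w != 1 -> (1 - e (w / 2) != 0) && (1 + e (w / 2) != 0).
Proof.
rewrite cexp2pi_half_sqr => h; apply/andP; split; apply: contra h.
  by rewrite subr_eq0 => /eqP <-; rewrite expr1n.
by rewrite addrC addr_eq0 => /eqP ->; rewrite sqrrN expr1n.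
Qed.

(* z is away from the integers, in a form suited to comparison with 1/(j+1)^2. *)
Definition off_integers (c : R) z := 0 < c /\
  forall j, c * j.+1%:R <= cmod (z + j%:R) /\ c * j.+1%:R <= cmod (z - j.+1%:R).

Lemma off_integers_Im z : 0 < complex.Im z -> exists c, off_integers c z.
Proof.
set t := complex.Im z => t0; have Z0 := cmod_ge0 z.
have D0 : 0 < 1 + (cmod z + 1) / t by rewrite addr_gt0 // divr_gt0 //; lra.
(* For w = z + j or z - j - 1 one has j + 1 <= |w| + |z| + 1, and |w| >= t bounds |z| + 1 by |w|
   (|z| + 1)/t. *)
exists (1 + (cmod z + 1) / t)^-1; split; first by rewrite invr_gt0.
have key (x : R) (j : nat) : j%:R <= `|x| + 1 -> j.+1%:R <= cmod z + 1 + 1 + `|x|.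
  by rewrite -natr1; lra.
have low (w : C) (j : nat) : t <= cmod w -> j.+1%:R <= cmod w + cmod z + 1 ->
    (1 + (cmod z + 1) / t)^-1 * j.+1%:R <= cmod w.
  move=> tw jw; rewrite mulrC ler_pdivrMr // mulrDr mulr1; apply: (le_trans jw).
  rewrite -addrA lerD2l mulrCA ler_peMr //; first by lra.
  by rewrite ler_pdivlMr // mul1r.
have imn (w : C) (n : C) : complex.Im n = 0 -> complex.Im (z + n) = t by move=> h; rewrite complexImD h addr0.
have im0 n : complex.Im (n%:R : C) = 0.
  by rewrite -(rmorph_nat (real_complex R)).
move=> j; split; apply: low.
- by rewrite -(imn z j%:R) //; apply: le_trans (Im_le_cmod _); exact: ler_norm.
- have := cmodB (z + j%:R) z; rewrite (_ : _ - z = j%:R) ?cmod_nat -?natr1; [lra | ring].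
- rewrite -(imn z (- j.+1%:R)); last by rewrite complexImN im0 oppr0.
  by apply: le_trans (Im_le_cmod _); exact: ler_norm.
- have := cmodB (z - j.+1%:R) z; rewrite (_ : _ - z = - j.+1%:R) ?cmodN ?cmod_nat; [lra | ring].
Qed.

Lemma off_integers_neq0 c z j : off_integers c z -> z + j%:R != 0 /\ z - j.+1%:R != 0.
Proof.
move=> [c0 /(_ j)[h1 h2]]; have c1 : 0 < c * j.+1%:R by rewrite mulr_gt0 // ltr0n.
by split; rewrite -cmod_gt0; lra.
Qed.

(* Tannery's theorem applied to the n-fold iterate of the duplication formula;
   phi is the rescaled limit of G at 0. *)
Lemma duplication_partial_fractions (G phi : C -> C) (k : C) (c M : R) z :
  (forall w, e w != 1 -> G w = k * (G (w / 2) + G ((w + 1) / 2))) ->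
  (forall w, G (w + 1) = G w) -> e z != 1 ->
  (forall w, w != 0 -> clim (fun n => k ^+ n * G (w / 2 ^+ n)) (phi w)) ->
  off_integers c z -> 0 <= M ->
  (exists n0 : nat, forall n j, (n0 <= n)%N -> (j < 2 ^ n)%N ->
     cmod (k ^+ n.+1 * (G ((z + j%:R) / 2 ^+ n.+1) + G ((z - j.+1%:R) / 2 ^+ n.+1)))
     <= M * (j.+1%:R ^+ 2)^-1) ->
  csums (fun j => phi (z + j%:R) + phi (z - j.+1%:R)) (G z).
Proof.
move=> hG G1 z1 hphi hc M0 [n0 hM].
pose u n j := if (j < 2 ^ n)%N then
  k ^+ n.+1 * (G ((z + j%:R) / 2 ^+ n.+1) + G ((z - j.+1%:R) / 2 ^+ n.+1)) else 0.
have sv := summableZ M0 summable_inv_sqr.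
have ub n j : (n0 <= n)%N -> cmod (u n j) <= M * (j.+1%:R ^+ 2)^-1.
  move=> nn; rewrite /u; case: ifP => h; first exact: hM.
  by rewrite cmod0 mulr_ge0 // invr_ge0 exprn_ge0 ?ler0n.
have ul j : clim (fun n => u n j) (phi (z + j%:R) + phi (z - j.+1%:R)).
  have [a0 b0] := off_integers_neq0 j hc.
  have := climD (clim_shift 1 (hphi _ a0)) (clim_shift 1 (hphi _ b0)).
  apply: eq_clim; exists j => n jn; rewrite /u addn1 ifT ?mulrDr //.
  by apply: leq_ltn_trans jn _; exact: ltn_expl.
have wv j : cmod (phi (z + j%:R) + phi (z - j.+1%:R)) <= M * (j.+1%:R ^+ 2)^-1.
  by apply: (clim_cmod_le (clim_shift n0 (ul j))) => n; apply: ub; lia.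
have uE n : csum (u n) = G z.
  rewrite (@csum_finite _ _ (2 ^ n)) => [|j]; last by rewrite /u ltnNge => ->.
  rewrite (dup_sym hG G1 n z1) mulr_sumr; apply: eq_bigr => j _.
  by rewrite /u ltn_ord.
have -> : G z = csum (fun j => phi (z + j%:R) + phi (z - j.+1%:R)).
  apply: (@clim_uniq _ (fun n => csum (u n))).
    by apply: eq_clim (clim_cst (G z)); exists 0%N => n _.
  by apply: (tannery sv) => //; exists n0 => n j; exact: ub.
by apply: dominated_csums; exists (fun j => M * (j.+1%:R ^+ 2)^-1).
Qed.

(** The shift contributes at most 1/2 to the real part after rescaling, and z itself at most 1/4
    once n is large; this is the region of [cmod_le_sub1]. *)
Lemma strip_bound z : 0 <= complex.Im z -> exists n0 : nat, forall n (x : R), (n0 <= n)%N ->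
  `|x| <= 2 ^+ n -> `|complex.Re ((z + x%:C) / 2 ^+ n.+1)| <= 3 / 4 /\
  0 <= complex.Im ((z + x%:C) / 2 ^+ n.+1) <= 1.
Proof.
move=> y0; exists (Num.truncn (4 * cmod z)).+1 => n x nn hx.
have t0 : 0 < 2 ^+ n.+1 :> R by rewrite exprn_gt0.
have zn : 4 * cmod z <= 2 ^+ n.
  apply: ltW; apply: lt_le_trans (truncnS_gt _) _.
  rewrite -natrX ler_nat; apply: leq_trans nn _; exact: ltnW (ltn_expl _ _).
have -> : (2 ^+ n.+1)^-1 = (2 ^- n.+1)%:C :> C by rewrite fmorphV /= rmorphXn /= rmorph_nat.
rewrite complexReM complexImM /= !mulr0 subr0 add0r complexReD complexImD /= addr0.
have hr := Re_le_cmod z; have hi := Im_le_cmod z.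
have tE : 2 ^+ n.+1 = 2 * 2 ^+ n :> R by rewrite exprS.
have p0 : 0 < 2 ^+ n :> R by rewrite exprn_gt0.
split.
  rewrite normrM [X in _ * X]ger0_norm ?invr_ge0 ?(ltW t0) // ler_pdivrMr // tE.
  apply: le_trans (ler_normD _ _) _; lra.
apply/andP; split; first by rewrite mulr_ge0 // invr_ge0 ltW.
by rewrite ler_pdivrMr // tE mul1r; move: hi; rewrite ler_norml => /andP[_ hi]; lra.
Qed.

Lemma strip_cmod (K : R) z : 0 <= complex.Im z -> (forall w,
    `|complex.Re w| <= 3 / 4 -> 0 <= complex.Im w <= 1 -> cmod w <= K * cmod (1 - e w)) ->
  exists n0 : nat, forall n j, (n0 <= n)%N -> (j < 2 ^ n)%N ->
    cmod (z + j%:R) <= K * 2 ^+ n.+1 * cmod (1 - e ((z + j%:R) / 2 ^+ n.+1)) /\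
    cmod (z - j.+1%:R) <= K * 2 ^+ n.+1 * cmod (1 - e ((z - j.+1%:R) / 2 ^+ n.+1)).
Proof.
move=> y0 hK; have [n0 h] := strip_bound y0; exists n0 => n j nn jn.
have t0 : 0 < 2 ^+ n.+1 :> R by rewrite exprn_gt0.
have key (x : R) : `|x| <= 2 ^+ n ->
    cmod (z + x%:C) <= K * 2 ^+ n.+1 * cmod (1 - e ((z + x%:C) / 2 ^+ n.+1)).
  move=> /(h n x nn)[h1 h2]; have := hK _ h1 h2.
  have -> : cmod ((z + x%:C) / 2 ^+ n.+1) = cmod (z + x%:C) / 2 ^+ n.+1.
    by rewrite cmodM cmodV cmodX cmod_nat.
  by rewrite ler_pdivrMr // mulrAC.
split; first by rewrite -(rmorph_nat (real_complex R)); apply: key; rewrite normr_nat -natrX ler_nat ltnW.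
rewrite -(rmorph_nat (real_complex R)) -rmorphN; apply: key.
by rewrite normrN normr_nat -natrX ler_nat.
Qed.

Section Weight.
Variables (p : C -> C) (P : R) (k : nat).
Hypothesis k2 : (2 <= k)%N.
Hypothesis hP : forall x, cmod x <= 1 -> cmod (p x) <= P.
Hypothesis hpc : forall x : nat -> C, clim x 1 -> clim (fun n => p (x n)) P%:C.
Let G w : C := e w * p (e w) / (1 - e w) ^+ k.
Hypothesis hG : forall w, e w != 1 -> G w = 2^-1 ^+ k * (G (w / 2) + G ((w + 1) / 2)).

(** G is a rational function of e(w) with a pole of order k at 1, and P is the limit of its
    numerator there. By [strip_cmod] the rescaled terms are at most a constant times (j + 1)^(-k),
    hence at most that constant times (j + 1)^(-2). *)
Lemma rational_partial_fractions c z : 0 <= complex.Im z -> e z != 1 -> off_integers c z ->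
  csums (fun j => P%:C / (- (twopii R * (z + j%:R))) ^+ k + P%:C / (- (twopii R * (z - j.+1%:R))) ^+ k) (G z).
Proof.
move=> y0 z1 hc; have [K K0 hK] := cmod_le_sub1; have [c0 hc'] := hc.
have p0 := twopii_neq0 R.
have P0 : 0 <= P by apply: le_trans (cmod_ge0 (p 0)) (hP _); rewrite cmod0.
have Kc : 0 < K / c by rewrite divr_gt0.
apply: (@duplication_partial_fractions G (fun w => P%:C / (- (twopii R * w)) ^+ k) (2^-1 ^+ k) c (2 * (P * (K / c) ^+ k)) z hG _ z1 _ hc).
- by move=> w; rewrite /G cexp2piD1.
- move=> w w0; have tw : - (twopii R * w) != 0 by rewrite oppr_eq0 mulf_neq0.
  have es := clim_cexp2pi_small w.
  have := climM (climM es (hpc es)) (climX k (climV tw (clim_cexp2pi_dilate w))).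
  rewrite mul1r -exprVn; apply: eq_clim; exists 0%N => n _.
  by rewrite /G -exprM mulnC exprM exprVn exprMn invfM mulrCA exprVn [(2 ^+ n)^-1 ^+ k]exprVn.
- by rewrite !mulr_ge0 ?invr_ge0 ?exprn_ge0 // ltW.
have [n0 h] := strip_cmod y0 hK; exists n0 => n j nn jn.
have [h1 h2] := h n j nn jn; have [l1 l2] := hc' j.
have j0 : 0 < c * j.+1%:R by rewrite mulr_gt0 // ltr0n.
have t0 : 0 < 2 ^+ n.+1 :> R by rewrite exprn_gt0.
have low (w : C) (d : R) : c * j.+1%:R <= d -> d <= K * 2 ^+ n.+1 * cmod (1 - e w) ->
    0 <= complex.Im w ->
    cmod ((2^-1 ^+ k) ^+ n.+1 * G w) <= P * (K / c) ^+ k * (j.+1%:R ^+ 2)^-1.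
  move=> hd1 hd2 yw; have M0 : 0 < cmod (1 - e w).
    by rewrite -(pmulr_rgt0 _ (mulr_gt0 K0 t0)); lra.
  have ew : cmod (e w) <= 1.
    by rewrite cmod_cexp2pi -[leRHS]expR0 ler_expR oppr_le0 !mulr_ge0 ?pi_ge0.
  have -> : cmod ((2^-1 ^+ k) ^+ n.+1 * G w) =
      cmod (e w) * cmod (p (e w)) * ((2 ^+ n.+1)^-1 * (cmod (1 - e w))^-1) ^+ k.
    rewrite /G (cmodM (_ ^+ n.+1)) (cmodM (e w * _)) (cmodM (e w)) !cmodX cmodV [cmod (_ ^+ k)^-1]cmodV cmodX cmod_nat.
    by rewrite exprMn !exprVn -!exprM [(k * _)%N]mulnC; ring.
  have e0 := cmod_ge0 (e w); have pe := hP ew; have pe0 := cmod_ge0 (p (e w)).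
  have hy : (2 ^+ n.+1)^-1 * (cmod (1 - e w))^-1 <= K / c * j.+1%:R^-1.
    rewrite -invfM -mulrA -invfM -div1r ler_pdivrMr ?mulr_gt0 // mulrAC ler_pdivlMr // mul1r mulrA; lra.
  have y0' : 0 <= (2 ^+ n.+1)^-1 * (cmod (1 - e w))^-1 by rewrite mulr_ge0 // invr_ge0 ltW.
  have hj : 0 <= (j.+1%:R : R)^-1 <= 1 by rewrite invr_ge0 ler0n invf_le1 ?ltr0n // ler1n.
  apply: (@le_trans _ _ (P * ((2 ^+ n.+1)^-1 * (cmod (1 - e w))^-1) ^+ k)).
    by rewrite ler_wpM2r ?exprn_ge0 //; nra.
  rewrite -mulrA ler_wpM2l //.
  apply: (@le_trans _ _ ((K / c * j.+1%:R^-1) ^+ k)).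
    by rewrite lerXn2r ?nnegrE // (le_trans y0').
  rewrite exprMn -exprVn ler_wpM2l ?exprn_ge0 ?(ltW Kc) //.
  by case/andP: hj => ? ?; exact: ler_wiXn2l.
have im (x : C) : complex.Im x = 0 -> 0 <= complex.Im ((z + x) / 2 ^+ n.+1).
  move=> x0; have -> : (2 ^+ n.+1)^-1 = (2 ^- n.+1)%:C :> C by rewrite fmorphV /= rmorphXn /= rmorph_nat.
  by rewrite complexImM /= mulr0 add0r complexImD x0 addr0 mulr_ge0 // invr_ge0 ltW.
have imn i : complex.Im (i%:R : C) = 0 by rewrite -(rmorph_nat (real_complex R)).
have imN : complex.Im (- j.+1%:R : C) = 0 by rewrite complexImN imn oppr0.
have b1 := low _ _ l1 h1 (im _ (imn j)); have b2 := low _ _ l2 h2 (im _ imN).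
rewrite mulrDr; apply: le_trans (cmodD _ _) _; apply: le_trans (lerD b1 b2) _.
by rewrite -[leRHS]mulrA mulr_natl mulr2n.
Qed.
End Weight.
End PartialFractions.

Section EisensteinS.
Variable R : realType.
Local Notation C := R[i].
Local Notation e := (@cexp2pi R).
Implicit Types (z w tau : C).

Definition powers k : fps C := fun n => n%:R ^+ k.

Lemma rapid_powers k : rapid (powers k).
Proof. by apply: (@rapid_poly _ _ k) => n; rewrite cmodX cmod_nat. Qed.

Lemma dq_powers k : dq (powers k) = powers k.+1.
Proof. by apply/funext => n; rewrite /dq /powers exprS. Qed.

Lemma ev_powers0 (X : C) : cmod X < 1 -> ev (powers 0) X = (1 - X)^-1.
Proof.
move=> X1; rewrite -(csums_csum (csums_geo X1)); apply: eq_csum => n.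
by rewrite /powers expr0 mul1r.
Qed.

Lemma powers1 : powers 1 = powers 0 ^+ 2 - powers 0.
Proof.
apply/funext => n; rewrite fpsB expr2 fpsM /powers expr1 expr0.
under eq_bigr do rewrite !expr0 mulr1.
by rewrite sumr_const card_ord -natr1 addrK.
Qed.

Let u : fps C := powers 0.
Let du : dq u = u ^+ 2 - u. Proof. by rewrite dq_powers powers1. Qed.

(** Obtained by applying D repeatedly to u = 1/(1 - X), for which Du = u^2 - u. *)
Lemma powers3 : powers 3 = 6%:R * u ^+ 4 - 12%:R * u ^+ 3 + 7%:R * u ^+ 2 - u.
Proof.
have p2 : powers 2 = 2%:R * u ^+ 3 - 3%:R * u ^+ 2 + u.
  by rewrite -dq_powers powers1 -/u dqB dqX du /=; ring.
by rewrite -dq_powers p2 dqD dqB !dqMn !dqX du /=; ring.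
Qed.

Lemma powers5 : powers 5 =
  120%:R * u ^+ 6 - 360%:R * u ^+ 5 + 390%:R * u ^+ 4 - 180%:R * u ^+ 3 + 31%:R * u ^+ 2 - u.
Proof.
have p4 : powers 4 = 24%:R * u ^+ 5 - 60%:R * u ^+ 4 + 50%:R * u ^+ 3 - 15%:R * u ^+ 2 + u.
  by rewrite -dq_powers powers3 dqB dqD dqB !dqMn !dqX du /=; ring.
by rewrite -dq_powers p4 dqD dqB dqD dqB !dqMn !dqX du /=; ring.
Qed.

Let ru k : rapid (u ^+ k). Proof. exact: rapidX (rapid_powers 0). Qed.
Let rm m k : rapid (m%:R * u ^+ k). Proof. exact: rapidMn. Qed.
Let evm m k X : cmod X < 1 -> ev (m%:R * u ^+ k) X = m%:R / (1 - X) ^+ k.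
Proof. by move=> X1; rewrite evMn // evX ?ev_powers0 ?exprVn //; exact: rapid_powers. Qed.
Let sub1_neq0 (X : C) : cmod X < 1 -> 1 - X != 0.
Proof. by move=> X1; rewrite -cmod_gt0; have := cmod_sub_ge 1 X; rewrite cmod1; lra. Qed.

Lemma ev_powers3 (X : C) : cmod X < 1 ->
  ev (powers 3) X = X * (1 + 4 * X + X ^+ 2) / (1 - X) ^+ 4.
Proof.
move=> X1; rewrite powers3.
rewrite (evB (rapidD (rapidB (rm 6 4) (rm 12 3)) (rm 7 2)) (rapid_powers 0) X1).
rewrite (evD (rapidB (rm 6 4) (rm 12 3)) (rm 7 2) X1) (evB (rm 6 4) (rm 12 3) X1).
rewrite (evm 6 4 X1) (evm 12 3 X1) (evm 7 2 X1) (ev_powers0 X1).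
by have h := sub1_neq0 X1; field.
Qed.

Lemma ev_powers5 (X : C) : cmod X < 1 ->
  ev (powers 5) X = X * (1 + 26 * X + 66 * X ^+ 2 + 26 * X ^+ 3 + X ^+ 4) / (1 - X) ^+ 6.
Proof.
move=> X1; rewrite powers5.
have r1 := rapidB (rm 120 6) (rm 360 5); have r2 := rapidD r1 (rm 390 4).
have r3 := rapidB r2 (rm 180 3); have r4 := rapidD r3 (rm 31 2).
rewrite (evB r4 (rapid_powers 0) X1) (evD r3 (rm 31 2) X1) (evB r2 (rm 180 3) X1).
rewrite (evD r1 (rm 390 4) X1) (evB (rm 120 6) (rm 360 5) X1).
rewrite (evm 120 6 X1) (evm 360 5 X1) (evm 390 4 X1) (evm 180 3 X1) (evm 31 2 X1) (ev_powers0 X1).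
by have h := sub1_neq0 X1; field.
Qed.

(** Exchange of summation in the double series of n^k q^(mn). The row n = 0 vanishes because k > 0,
    and (n+1)(m+1) >= (n+1) + m supplies a majorant in product form. *)
Lemma ev_sig_powers k (q : C) : cmod q < 1 -> (0 < k)%N ->
  ev (sig C k) q = csum (fun m => ev (powers k) (q ^+ m.+1)).
Proof.
move=> q1 k0; rewrite -lambert_csums //.
have hr : 0 <= cmod q < 1 by rewrite cmod_ge0.
have r0 := cmod_ge0 q.
pose g n m := powers k n * (q ^+ n) ^+ m.+1.
have gv n m : cmod (g n m) <= cmod (powers k n) * cmod q ^+ n * cmod q ^+ m.
  rewrite /g cmodM -mulrA; case: n => [|n].
    by rewrite /powers expr0n; case: (k) k0 => // k' _; rewrite /= cmod0 !mul0r.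
  rewrite ler_wpM2l ?cmod_ge0 // -exprM cmodX -exprD.
  have h : (n.+1 + m <= n.+1 * m.+1)%N by rewrite mulnS leq_add2l leq_pmull.
  exact: (ler_wiXn2l r0 (ltW q1) h).
transitivity (csum (fun n => csum (g n))); last first.
  rewrite (csum_exchange (rapid_powers k hr) (summable_geo hr) gv).
  by apply: eq_csum => m; rewrite /ev; apply: eq_csum => n; rewrite /g -!exprM mulnC.
apply: eq_csum => -[|n].
  rewrite (@csum_finite _ _ 0) ?big_ord0 // => m _.
  by rewrite /g /powers expr0n; case: (k) k0 => // k' _; rewrite /= mul0r.
have qn : cmod (q ^+ n.+1) < 1 by apply: cmod_expr_lt1.
rewrite /= /g csumMl; last first.
  exists (fun m => cmod (q ^+ n.+1) ^+ m.+1) => [|m]; last by rewrite cmodX.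
  apply: summable_le (summable_geo (r := cmod (q ^+ n.+1)) _) => [m|m|].
  - by rewrite exprn_ge0 ?cmod_ge0.
  - by rewrite exprS ler_piMl ?exprn_ge0 ?cmod_ge0 // ltW.
  - by rewrite cmod_ge0.
congr (_ * _); apply: esym; apply: csums_csum.
apply: eq_clim (csumsMl (q ^+ n.+1) (csums_geo qn)).
by exists 0%N => m _; apply: eq_bigr => i _; rewrite [RHS]exprS.
Qed.

Lemma zeta_half k : (2 <= k)%N ->
  let Z := csum (fun n => (n.+1%:R ^+ k)^-1 : C) in
  csum (fun j => ((j.*2.+1)%:R ^+ k)^-1 : C) = (1 - 2^-1 ^+ k) * Z.
Proof.
move=> k2 Z.
have dom (f : nat -> nat) : (forall j, (j < f j)%N) -> dominated (fun j => ((f j)%:R ^+ k)^-1 : C).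
  move=> hf; exists (fun j => (j.+1%:R ^+ 2)^-1); first exact: summable_inv_sqr.
  move=> j; rewrite cmodV cmodX cmod_nat lef_pV2 ?posrE ?exprn_gt0 ?ltr0n //; last by apply: leq_ltn_trans (hf j).
  apply: (@le_trans _ _ (j.+1%:R ^+ k)).
    by rewrite ler_weXn2l // ler1n.
  by rewrite lerXn2r ?nnegrE ?ler0n // ler_nat.
pose f n : C := (n.+1%:R ^+ k)^-1.
have d1 := dom (fun j => j.*2.+1) (fun j => ltac:(lia)).
have d2 := dom succn (fun j => leqnn _).
have h : csums (fun j => f j.*2 + f j.*2.+1) Z.
  apply: eq_clim (clim_comp (m := double) (dominated_csums d2) _); last first.
    by move=> n0; exists n0 => j; lia.
  exists 0%N => n _; elim: n => [|n ih]; first by rewrite !big_ord0.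
  by rewrite doubleS !big_ord_recr /= -ih addrA.
have d3 := dom (fun j => j.*2.+2) (fun j => ltac:(lia)).
have e1 : csum (fun j => f j.*2) + csum (fun j => f j.*2.+1) = Z.
  by rewrite -(csumD d1 d3); exact: csums_csum h.
suff e2 : csum (fun j => f j.*2.+1) = 2^-1 ^+ k * Z.
  by move: e1; rewrite e2 mulrBl mul1r => /(canRL (addrK _)).
rewrite -(csumMl _ d2); apply: eq_csum => j; rewrite /f exprVn -invfM -exprMn -natrM.
by congr ((_%:R ^+ _)^-1); lia.
Qed.
End EisensteinS.

Section LatticeSum.
Variable R : realType.
Local Notation C := R[i].
Local Notation e := (@cexp2pi R).
Implicit Types (z w tau : C).
Variables (p : C -> C) (P : R) (k : nat).
Hypothesis k4 : (4 <= k)%N.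
Hypothesis keven : ~~ odd k.
Hypothesis hP : forall x, cmod x <= 1 -> cmod (p x) <= P.
Hypothesis hpc : forall x : nat -> C, clim x 1 -> clim (fun n => p (x n)) P%:C.
Let G w : C := e w * p (e w) / (1 - e w) ^+ k.
Hypothesis hG : forall w, e w != 1 -> G w = 2^-1 ^+ k * (G (w / 2) + G ((w + 1) / 2)).
Hypothesis hGev : forall x, cmod x < 1 -> ev (powers R k.-1) x = x * p x / (1 - x) ^+ k.

Let opp_even z : (- z) ^+ k = z ^+ k.
Proof. by rewrite exprNn -signr_odd (negbTE keven) mul1r. Qed.

Lemma lipschitz_sum c z : 0 <= complex.Im z -> e z != 1 -> off_integers c z ->
  twopii R ^+ k * G z =
  P%:C * (csum (fun j => ((z + j%:R) ^+ k)^-1) + csum (fun j => ((z - j.+1%:R) ^+ k)^-1)) /\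
  dominated (fun j => ((z + j%:R) ^+ k)^-1) /\ dominated (fun j => ((z - j.+1%:R) ^+ k)^-1).
Proof.
move=> y0 z1 hc; have [c0 hc'] := hc.
have dom (f : nat -> C) : (forall j, c * j.+1%:R <= cmod (f j)) -> dominated (fun j => (f j ^+ k)^-1).
  move=> hf; exists (fun j => c^-1 ^+ k * (j.+1%:R ^+ 2)^-1).
    by apply: summableZ (@summable_inv_sqr R); rewrite exprn_ge0 // invr_ge0 ltW.
  move=> j; have j0 : 0 < c * j.+1%:R by rewrite mulr_gt0 // ltr0n.
  rewrite cmodV cmodX; apply: (@le_trans _ _ ((c * j.+1%:R) ^+ k)^-1).
    rewrite lef_pV2 ?posrE ?exprn_gt0 //; last exact: lt_le_trans (hf j).
    by rewrite lerXn2r ?nnegrE ?cmod_ge0 // ltW.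
  rewrite exprMn invfM exprVn ler_wpM2l ?invr_ge0 ?exprn_ge0 ?(ltW c0) //.
  rewrite lef_pV2 ?posrE ?exprn_gt0 ?ltr0n // ler_weXn2l ?ler1n //; exact: leq_trans k4.
have d1 := dom _ (fun j => (hc' j).1); have d2 := dom _ (fun j => (hc' j).2).
split; last by [].
have k2 : (2 <= k)%N by exact: leq_trans k4.
have p0 := twopii_neq0 R.
have h := csumsMl (twopii R ^+ k) (rational_partial_fractions k2 hP hpc hG y0 z1 hc).
rewrite -(csums_csum h) -(csumD d1 d2) -(csumMl _ (dominatedD d1 d2)).
apply: eq_csum => j; rewrite !opp_even !(exprMn k (twopii R)) !invfM.
have : twopii R ^+ k != 0 by rewrite expf_neq0.
move: (twopii R ^+ k) ((z + _) ^+ k)^-1 ((z - _) ^+ k)^-1 => t a b t0.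
by field.
Qed.

Definition zetaval : C := csum (fun n => (n.+1%:R ^+ k)^-1).

(** At z = 1/2 one has e(z) = - 1 and the two half-series of poles are equal, each a sum over odd
    integers. This ties (2 pi i)^k to zeta(k) without Bernoulli numbers. *)
Lemma zetaval_half :
  twopii R ^+ k * (- p (-1) / 2 ^+ k) = P%:C * (2 * 2 ^+ k * (1 - 2^-1 ^+ k) * zetaval).
Proof.
have hC : (2^-1)%:C = 2^-1 :> C by rewrite fmorphV /= rmorph_nat.
have e2' : e (2^-1 : C) != 1.
  by rewrite cexp2pi_half; apply/eqP => /eqP; rewrite -subr_eq0 -opprD oppr_eq0 -mulr2n pnatr_eq0.
have hc : off_integers 4^-1 (2^-1 : C).
  split=> [|j]; first by rewrite invr_gt0.
  rewrite -hC -!(rmorph_nat (real_complex R)) -rmorphD -rmorphB /= !cmodR.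
  have j0 : 0 <= j%:R :> R by [].
  by rewrite -(natr1 j); split; [rewrite ger0_norm; lra | rewrite ler0_norm; lra].
have y0 : 0 <= complex.Im (2^-1 : C) by rewrite -hC.
have k2 : (2 <= k)%N by exact: leq_trans k4.
have [] := lipschitz_sum y0 e2' hc; rewrite /G cexp2pi_half => h [d1 d2].
have -> : - p (-1) / 2 ^+ k = -1 * p (-1) / (1 - -1) ^+ k :> C.
  by rewrite mulN1r opprK.
rewrite h -(mulrA (2 * _)) -(zeta_half R k2); congr (_ * _).
have t2 : 2 ^+ k != 0 :> C by rewrite expf_neq0 // pnatr_eq0.
have half (x : C) (n : nat) : 2 * x = n%:R -> (n%:R ^+ k)^-1 = 2^-1 ^+ k * (x ^+ k)^-1 :> C.
  by move=> <-; rewrite exprMn invfM exprVn.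
have eh j : ((j.*2.+1)%:R ^+ k)^-1 = 2^-1 ^+ k * ((2^-1 + j%:R) ^+ k)^-1 :> C.
  by apply: half; rewrite mulrDr divff ?pnatr_eq0 // -natrM addrC natr1; congr (_%:R); lia.
have -> : csum (fun j => ((2^-1 - j.+1%:R) ^+ k)^-1 : C) = csum (fun j => ((2^-1 + j%:R) ^+ k)^-1).
  apply: eq_csum => j; rewrite -opp_even; congr ((_ ^+ _)^-1).
  by rewrite -(natr1 j); field.
rewrite (eq_csum eh) (csumMl _ d1) exprVn.
by move: (csum _) => x; field.
Qed.

Let g z y : C := ((z + y%:R) ^+ k)^-1 + ((z - y%:R) ^+ k)^-1.

Lemma lipschitz z : 0 < complex.Im z ->
  twopii R ^+ k * ev (powers R k.-1) (e z) = P%:C * ((z ^+ k)^-1 + csum (fun n => g z n.+1)).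
Proof.
move=> z0; have [c hc] := off_integers_Im z0.
have z1 : e z != 1.
  by apply/eqP => h; have := cexp2pi_lt1 z0; rewrite h cmod1 ltxx.
have [h [d1 d2]] := lipschitz_sum (ltW z0) z1 hc.
rewrite hGev ?cexp2pi_lt1 // h (csum_recl d1) addr0 -addrA; congr (_ * (_ + _)).
by rewrite -(csumD (dominated_tail d1) d2).
Qed.

(** With A = |m tau + n| and t = Im tau, A >= m t and n <= A (1 + |tau|/t), so mn is at most a
    constant times A^2. Four of the k factors thus give m^(-2) n^(-2), and the other k - 4 are
    bounded through A >= t. *)
Lemma lattice_bound tau : 0 < complex.Im tau -> exists2 K : R, 0 <= K & forall m n,
  cmod (g (m.+1%:R * tau) n.+1) <= K * (m.+1%:R ^+ 2)^-1 * (n.+1%:R ^+ 2)^-1.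
Proof.
set t := complex.Im tau => t0; have T0 := cmod_ge0 tau.
pose L := (1 + cmod tau / t) / t.
have L0 : 0 < L by rewrite divr_gt0 // ltr_pwDl // divr_ge0 // ltW.
pose D := (t ^+ (k - 4))^-1; have D0 : 0 < D by rewrite invr_gt0 exprn_gt0.
exists (2 * (L ^+ 2 * D)); first by rewrite mulr_ge0 // mulr_ge0 ?(ltW D0) // exprn_ge0 // ltW.
move=> m n; have mt : complex.Im (m.+1%:R * tau) = m.+1%:R * t.
  by rewrite -(rmorph_nat (real_complex R)) complexImM /= mul0r addr0.
have key (y : C) : complex.Im y = 0 -> cmod y = n.+1%:R ->
    cmod ((m.+1%:R * tau + y) ^+ k)^-1 <= L ^+ 2 * D * (m.+1%:R ^+ 2)^-1 * (n.+1%:R ^+ 2)^-1.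
  move=> y0 yn; set A := cmod (m.+1%:R * tau + y).
  have m0 : 1 <= m.+1%:R :> R by rewrite ler1n.
  have n0 : 0 < n.+1%:R :> R by rewrite ltr0n.
  have A1 : m.+1%:R * t <= A.
    rewrite -mt -[leLHS]addr0 -y0 -complexImD; apply: le_trans (Im_le_cmod _); exact: ler_norm.
  have At : t <= A by nra.
  have A0 : 0 < A by lra.
  have A2 : n.+1%:R <= A * (1 + cmod tau / t).
    rewrite mulrDr mulr1; have := cmodB (m.+1%:R * tau + y) (m.+1%:R * tau).
    rewrite addrC addKr yn -/A cmodM cmod_nat => h; apply: (le_trans h); rewrite lerD2l.
    by rewrite mulrCA mulrC ler_wpM2l // ler_pdivlMr.
  have A3 : m.+1%:R * n.+1%:R <= A ^+ 2 * L.
    have -> : A ^+ 2 * L = A / t * (A * (1 + cmod tau / t)) by rewrite /L expr2; ring.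
    by rewrite ler_pM ?ler0n // ler_pdivlMr.
  rewrite cmodV cmodX -/A -(subnK k4) exprD invfM.
  have h1 : (A ^+ (k - 4))^-1 <= D.
    by rewrite lef_pV2 ?posrE ?exprn_gt0 // lerXn2r ?nnegrE // ltW.
  have h2 : (A ^+ 4)^-1 <= L ^+ 2 * (m.+1%:R ^+ 2)^-1 * (n.+1%:R ^+ 2)^-1.
    rewrite -mulrA -invfM -exprMn -[leLHS]div1r ler_pdivrMr ?exprn_gt0 // mulrAC.
    rewrite ler_pdivlMr ?exprn_gt0 ?mulr_gt0 ?ltr0n // mul1r.
    have -> : L ^+ 2 * A ^+ 4 = (A ^+ 2 * L) ^+ 2 by ring.
    have u0 : 0 <= m.+1%:R * n.+1%:R :> R by rewrite mulr_ge0 ?ler0n.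
    by rewrite lerXn2r ?nnegrE //; exact: le_trans A3.
  apply: (@le_trans _ _ (D * (L ^+ 2 * (m.+1%:R ^+ 2)^-1 * (n.+1%:R ^+ 2)^-1))).
    by rewrite ler_pM ?invr_ge0 ?exprn_ge0 ?(ltW A0).
  by move: (L ^+ 2) (m.+1%:R ^- 2) (n.+1%:R ^- 2) => x v u; rewrite !mulrA (mulrC x).
have hn : complex.Im (n.+1%:R : C) = 0 by rewrite -(rmorph_nat (real_complex R)).
have hn' : complex.Im (- n.+1%:R : C) = 0 by rewrite complexImN hn oppr0.
have b1 := key _ hn (cmod_nat R n.+1); have b2 := key _ hn' (etrans (cmodN _) (cmod_nat R n.+1)).
apply: le_trans (cmodD _ _) _; apply: le_trans (lerD b1 b2) _.
by rewrite -!(mulrA 2) mulr_natl mulr2n.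
Qed.

Let row tau m := csum (fun n => g (m.+1%:R * tau) n.+1).

Let row_dom tau : 0 < complex.Im tau -> dominated (row tau).
Proof.
move=> /lattice_bound[K K0 hK]; have [_ [M hM]] := @summable_inv_sqr R.
exists (fun m => K * M * (m.+1%:R ^+ 2)^-1) => [|m].
  apply: summableZ (@summable_inv_sqr R); rewrite mulr_ge0 //.
  by apply: le_trans (hM 0%N); rewrite big_ord0.
have c0 : 0 <= K * (m.+1%:R ^+ 2)^-1 by rewrite mulr_ge0 // invr_ge0 exprn_ge0 ?ler0n.
apply: (cmod_csum (summableZ c0 (@summable_inv_sqr R)) (hK m)) => n.
by rewrite -mulr_sumr [leRHS]mulrAC ler_wpM2l.
Qed.

Let zeta_dom : dominated (fun n => (n.+1%:R ^+ k)^-1 : C).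
Proof.
exists (fun j => (j.+1%:R ^+ 2)^-1); first exact: summable_inv_sqr.
move=> j; rewrite cmodV cmodX cmod_nat lef_pV2 ?posrE ?exprn_gt0 ?ltr0n //.
by rewrite ler_weXn2l ?ler1n //; exact: leq_trans k4.
Qed.

Lemma lattice_sum tau : 0 < complex.Im tau ->
  twopii R ^+ k * ev (sig C k.-1) (e tau) = P%:C * (zetaval / tau ^+ k + csum (row tau)).
Proof.
move=> t0; have k1 : (0 < k.-1)%N by rewrite -ltnS prednK; exact: leq_trans k4.
have T0 : twopii R ^+ k != 0 by rewrite expf_neq0 // twopii_neq0.
rewrite ev_sig_powers ?cexp2pi_lt1 //.
have rE m : ev (powers R k.-1) (e tau ^+ m.+1) =
    (twopii R ^+ k)^-1 * P%:C * ((tau ^+ k)^-1 * (m.+1%:R ^+ k)^-1 + row tau m).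
  have mt : complex.Im (m.+1%:R * tau) = m.+1%:R * complex.Im tau.
    by rewrite -(rmorph_nat (real_complex R)) complexImM /= mul0r addr0.
  apply: (mulfI T0); rewrite -cexp2piX lipschitz; last by rewrite mt mulr_gt0 ?ltr0n.
  by rewrite !mulrA divff // mul1r exprMn invfM [X in _ * (X + _) = _]mulrC.
have dz : dominated (fun m => (tau ^+ k)^-1 * (m.+1%:R ^+ k)^-1).
  have [v s b] := zeta_dom; exists (fun n => cmod (tau ^+ k)^-1 * v n) => [|n].
    by apply: summableZ s; exact: cmod_ge0.
  by rewrite cmodM ler_wpM2l ?cmod_ge0.
have dr := row_dom t0.
rewrite (eq_csum rE) (csumMl _ (dominatedD dz dr)) (csumD dz dr) (csumMl _ zeta_dom) !mulrA divff // mul1r.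
by rewrite [_^-1 * _]mulrC.
Qed.

Lemma Im_Ninv tau : 0 < complex.Im tau -> 0 < complex.Im (- tau^-1).
Proof.
case: tau => x y /= y0; rewrite ?mulNr opprK divr_gt0 //.
by rewrite ltr_wpDl ?sqr_ge0 // exprn_gt0.
Qed.

(** Replacing tau by - 1/tau exchanges the roles of m and n up to the factor tau^k; absolute
    convergence lets the double sum be transposed back. *)
Lemma lattice_sum_inv tau : 0 < complex.Im tau ->
  twopii R ^+ k * ev (sig C k.-1) (e (- tau^-1)) = tau ^+ k * P%:C * (zetaval + csum (row tau)).
Proof.
move=> t0; have T0 : tau != 0 by apply/eqP => h; rewrite h ltxx in t0.
have [K K0 hK] := lattice_bound t0.
rewrite (lattice_sum (Im_Ninv t0)) opp_even exprVn invrK (mulrC zetaval).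
have gE m n : g (m.+1%:R * - tau^-1) n.+1 = tau ^+ k * g (n.+1%:R * tau) m.+1.
  rewrite /g; have -> : m.+1%:R * - tau^-1 + n.+1%:R = (n.+1%:R * tau - m.+1%:R) / tau by field.
  have -> : m.+1%:R * - tau^-1 - n.+1%:R = - ((n.+1%:R * tau + m.+1%:R) / tau) by field.
  rewrite opp_even [(_ / tau) ^+ k]exprMn [((_ + _) / tau) ^+ k]exprMn exprVn !invfM invrK.
  by rewrite mulrDr addrC; congr (_ + _); rewrite mulrC.
have dr := row_dom t0.
have rowE : csum (row (- tau^-1)) = tau ^+ k * csum (row tau).
  rewrite -(csumMl _ dr).
  have sK' := summableZ (mulr_ge0 (cmod_ge0 (tau ^+ k)) K0) (@summable_inv_sqr R).
  transitivity (csum (fun n => csum (fun m => tau ^+ k * g (n.+1%:R * tau) m.+1))).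
    rewrite -(csum_exchange (g := fun m n => tau ^+ k * g (n.+1%:R * tau) m.+1) sK' (@summable_inv_sqr R)).
      by apply: eq_csum => m; apply: eq_csum => n; exact: gE.
    move=> m n; have h := ler_wpM2l (cmod_ge0 (tau ^+ k)) (hK n m).
    by rewrite cmodM; apply: le_trans h _; rewrite !mulrA [leLHS]mulrAC.
  apply: eq_csum => m; rewrite csumMl //.
  exists (fun n => K * (m.+1%:R ^+ 2)^-1 * (n.+1%:R ^+ 2)^-1) => //.
  apply: summableZ (@summable_inv_sqr R); rewrite mulr_ge0 // invr_ge0 exprn_ge0 ?ler0n //.
by rewrite [X in _ * (_ + X)]rowE; ring.
Qed.

(* The hypothesis says N = -2k/B_k; it compares the value at z = 1/2 of the
   partial fractions with zeta(k). *)
Lemma eisenstein_inv (N : C) tau : 0 < complex.Im tau ->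
  N * (- p (-1) / 2 ^+ k) = 2 * 2 ^+ k * (1 - 2^-1 ^+ k) ->
  1 + N * ev (sig C k.-1) (e (- tau^-1)) = tau ^+ k * (1 + N * ev (sig C k.-1) (e tau)).
Proof.
move=> t0 hN; have T0 : tau ^+ k != 0 by rewrite expf_neq0 //; apply/eqP => h; rewrite h ltxx in t0.
have hz := zetaval_half; have h1 := lattice_sum t0; have h2 := lattice_sum_inv t0.
have c0 : 2 * 2 ^+ k * (1 - 2^-1 ^+ k) != 0 :> C.
  rewrite -mulrA mulf_neq0 ?pnatr_eq0 // mulrBr mulr1 exprVn divff ?expf_neq0 ?pnatr_eq0 //.
  by rewrite subr_eq0 -natrX pnatr_eq1 gtn_eqF // -[1%N](expn0 2) ltn_exp2l //; exact: leq_trans k4.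
have t1 : twopii R ^+ k != 0 by rewrite expf_neq0 // twopii_neq0.
move: hz h1 h2 hN c0.
move: (_ * (1 - _)) (- p (-1) / _) (ev _ (e tau)) (ev _ (e (- tau^-1))) zetaval (csum _) (twopii R ^+ k) t1 (tau ^+ k) T0.
move=> c v x y Z D t t1 T T0 hz h1 h2 hN c0.
(* Here t = (2 pi i)^k: the constant term 1 of the Eisenstein series is N P zeta(k) / t, exactly the
   row m = 0 of the lattice sum. *)
have NZ : N * (P%:C * Z) = t.
  by apply: (mulfI c0); transitivity (N * (P%:C * (c * Z))); [ring | rewrite -hz -hN; ring].
apply: (mulfI t1); transitivity (t + N * (t * y)); first by ring.
transitivity (t + T * (N * (P%:C * Z)) + T * N * (P%:C * (Z / T + D)) - N * (P%:C * Z)).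
  by rewrite h2; field.
by rewrite -h1 NZ; ring.
Qed.

End LatticeSum.

(** * Transformation of E4 and E6 under tau -> - 1/tau *)

Section ModularLaws.
Variable R : realType.
Local Notation C := R[i].
Local Notation e := (@cexp2pi R).
Implicit Types (z w tau : C).

Lemma E4_inv tau : 0 < complex.Im tau -> E4 (- tau^-1) = tau ^+ 4 * E4 tau.
Proof.
move=> t0; pose p (x : C) : C := 1 + 4 * x + x ^+ 2.
have hP x : cmod x <= 1 -> cmod (p x) <= 6.
  move=> x1; have x0 := cmod_ge0 x; rewrite /p.
  have a1 := cmodD (1 + 4 * x) (x ^+ 2); have a2 := cmodD 1 (4 * x).
  move: a1 a2; rewrite cmod1 cmodX (cmodM 4) cmod_nat expr2 => a1 a2; nra.
have hpc (x : nat -> C) : clim x 1 -> clim (fun n => p (x n)) 6%:C.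
  move=> hx; have -> : 6%:C = 1 + 4 * 1 + 1 ^+ 2 :> C by rewrite (rmorph_nat (real_complex R)); ring.
  exact: climD (climD (clim_cst 1) (climMl 4 hx)) (climX 2 hx).
(* With Y = e(w/2) one has e(w) = Y^2 and e((w+1)/2) = - Y, so duplication is an identity of
   rational functions in Y. *)
have hG w : e w != 1 -> e w * p (e w) / (1 - e w) ^+ 4 = 2^-1 ^+ 4 *
    (e (w / 2) * p (e (w / 2)) / (1 - e (w / 2)) ^+ 4 +
     e ((w + 1) / 2) * p (e ((w + 1) / 2)) / (1 - e ((w + 1) / 2)) ^+ 4).
  move=> /cexp2pi_half_neq; rewrite cexp2pi_half_opp (cexp2pi_half_sqr w) opprK /p.
  move: (e (w / 2)) => Y /andP[h1 h2].
  have -> : 1 - Y ^+ 2 = (1 - Y) * (1 + Y) by ring.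
  by field; rewrite h1 h2.
have q1 := cexp2pi_lt1 t0; have q2 := cexp2pi_lt1 (Im_Ninv t0).
(* p(-1) = - 2, and both sides equal 30. *)
have hN : (240) * (- p (-1) / 2 ^+ 4) = 2 * 2 ^+ 4 * (1 - 2^-1 ^+ 4) by rewrite /p; field.
have h := eisenstein_inv (k := 4) erefl erefl hP hpc hG (@ev_powers3 R) t0 hN.
rewrite /E4 (lambertE _ q1) (lambertE _ q2); exact: h.
Qed.

Lemma E6_inv tau : 0 < complex.Im tau -> E6 (- tau^-1) = tau ^+ 6 * E6 tau.
Proof.
move=> t0; pose p (x : C) : C := 1 + 26 * x + 66 * x ^+ 2 + 26 * x ^+ 3 + x ^+ 4.
have hP x : cmod x <= 1 -> cmod (p x) <= 120.
  move=> x1; have x0 := cmod_ge0 x; rewrite /p.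
  have b1 := cmodD (1 + 26 * x + 66 * x ^+ 2 + 26 * x ^+ 3) (x ^+ 4).
  have b2 := cmodD (1 + 26 * x + 66 * x ^+ 2) (26 * x ^+ 3).
  have b3 := cmodD (1 + 26 * x) (66 * x ^+ 2); have b4 := cmodD 1 (26 * x).
  move: b1 b2 b3 b4; rewrite cmod1 !(cmodM _ (_ ^+ _)) (cmodM 26 x) !cmod_nat !cmodX.
  have c2 : cmod x ^+ 2 <= 1 by rewrite exprn_ile1.
  have c3 : cmod x ^+ 3 <= 1 by rewrite exprn_ile1.
  have c4 : cmod x ^+ 4 <= 1 by rewrite exprn_ile1.
  lra.
have hpc (x : nat -> C) : clim x 1 -> clim (fun n => p (x n)) 120%:C.
  move=> hx; have -> : 120%:C = 1 + 26 * 1 + 66 * 1 ^+ 2 + 26 * 1 ^+ 3 + 1 ^+ 4 :> C by rewrite (rmorph_nat (real_complex R)); ring.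
  exact: climD (climD (climD (climD (clim_cst 1) (climMl 26 hx)) (climMl 66 (climX 2 hx))) (climMl 26 (climX 3 hx))) (climX 4 hx).
have hG w : e w != 1 -> e w * p (e w) / (1 - e w) ^+ 6 = 2^-1 ^+ 6 *
    (e (w / 2) * p (e (w / 2)) / (1 - e (w / 2)) ^+ 6 +
     e ((w + 1) / 2) * p (e ((w + 1) / 2)) / (1 - e ((w + 1) / 2)) ^+ 6).
  move=> /cexp2pi_half_neq; rewrite cexp2pi_half_opp (cexp2pi_half_sqr w) opprK /p.
  move: (e (w / 2)) => Y /andP[h1 h2].
  have -> : 1 - Y ^+ 2 = (1 - Y) * (1 + Y) by ring.
  by field; rewrite h1 h2.
have q1 := cexp2pi_lt1 t0; have q2 := cexp2pi_lt1 (Im_Ninv t0).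
have hN : (- 504) * (- p (-1) / 2 ^+ 6) = 2 * 2 ^+ 6 * (1 - 2^-1 ^+ 6) by rewrite /p; field.
have h := eisenstein_inv (k := 6) erefl erefl hP hpc hG (@ev_powers5 R) t0 hN.
rewrite /E6 (lambertE _ q1) (lambertE _ q2); move: (ev _ (e tau)) (ev _ (e (- tau^-1))) h => x y.
by rewrite !mulNr.
Qed.

End ModularLaws.

(** * Zeros of E4 and E6 *)

Section Zeros.
Variable R : realType.
Local Notation C := R[i].
Local Notation e := (@cexp2pi R).
Implicit Types (z w tau : C).

Lemma count_divisor_pairs n : (count (fun p => p.1 * p.2 == n)%N (box n) <= n)%N.
Proof.
rewrite -size_filter; set s := seq.filter _ _; rewrite -(size_map fst) -[leqRHS](size_iota 1).
apply: uniq_leq_size => [|a /mapP[[x y]]].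
  rewrite map_inj_in_uniq ?filter_uniq ?box_uniq // => -[a x] [b y].
  rewrite !mem_filter !mem_box /= => /andP[/eqP h1 h2] /andP[/eqP h3 h4] ab.
  by subst b; congr pair; nia.
by rewrite mem_filter mem_box mem_iota /= => /andP[_ h] ->; lia.
Qed.

Lemma sig_cmod_le k n : cmod (sig C k n) <= n%:R ^+ k.+1.
Proof.
rewrite /sig /divsum; apply: le_trans (cmod_sum _ _ _) _.
apply: (@le_trans _ _ (\sum_(p <- box n | (p.1 * p.2 == n)%N) n%:R ^+ k)).
  rewrite big_seq_cond [leRHS]big_seq_cond; apply: ler_sum => -[a x] /=.
  rewrite mem_box /= => /andP[h _]; rewrite cmodX cmod_nat lerXn2r ?nnegrE ?ler0n //.
  by rewrite ler_nat; lia.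
rewrite big_const_seq iter_addr_0 -[leLHS]mulr_natl exprS ler_wpM2r ?exprn_ge0 ?ler0n //.
by rewrite ler_nat; exact: count_divisor_pairs.
Qed.

(** 2187/128 = (3/2)^7, and (n + 3)/(n + 2) <= 3/2. The exponent is 6 from the coefficient bound
    plus 1 from the difference of powers. *)
Lemma seventh_power_le n : n.+2%:R ^+ 7 <= 128 * (2187 / 128) ^+ n :> R.
Proof.
elim: n => [|n ih]; first by rewrite expr0 mulr1; lra.
rewrite [(_ / _) ^+ _]exprS; have h : 2 * n.+3%:R <= 3 * n.+2%:R :> R by rewrite -!natrM ler_nat; lia.
have h7 : (2 * n.+3%:R) ^+ 7 <= (3 * n.+2%:R) ^+ 7 :> R.
  by rewrite lerXn2r ?nnegrE ?mulr_ge0 ?ler0n.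
move: ih; move: ((2187 / 128) ^+ n) => a ih; move: h7; rewrite !exprMn -[2 ^+ 7]/(2*(2*(2*(2*(2*(2*2)))))) -[3 ^+ 7]/(3*(3*(3*(3*(3*(3*3)))))).
move: ih; move: (n.+3%:R ^+ 7) (n.+2%:R ^+ 7) => b c; lra.
Qed.

Lemma cmod_subX_le (q q' : C) (r : R) n : cmod q <= r -> cmod q' <= r ->
  cmod (q ^+ n.+1 - q' ^+ n.+1) <= n.+1%:R * r ^+ n * cmod (q - q').
Proof.
move=> h h'; have r0 : 0 <= r by exact: le_trans (cmod_ge0 _) h.
rewrite subrXX cmodM mulrC ler_wpM2r ?cmod_ge0 //; apply: le_trans (cmod_sum _ _ _) _.
apply: (@le_trans _ _ (\sum_(i < n.+1) r ^+ n)); last by rewrite sumr_const card_ord mulr_natl.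
apply: ler_sum => i _; rewrite cmodM !cmodX.
rewrite -[in leRHS](subnK (leq_ord i)) exprD /=.
by rewrite ler_pM ?exprn_ge0 ?cmod_ge0 // lerXn2r ?nnegrE ?cmod_ge0.
Qed.

(* The hypothesis on f bounds the tail of the difference quotient of its sum by
   128 r / (1 - (2187/128) r) < 1 at r = 1/146. *)
Lemma ev_inj_small (f : fps C) (q q' : C) : rapid f -> f 1%N = 1 ->
  (forall n, cmod (f n) <= n%:R ^+ 6) -> cmod q <= 146^-1 -> cmod q' <= 146^-1 ->
  ev f q = ev f q' -> q = q'.
Proof.
move=> rf f1 fb hq hq' ee; apply/eqP; rewrite -subr_eq0 -cmod_eq0.
have q1 : cmod q < 1 by lra.
have q1' : cmod q' < 1 by lra.
pose u n := f n * q ^+ n - f n * q' ^+ n.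
have d1 := rapid_dominated rf q1; have d2 := rapid_dominated rf q1'.
have du : dominated u := dominatedD d1 (dominatedN d2).
have u0 : csum u = 0.
  rewrite /u (csumD d1 (dominatedN d2)) (csumN d2).
  by apply/eqP; rewrite subr_eq0; apply/eqP.
move: u0; rewrite (csum_recl du) (csum_recl (dominated_tail du)) /u !expr0 !expr1 subrr add0r f1 !mul1r.
set S := csum _ => /eqP; rewrite addr_eq0 => /eqP h.
have Sb : cmod S <= cmod (q - q') * (128 / 146 / (1 - 2187 / 128 / 146)).
  have c0 := cmod_ge0 (q - q').
  pose s : R := 2187 / 128 / 146; have hs : 0 <= s < 1 by rewrite /s; apply/andP; split; lra.
  have c1 : 0 <= cmod (q - q') * (128 / 146) by apply: (mulr_ge0 c0); lra.
  apply: (cmod_csum (summableZ c1 (summable_geo hs))).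
    move=> n; rewrite -mulrBr cmodM; have t := cmod_subX_le n.+1 hq hq'.
    have h7 := seventh_power_le n; have h6 := fb n.+2.
    rewrite /s (exprMn n (2187 / 128) 146^-1); move: t; rewrite [146^-1 ^+ _]exprS.
    have v : 0 <= 146^-1 ^+ n :> R by rewrite exprn_ge0 // invr_ge0.
    have X0 := cmod_ge0 (f n.+2); have Y0 := cmod_ge0 (q ^+ n.+2 - q' ^+ n.+2).
    move: v h7 h6 X0 Y0 c0; move: (146^-1 ^+ n) ((2187 / 128) ^+ n) (cmod (f _)).
    move: (cmod (q ^+ _ - _)) (cmod (q - q')) (n.+2%:R : R) => Y D N r S' X r0 h7 h6 X0 Y0 D0 hY.
    apply: le_trans (ler_pM X0 Y0 h6 hY) _.
    have -> : N ^+ 6 * (N * (146^-1 * r) * D) = N ^+ 7 * (r * D / 146) by ring.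
    have -> : D * (128 / 146) * (S' * r) = 128 * S' * (r * D / 146) by ring.
    have H : 0 <= r * D / 146 by apply: divr_ge0; [exact: mulr_ge0 | exact: ler0n].
    exact: (ler_wpM2r H h7).
  move=> n; rewrite -mulr_sumr -mulrA; apply: (ler_wpM2l c0).
  by apply: ler_wpM2l; [lra | exact: (geo_sum_le n hs)].
move: Sb; rewrite -(cmodN S) -h; have := cmod_ge0 (q - q').
(* 146 is the least integer N with 128 + 2187/128 < N, which is what makes this ratio less than
   1. *)
have k : 128 / 146 / (1 - 2187 / 128 / 146) <= 999 / 1000 :> R by rewrite ler_pdivrMr; lra.
move: (cmod _) (_ / (1 - _)) k => x y y1 x0 xs; apply/eqP; nra.
Qed.

(** The triple angle formula gives (s + 1)(2s - 1)^2 = 0 for s = sin(pi/6), so s = 1/2, and sin x <=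
    x does the rest. *)
Lemma pi_ge3 : 3 <= pi :> R.
Proof.
have p2 := pi_ge2 R; have p4 := pihalf_lt2 R.
pose s : R := sin (pi / 6).
have s0 : 0 < s by apply: sin_gt0_pi; apply/andP; split; lra.
have h : 1 = 3 * s - 4 * s ^+ 3.
  have h1 : sin (pi / 6 *+ 2 + pi / 6) = 1 :> R.
    by rewrite -[RHS]sin_pihalf; congr sin; rewrite mulr2n; field.
  have hc := cos2Dsin2 (pi / 6 : R); rewrite -[LHS]h1 sinD sin_mulr2n cos_mulr2n.
  move: hc; rewrite -/s; move: (cos _) s {s0 h1} => c s hc.
  have {}hc : c ^+ 2 = 1 - s ^+ 2 by lra.
  have -> : (c * s) *+ 2 * c = 2 * s * c ^+ 2 by ring.
  by rewrite hc; ring.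
have s12 : s = 1 / 2.
  have : (s + 1) * (2 * s - 1) ^+ 2 = 0 by move: h => {s0}; move: s => s h; nra.
  move=> /eqP; rewrite mulf_eq0 => /orP[/eqP|]; first by lra.
  by rewrite sqrf_eq0 => /eqP; lra.
have : `|s| <= `|pi / 6| := abs_sin_le _.
by rewrite !ger0_norm; lra.
Qed.

Lemma cexp2pi_small tau : 0 < complex.Im tau -> 3 <= 4 * complex.Im tau ^+ 2 -> cmod (e tau) <= 146^-1.
Proof.
move=> t0 t3; rewrite cmod_cexp2pi expRN lef_pV2 ?posrE ?expR_gt0 ?ltr0n //.
have p3 := pi_ge3; set y := complex.Im tau in t0 t3 *.
have y1 : 866 / 1000 <= y by rewrite leNgt; apply/negP => h; nra.
(* Dividing by 64 = 2^6 makes the bound 1 + x <= exp x sharp enough, and six squarings restore the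
   exponent. *)
have h : 3 / 37 <= 2 * pi * y / 64 by nra.
have := expR_ge1Dx (2 * pi * y / 64); set x := _ / 64 in h * => h1.
have -> : 2 * pi * y = x *+ 64 by rewrite -[RHS]mulr_natr /x divfK // pnatr_eq0.
rewrite -[_ *+ 64]mulr_natr expRM_natr; set b := expR x.
(* (1 + 3/37)^64 >= 146, by repeated squaring with rounding down *)
have sq (v w : R) (n : nat) : 0 <= v -> v <= b ^+ n -> w <= v ^+ 2 -> w <= b ^+ (n * 2).
  move=> v0 hv hw; apply: (le_trans hw); rewrite exprM.
  exact: (lerXn2r 2 v0 (le_trans v0 hv) hv).
have h2 : 97 / 83 <= b ^+ (1 * 2) by apply: (sq (40 / 37)); rewrite ?expr1 /b; lra.
have h4 : 127 / 93 <= b ^+ (1 * 2 * 2) by apply: (sq _ _ _ _ h2); lra.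
have h8 : 179 / 96 <= b ^+ (1 * 2 * 2 * 2) by apply: (sq _ _ _ _ h4); lra.
have h16 : 73 / 21 <= b ^+ (1 * 2 * 2 * 2 * 2) by apply: (sq _ _ _ _ h8); lra.
have h32 : 145 / 12 <= b ^+ (1 * 2 * 2 * 2 * 2 * 2) by apply: (sq _ _ _ _ h16); lra.
rewrite -[64%N]/(1 * 2 * 2 * 2 * 2 * 2 * 2)%N.
by apply: (sq _ _ _ _ h32); lra.
Qed.

End Zeros.

Section FundamentalDomain.
Variable R : realType.
Local Notation C := R[i].
Local Notation e := (@cexp2pi R).
Implicit Types (z w tau : C).

Lemma cderiv_uniq (f : C -> C) z l m : cderiv f z l -> cderiv f z m -> l = m.
Proof.
move=> hl hm; apply/eqP; rewrite -subr_eq0 -cmod_eq0 eq_le cmod_ge0 andbT.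
rewrite leNgt; apply/negP => c0; have c1 : 0 < cmod (l - m) / 4 by lra.
have [d d0 h] := hl _ c1; have [d' d0' h'] := hm _ c1.
have M0 : 0 < Num.min d d' by rewrite lt_min d0.
have [t t0 tm] : exists2 t : R, 0 < t & t < Num.min d d'.
  by move: (Num.min d d') M0 => x x0; exists (x / 2); lra.
have ct : cmod t%:C = t by rewrite cmodR gtr0_norm.
have := h t%:C; have := h' t%:C; rewrite !ct; move: tm; rewrite lt_min => /andP[t1 t2].
move=> /(_ t2) a /(_ t1) b.
have := cmodB (f (z + t%:C) - f z - m * t%:C) (f (z + t%:C) - f z - l * t%:C).
rewrite (_ : _ - _ - (_ - _) = (l - m) * t%:C); last by ring.
rewrite cmodM ct => h3; have : cmod (l - m) * t <= cmod (l - m) / 2 * t by lra.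
by rewrite ler_pM2r //; lra.
Qed.

Lemma cnear_Im tau : 0 < complex.Im tau -> cnear (fun w => 0 < complex.Im w) tau.
Proof.
move=> t0; exists (complex.Im tau) => // h ht; rewrite complexImD.
by have := le_lt_trans (Im_le_cmod h) ht; rewrite ltr_norml => /andP[]; lra.
Qed.

Lemma Im_gt0_neq0 tau : 0 < complex.Im tau -> tau != 0.
Proof. by move=> t0; apply/eqP => h; rewrite h ltxx in t0. Qed.

Lemma e4E tau : 0 < complex.Im tau -> e4 tau = E4 tau.
Proof. by move=> t0; rewrite E4_ev. Qed.
Lemma e2E tau : 0 < complex.Im tau -> e2 tau = E2 tau.
Proof. by move=> t0; rewrite E2_ev. Qed.
Lemma e6E tau : 0 < complex.Im tau -> e6 tau = E6 tau.
Proof. by move=> t0; rewrite E6_ev. Qed.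

(* Differentiate E4(-1/tau) = tau^4 E4(tau) and use 3 q dE4/dq = E2 E4 - E6. *)
Lemma E2_inv tau : 0 < complex.Im tau -> E4 tau != 0 ->
  E2 (- tau^-1) = tau ^+ 2 * E2 tau + 12 * tau / twopii R.
Proof.
move=> t0 n0; have T0 := Im_gt0_neq0 t0; have ti := Im_Ninv t0.
have d1 := cderiv_comp (cderivN (cderiv_inv T0)) (cderiv_e4 ti).
have d2 := cderivM (cderivX 4 (@cderiv_id R tau)) (cderiv_e4 t0).
have near : cnear (fun w => w ^+ 4 * e4 w = e4 (- w^-1)) tau.
  have [d d0 hd] := cnear_Im t0; exists d => // h /hd w0.
  by rewrite !e4E ?E4_inv // Im_Ninv.
have := cderiv_uniq d1 (eq_cderiv near d2).
rewrite !e2E // !e4E // !e6E // E4_inv // E6_inv //=.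
have := twopii_neq0 R; move: (twopii R) (E2 (- tau^-1)) (E2 tau) (E4 tau) n0 (E6 tau).
move=> p x y u u0 v p0 h; apply: (mulfI (_ : p * tau ^+ 2 * u != 0)); first by rewrite !mulf_neq0 ?expf_neq0.
transitivity (3 * (p * ((x * (tau ^+ 4 * u) - tau ^+ 6 * v) / 3) * - - tau ^- 2) + p * tau ^+ 4 * v).
  by field.
by rewrite h; field.
Qed.

Definition rho : C := (- 1 / 2) +i* (Num.sqrt 3 / 2).

Lemma sqrt3 : Num.sqrt 3 ^+ 2 = 3 :> R. Proof. by rewrite sqr_sqrtr. Qed.

Lemma Im_rho : 4 * complex.Im rho ^+ 2 = 3.
Proof. by rewrite /= expr_div_n sqrt3; field. Qed.

(** - 1/rho = rho + 1, so the transformation law and periodicity give E4(rho) = rho^4 E4(rho) = rho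
    E4(rho). *)
Lemma E4_rho : E4 rho = 0.
Proof.
have r0 : 0 < complex.Im rho by rewrite /= divr_gt0 // sqrtr_gt0.
have rr : rho ^+ 2 + rho + 1 = 0.
  rewrite expr2; apply: complex_eqP; rewrite !(complexReD, complexImD, complexReM, complexImM) /=.
    by have := sqrt3; rewrite expr2; nra.
  by field.
have R0 := Im_gt0_neq0 r0.
have ri : - rho^-1 = rho + 1.
  apply: (mulfI R0); rewrite mulrN divff // mulrDr mulr1 -expr2.
  by apply/eqP; rewrite eq_sym -addr_eq0 rr.
have := E4_inv r0; rewrite ri /E4 cexp2piD1 -/(E4 rho).
have -> : rho ^+ 4 = rho.
  have -> : rho ^+ 4 = rho + (rho ^+ 2 + rho + 1) * (rho ^+ 2 - rho) by ring.
  by rewrite rr mul0r addr0.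
move=> /eqP; rewrite -subr_eq0 -{1}[E4 rho]mul1r -mulrBl mulf_eq0 => /orP[|/eqP //].
rewrite subr_eq0 => /eqP h; move: rr; rewrite -h expr1n => /eqP.
by rewrite (_ : _ + _ = 3%:R) ?pnatr_eq0 //; ring.
Qed.

(** sigma_k(n) <= n^(k+1) <= n^6 for k <= 5, and heights at least sqrt 3/2 put both nomes in the
    disc of [ev_inj_small]. *)
Lemma sig_eq0_inj k tau tau' : 0 < complex.Im tau -> 0 < complex.Im tau' -> (k <= 5)%N ->
  3 <= 4 * complex.Im tau ^+ 2 -> 3 <= 4 * complex.Im tau' ^+ 2 ->
  lambert k (e tau) = lambert k (e tau') -> e tau = e tau'.
Proof.
move=> t0 t0' k5 t t'; rewrite (lambertE _ (cexp2pi_lt1 t0)) (lambertE _ (cexp2pi_lt1 t0')).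
have b n : cmod (sig C k n) <= n%:R ^+ 6.
  case: n => [|n]; first by rewrite sig_0 cmod0 expr0n.
  by apply: le_trans (sig_cmod_le _ _ _) _; rewrite ler_weXn2l // ler1n.
exact: (ev_inj_small (@rapid_sig R k) (sig_1 C k) b (cexp2pi_small t0 t) (cexp2pi_small t0' t')).
Qed.

Lemma Im_cexp2pi tau tau' : e tau = e tau' -> complex.Im tau = complex.Im tau'.
Proof.
have p0 : 2 * pi != 0 :> R by rewrite mulf_neq0 // gt_eqF // pi_gt0.
by move=> /(congr1 (@cmod R)); rewrite !cmod_cexp2pi => /expR_inj /oppr_inj /(mulfI p0).
Qed.

(** A zero would share its nome with rho, hence have height exactly sqrt 3/2. *)
Lemma E4_neq0_high tau : 0 < complex.Im tau -> 3 < 4 * complex.Im tau ^+ 2 -> E4 tau != 0.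
Proof.
move=> t0 t3; apply/eqP => h.
have r0 : 0 < complex.Im rho by rewrite /= divr_gt0 // sqrtr_gt0.
have : e tau = e rho.
  apply: (@sig_eq0_inj 3 tau rho t0 r0 erefl (ltW t3)); first by rewrite Im_rho.
  by move: h; rewrite -E4_rho /E4 => /addrI; apply: mulfI; rewrite pnatr_eq0.
by move=> /Im_cexp2pi hi; move: t3; rewrite hi Im_rho ltxx.
Qed.

Lemma E6_i : E6 ('i%C : C) = 0.
Proof.
have i0 : 0 < complex.Im ('i%C : C) by [].
have ii : - 'i%C^-1 = 'i%C :> C.
  by apply: (mulfI (Im_gt0_neq0 i0)); rewrite mulrN divff ?(Im_gt0_neq0 i0) // -expr2 sqr_i.
have := E6_inv i0; rewrite ii (exprM _ 2 3) sqr_i => /eqP.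
rewrite -subr_eq0 -{1}[E6 _]mul1r -mulrBl mulf_eq0 => /orP[|/eqP //].
by rewrite (_ : _ - _ = 2%:R) ?pnatr_eq0 //; ring.
Qed.

End FundamentalDomain.

Section F3A.
Variable R : realType.
Local Notation C := R[i].
Local Notation e := (@cexp2pi R).
Implicit Types (z w tau : C).

Lemma ImV (x y : R) : complex.Im (- (x +i* y)^-1) = y / (x ^+ 2 + y ^+ 2).
Proof. by rewrite /= ?mulNr opprK. Qed.

Lemma E2star_inv tau : 0 < complex.Im tau -> E4 tau != 0 ->
  E2star (- tau^-1) = tau ^+ 2 * E2star tau.
Proof.
move=> t0 n0; rewrite /E2star E2_inv //.
(* The correction term of E2 under inversion is exactly what the term 3/(pi Im tau) in [E2star]
   compensates. *)
have : 12 * tau / twopii R = tau ^+ 2 * - (3 / (pi * complex.Im tau))%:C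
    + (3 / (pi * complex.Im (- tau^-1)))%:C; last first.
  by move=> ->; ring.
case: tau t0 {n0} => x y; rewrite ImV /= => y0; have p0 := pi_gt0 R.
have n0 : 0 < x ^+ 2 + y ^+ 2 by rewrite ltr_wpDl ?sqr_ge0 // exprn_gt0.
apply: (mulIf (twopii_neq0 R)); rewrite divfK ?twopii_neq0 // /twopii expr2.
rewrite -(rmorph_nat (real_complex R) 12).
apply: complex_eqP; rewrite !(complexReD, complexImD, complexReM, complexImM, complexReN, complexImN) /=.
  by move: pi p0 => p p0; field; rewrite !gt_eqF.
by move: pi p0 => p p0; field; rewrite !gt_eqF.
Qed.

(** Put N = |tau|^2; since |Re tau| < 1/2, 4 (Im tau)^2 > 4N - 1. This suffices when N >= 1. For 1/3
    < N < 1 the height of - 1/tau is Im tau / N, and 4N - 1 > 3 N^2 because (3N - 1)(1 - N) > 0. *)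
Lemma F3A_high tau : F3A tau ->
  3 < 4 * complex.Im tau ^+ 2 \/ 3 < 4 * complex.Im (- tau^-1) ^+ 2.
Proof.
move=> [t0 h1 h2]; have hN : 1 / 3 < cmod tau ^+ 2.
  have t3 : (3^-1)%:C = 3^-1 :> C by rewrite fmorphV /= rmorph_nat.
  by move: h1; rewrite normcE_cmod -rmorphXn /= !div1r -t3 ltcR.
have hx : 4 * complex.Re tau ^+ 2 < 1.
  have := normr_ge0 (complex.Re tau); move: h2; rewrite -real_normK ?num_real //; nra.
move: hN hx t0; rewrite cmod_sqr; case: tau {h1 h2} => x y; rewrite ImV /= => hN hx y0.
set N := x ^+ 2 + y ^+ 2 in hN *; have yN : 4 * y ^+ 2 = 4 * N - 4 * x ^+ 2 by rewrite /N; ring.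
have [h|h] := leP 1 N; [left; lra | right].
have N0 : 0 < N by lra.
rewrite expr_div_n mulrA ltr_pdivlMr ?exprn_gt0 // yN expr2; nra.
Qed.

Lemma F3A_Im tau : F3A tau -> 0 < complex.Im tau. Proof. by case. Qed.

Lemma E4_neq0_F3A tau : F3A tau -> E4 tau != 0.
Proof.
move=> ht; have t0 := F3A_Im ht; have [h|h] := F3A_high ht; first exact: E4_neq0_high.
have := E4_neq0_high (Im_Ninv t0) h; rewrite E4_inv //.
by apply: contra => /eqP ->; rewrite mulr0.
Qed.

Lemma E2star_i : E2star ('i%C : C) = 0.
Proof.
have i0 : 0 < complex.Im ('i%C : C) by [].
have h4 : E4 ('i%C : C) != 0 by apply: (E4_neq0_high i0); rewrite /= expr1n; lra.
have ii : - 'i%C^-1 = 'i%C :> C.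
  by apply: (mulfI (Im_gt0_neq0 i0)); rewrite mulrN divff ?(Im_gt0_neq0 i0) // -expr2 sqr_i.
have := E2star_inv i0 h4; rewrite ii sqr_i mulN1r => /eqP.
by rewrite -addr_eq0 -mulr2n mulrn_eq0 => /eqP.
Qed.

(** Such a zero has the nome of i, and equal nomes give equal E2 and equal imaginary parts; [E2star]
    vanishes at the fixed point i. *)
Lemma E2star_eq0_high tau : 0 < complex.Im tau -> 3 < 4 * complex.Im tau ^+ 2 ->
  E6 tau = 0 -> E2star tau = 0.
Proof.
move=> t0 t3 h; have i0 : 0 < complex.Im ('i%C : C) by [].
have i3 : 3 <= 4 * complex.Im ('i%C : C) ^+ 2 by rewrite /= expr1n; lra.
have et : e tau = e 'i%C.
  apply: (@sig_eq0_inj R 5 tau 'i%C t0 i0 erefl (ltW t3) i3).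
  by move: h; rewrite -(E6_i R) /E6 => /addrI /oppr_inj; apply: mulfI; rewrite pnatr_eq0.
by rewrite -E2star_i /E2star /E2 et (Im_cexp2pi et).
Qed.

Lemma E2star_eq0_F3A tau : F3A tau -> E6 tau = 0 -> E2star tau = 0.
Proof.
move=> ht h6; have t0 := F3A_Im ht; have [h|h] := F3A_high ht; first exact: E2star_eq0_high.
have := E2star_eq0_high (Im_Ninv t0) h; rewrite E6_inv // h6 mulr0 => /(_ erefl).
rewrite (E2star_inv t0 (E4_neq0_F3A ht)) => /eqP.
by rewrite mulf_eq0 expf_eq0 (negbTE (Im_gt0_neq0 t0)) andbF => /eqP.
Qed.
End F3A.

(** * The hypergeometric equation *)

Section Hypergeometric.
Variable R : realType.
Local Notation C := R[i].
Implicit Types (z w tau : C).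

Definition fF : fps C := fun n =>
  pochhammer (1 / 6) n * pochhammer (1 / 3) n / (pochhammer 1 n * n`!%:R).

Lemma pochhammerS (a : C) n : pochhammer a n.+1 = pochhammer a n * (a + n%:R).
Proof. by rewrite /pochhammer big_ord_recr. Qed.

Lemma pochhammer1 n : pochhammer (1 : C) n = n`!%:R.
Proof.
elim: n => [|n ih]; first by rewrite /pochhammer big_ord0.
by rewrite pochhammerS ih addrC natr1 factS natrM mulrC.
Qed.

(** The ratio of consecutive coefficients is (n + 1/6)(n + 1/3)/(n + 1)^2; the factor 18 clears
    denominators. *)
Lemma fF_S n : 18 * (n.+1%:R ^+ 2 * fF n.+1) = (18 * n%:R ^+ 2 + 9 * n%:R + 1) * fF n.
Proof.
rewrite /fF !pochhammer1 !pochhammerS factS natrM -(natr1 n).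
have : n`!%:R != 0 :> C by rewrite pnatr_eq0 -lt0n fact_gt0.
have : n%:R + 1 != 0 :> C by rewrite natr1 pnatr_eq0.
move: (n`!%:R) (pochhammer _ n) (pochhammer _ n) (n%:R) => f A B x x0 f0.
by field; apply/andP.
Qed.

Lemma cmod_fF n : cmod (fF n) <= 1.
Proof.
have b (k : nat) : (0 < k)%N -> cmod (pochhammer (1 / k%:R : C) n) <= n`!%:R.
  move=> k0; elim: n => [|n ih]; first by rewrite /pochhammer big_ord0 cmod1.
  rewrite pochhammerS cmodM factS natrM mulrC ler_pM ?cmod_ge0 //.
  apply: le_trans (cmodD _ _) _; rewrite cmod_nat -natr1 addrC lerD2l.
  by rewrite div1r cmodV cmod_nat invf_le1 ?ltr0n // ler1n.
have f0 : 0 < n`!%:R :> R by rewrite ltr0n fact_gt0.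
rewrite /fF pochhammer1 cmodM cmodV cmodM (cmodM n`!%:R) cmod_nat ler_pdivrMr ?mulr_gt0 // [leRHS]mul1r.
exact: ler_pM (cmod_ge0 _) (cmod_ge0 _) (b 6 erefl) (b 3 erefl).
Qed.

Lemma rapid_fF : rapid fF.
Proof. by apply: (@rapid_poly _ _ 0) => n; rewrite expr0 cmod_fF. Qed.

Lemma hyp2F1_ev z : cmod z < 1 -> hyp2F1 (1 / 6) (1 / 3) 1 z = ev fF z.
Proof.
move=> z1; apply: clim_lim; apply: eq_clim (dominated_csums (rapid_dominated rapid_fF z1)).
by exists 0%N => n _; rewrite big_mkord.
Qed.

Lemma fF_ode : 18%:R * dq (dq fF) = (18%:R * dq (dq fF) + 9%:R * dq fF + fF) * fX C.
Proof.
apply/funext => -[|n]; rewrite fpsMX !(fpsMn, fpsD) /dq ?mul0r ?mulr0 //.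
by rewrite [n.+1%:R * (_ * _)]mulrA -expr2 fF_S; ring.
Qed.

Lemma ev_fF_ode z : cmod z < 1 ->
  18 * ev (dq (dq fF)) z = (18 * ev (dq (dq fF)) z + 9 * ev (dq fF) z + ev fF z) * z.
Proof.
move=> z1; have r0 := rapid_fF; have r1 := rapid_dq r0; have r2 := rapid_dq r1.
have m2 := rapidMn 18 r2; have m1 := rapidMn 9 r1.
have := congr1 (fun f => ev f z) fF_ode.
rewrite (evM (rapidD (rapidD m2 m1) r0) (@rapid_fX R) z1) (evD (rapidD m2 m1) r0 z1) (evD m2 m1 z1).
by rewrite (evMn _ r2 z1) (evMn _ r1 z1) ev_fX.
Qed.

Definition mx tau : C := 4 * ms tau / (1 + ms tau) ^+ 2.
(** The rational square root of 1 - x given by the parametrisation through s; it is the factor in D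
    x = x a^2 v. *)
Definition mv tau : C := (1 - ms tau) / (1 + ms tau).
(* (1/2 pi i) d/dtau of ma *)
Definition mda tau : C := 12^-1 * (ma tau * e2 tau - 4 * mb tau + 3 * ma tau ^+ 3).

(* invw_disc without the geometric conditions and without the junk value
   1/w = 0 at w = 0; an open condition *)
Definition good tau := [/\ 0 < complex.Im tau, 1 + ms tau != 0 & cmod (mx tau) < 1].

Definition hF k tau : C := ev (iter k (@dq C) fF) (mx tau).

Definition mk tau : C := hF 0 tau / ma tau.
(* (1/2 pi i) d/dtau of mk; its derivative vanishes by the hypergeometric equation *)
Definition mdk tau : C := hF 1 tau * ma tau * mv tau - hF 0 tau * mda tau / ma tau ^+ 2.

Lemma cderiv_eq f z (l m : C) : cderiv f z l -> l = m -> cderiv f z m.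
Proof. by move=> h <-. Qed.

Section AtPoint.
Variable tau : C.
Hypothesis ht : good tau.
Let t0 : 0 < complex.Im tau. Proof. by case: ht. Qed.
Let s1 : 1 + ms tau != 0. Proof. by case: ht. Qed.
Let x1 : cmod (mx tau) < 1. Proof. by case: ht. Qed.
Let s0 : ms tau != 0. Proof. exact: ms_neq0. Qed.
Local Notation p := (twopii R).

Lemma ma_neq0 : ma tau != 0.
Proof.
have h : ma tau ^+ 3 != 0 by rewrite (ma_cube t0) mulf_neq0 // mb_neq0.
by apply: contra h => /eqP ->; rewrite expr0n.
Qed.

Lemma mx_neq0 : mx tau != 0.
Proof. by rewrite /mx mulf_neq0 ?invr_eq0 ?expf_neq0 // mulf_neq0 ?pnatr_eq0. Qed.

Lemma mx_mv : 1 - mx tau = mv tau ^+ 2.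
Proof. by rewrite /mx /mv; move: (ms tau) s1 => s h; field. Qed.

Lemma ms_neq1 : 1 - ms tau != 0.
Proof.
apply/eqP => h; have := mx_mv; rewrite /mv h mul0r expr0n /= => /eqP.
by rewrite subr_eq0 => /eqP e; move: x1; rewrite -e cmod1 ltxx.
Qed.

Lemma cderiv_mx : cderiv mx tau (p * (mx tau * ma tau ^+ 2 * mv tau)).
Proof.
have ds := cderiv_ms t0; have d1 := cderivD (cderiv_cst 1 tau) ds.
have s2 : (1 + ms tau) ^+ 2 != 0 by rewrite expf_neq0.
apply: cderiv_eq (@cderiv_div R (fun w => 4 * ms w) (fun w => (1 + ms w) ^+ 2) tau _ _ s2 (cderivMl 4 ds) (cderivX 2 d1)) _.
by rewrite /mx /mv; move: (ms tau) (ma tau) p s1 => s a t h; rewrite /= expr1; field.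
Qed.

Lemma cderiv_mv : cderiv mv tau (- (p * (mx tau * ma tau ^+ 2 / 2))).
Proof.
have ds := cderiv_ms t0; have d1 := cderivD (cderiv_cst 1 tau) ds.
have d2 := cderivB (cderiv_cst 1 tau) ds.
apply: cderiv_eq (@cderiv_div R (fun w => 1 - ms w) (fun w => 1 + ms w) tau _ _ s1 d2 d1) _.
by rewrite /mx /mv; move: (ms tau) (ma tau) p s1 => s a t h; field.
Qed.

Lemma cderiv_hF k : cderiv (hF k) tau (p * (hF k.+1 tau * ma tau ^+ 2 * mv tau)).
Proof.
have r : rapid (iter k (@dq C) fF) by elim: k => [|k ih]; [exact: rapid_fF | exact: rapid_dq].
apply: cderiv_eq (cderiv_comp cderiv_mx (cderiv_ev r mx_neq0 x1)) _.
rewrite -[ev (dq _) _]/(hF k.+1 tau).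
move: (hF k.+1 tau) (ma tau) (mv tau) (mx tau) mx_neq0 p => y a v x h t.
by field.
Qed.

Lemma cderiv_ma' : cderiv (@ma R) tau (p * mda tau).
Proof. by apply: cderiv_eq (cderiv_ma t0) _; rewrite /mda [_ / 12]mulrC. Qed.

Lemma cderiv_mk : cderiv mk tau (p * mdk tau).
Proof.
apply: cderiv_eq (@cderiv_div R (hF 0) (@ma R) tau _ _ ma_neq0 (cderiv_hF 0) cderiv_ma') _.
rewrite /mdk; move: (hF 1 tau) (hF 0 tau) (ma tau) ma_neq0 (mda tau) (mv tau) p => y z a a0 d v t.
by field.
Qed.

Lemma cderiv_mdk : cderiv mdk tau 0.
Proof.
have da := cderiv_ma'.
have dA := cderivMl 12^-1 (cderivD (cderivB (cderivM da (cderiv_e2 t0)) (cderivMl 4 (cderiv_mb t0)))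
  (cderivMl 3 (cderivX 3 da))).
have a2 : ma tau ^+ 2 != 0 by rewrite expf_neq0 // ma_neq0.
have d1 := cderivM (cderivM (cderiv_hF 1) da) cderiv_mv.
have d2 := @cderiv_div R (fun w => hF 0 w * mda w) (fun w => ma w ^+ 2) tau _ _ a2
  (cderivM (cderiv_hF 0) dA) (cderivX 2 da).
apply: cderiv_eq (cderivB d1 d2) _.
have ode := ev_fF_ode x1; rewrite -[ev (dq (dq fF)) _]/(hF 2 tau) -[ev (dq fF) _]/(hF 1 tau) -[ev fF _]/(hF 0 tau) in ode.
rewrite (e4_ab t0); have := ma_cube t0 => /esym hb.
have {}hb : mb tau = ma tau ^+ 3 / (1 + ms tau) by rewrite -hb mulfK.
rewrite /mda hb /mv; rewrite /mx in ode *.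
move: (hF 2 tau) (hF 1 tau) (hF 0 tau) (ma tau) ma_neq0 (ms tau) s1 (e2 tau) p ode => P2 P1 P0 a a0 s s1' y t ode.
(* After b is replaced by a^3/(1 + s) all terms in E2 cancel, and what is left is a multiple of the
   hypergeometric equation at x. *)
transitivity (t * a ^+ 3 / 18 * (18 * P2 - (18 * P2 + 9 * P1 + P0) * (4 * s / (1 + s) ^+ 2))).
  by rewrite /=; field; apply/andP.
by rewrite -ode subrr mulr0.
Qed.
End AtPoint.
End Hypergeometric.

(** * Propagation along the component that reaches the cusp *)

Section Component.
Variable R : realType.
Local Notation C := R[i].
Local Notation e := (@cexp2pi R).
Implicit Types (z w tau : C).

(** If s = - 1 then w = 0, and the convention 1/0 = 0 would put tau inside the disc. But s = - 1
    forces a^3 = 0, hence E4 = 0, which does not happen in [F3A]. *)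
Lemma invw_disc_good tau : invw_disc tau -> good tau.
Proof.
move=> [ht hx]; have t0 := F3A_Im ht; have s0 := ms_neq0 t0.
have s1 : 1 + ms tau != 0.
  apply/eqP => h; have := E4_neq0_F3A ht; rewrite -e4E // (e4_ab t0).
  have := ma_cube t0; rewrite h mulr0 => /eqP; rewrite expf_eq0 /= => /eqP ->.
  by rewrite expr0n mul0r !mulr0 subrr eqxx.
split=> //; move: hx; rewrite w3_ms // div1r invf_div -/(mx tau) normcE_cmod.
by rewrite -[1 in X in _ < X -> _]/(1%:C) ltcR.
Qed.

Lemma good_near z : good z -> cnear (@good R) z.
Proof.
move=> hz; have [t0 s1 x1] := hz.
have cs : ccont (fun w => 1 + ms w) z := cderiv_cont (cderivD (cderiv_cst 1 z) (cderiv_ms t0)).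
have cx := cderiv_cont (cderiv_mx hz).
have [d d0 hd] := cnear_and (cnear_Im t0) (cnear_and (ccont_neq0 cs s1) (ccont_cmod_lt cx x1)).
exists d; first exact: d0.
by move=> h /hd[p1 [p2 p3]]; split; [exact: p1 | exact: p2 | exact: p3].
Qed.

Lemma cnear_sub (P Q : C -> Prop) z : (forall w, P w -> Q w) -> cnear P z -> cnear Q z.
Proof. by move=> PQ [d d0 hd]; exists d => // h /hd /PQ. Qed.

Lemma cderiv0_near (f : C -> C) z : cnear (fun w => cderiv f w 0) z ->
  cnear (fun w => f w = f z) z.
Proof.
move=> [d d0 hd]; exists d => // h hh; apply: cderiv0_const => t /andP[u0 u1].
rewrite addrAC subrr add0r; apply: hd; rewrite cmodM cmodR ger0_norm //.
by apply: le_lt_trans hh; rewrite ler_piMl ?cmod_ge0.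
Qed.

Lemma cnear_open (P : C -> Prop) : (forall z, P z -> cnear P z) -> open ([set z | P z] : set C^o).
Proof.
move=> hP; rewrite openE => z /hP[d d0 hd]; apply/nbhs_ballP.
exists d%:C; first by rewrite /= ltcR.
move=> w; rewrite -ball_normE /= normcE_cmod ltcR cmodBC => /hd.
by rewrite addrC subrK.
Qed.

(** A property that is locally constant on the open set [good] cuts out an open and closed part of
    any connected subset of [invw_disc]. *)
Lemma component_spread (P : C -> Prop) tau z :
  (forall w, good w -> cnear (fun w' => P w' <-> P w) w) ->
  connected_component (@invw_disc R) tau z -> P tau -> P z.
Proof.
move=> hP [B [Bt BD Bc] Bz] Pt.
have oU : open ([set w | good w /\ P w] : set C^o).
  apply: cnear_open => w [gw Pw].
  by apply: cnear_sub (cnear_and (good_near gw) (hP _ gw)) => w' [? h]; split=> //; apply/h.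
have oV : open ([set w | good w /\ ~ P w] : set C^o).
  apply: cnear_open => w [gw Pw].
  by apply: cnear_sub (cnear_and (good_near gw) (hP _ gw)) => w' [? h]; split=> // /h.
have Bg w : B w -> good w by move=> /BD /invw_disc_good.
have e1 : B `&` [set w | good w /\ P w] = B.
  apply: Bc.
  - by exists tau; split=> //; split=> //; exact: Bg.
  - by exists [set w | good w /\ P w].
  - exists (~` [set w | good w /\ ~ P w]); first exact: open_closedC.
    apply/seteqP; split=> w [Bw] h; split=> //.
      by move=> [_]; apply; case: h.
    split; first exact: Bg.
    by apply: contrapT => nP; apply: h; split=> //; exact: Bg.
by move: Bz; rewrite -e1 => -[_ []].
Qed.

Lemma mdk_near z : good z -> cnear (fun w => mdk w = mdk z) z.
Proof.
by move=> gz; apply: cderiv0_near; apply: cnear_sub (good_near gz) => w; exact: cderiv_mdk.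
Qed.

Lemma mdk_component tau z : connected_component (@invw_disc R) tau z -> mdk z = mdk tau.
Proof.
move=> h; apply: (component_spread (P := fun w => mdk w = mdk tau) _ h) => // w gw.
by apply: cnear_sub (mdk_near gw) => w' ->.
Qed.

Lemma mk_component tau z : connected_component (@invw_disc R) tau z ->
  mdk tau = 0 -> mk z = mk tau.
Proof.
move=> h m0; suff [] : mdk z = 0 /\ mk z = mk tau by [].
apply: (component_spread (P := fun w => mdk w = 0 /\ mk w = mk tau) _ h) => // w gw.
(* [mk] is locally constant only where [mdk] is 0. Elsewhere the conjunction fails at w and at all
   nearby points, so it is still locally constant. *)
have hn := mdk_near gw; have [w0|w0] := eqVneq (mdk w) 0; last first.
  apply: cnear_sub hn => w' e1; split=> -[e2 _]; move: w0; first by rewrite -e1 e2 eqxx.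
  by rewrite e2 eqxx.
have hk : cnear (fun w' => mk w' = mk w) w.
  apply: cderiv0_near; apply: cnear_sub (cnear_and (good_near gw) hn) => w' [g' e1].
  by have := cderiv_mk g'; rewrite e1 w0 mulr0.
apply: cnear_sub (cnear_and hn hk) => w' [-> ->]; by [].
Qed.

Lemma fa_0 : fa C 0%N = 1.
Proof.
have h : fb3i C 0%N = 1 by rewrite /fb3i fpsM0 !fpsX0 fps_sub_0 !expr1n mulr1.
by rewrite /fa fpsM0 h /fB fpsD fpsB !fpsMn fps_sub_0 sig_0 fps1 /=; ring.
Qed.

Lemma fb3_0 : fb3 C 0%N = 1.
Proof. by rewrite /fb3 fpsM0 !fpsX0 fps_sub_0 !expr1n mulr1. Qed.

Lemma fs_0 : fs C 0%N = 0.
Proof. by rewrite /fs fpsM0 fpsMn [fX C 0%N]/(0) mulr0 mul0r. Qed.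

Lemma fE2_0 : fE2 C 0%N = 1.
Proof. by rewrite /fE2 fpsB fpsMn sig_0 fps1 mulr0 subr0. Qed.

Lemma fF_0 : fF R 0%N = 1.
Proof. by rewrite /fF /pochhammer !big_ord0 fact0 !mul1r invr1. Qed.

Lemma cexp2pi_cusp (zn : nat -> C) : (forall n : nat, n%:R < complex.Im (zn n)) ->
  clim (fun n => e (zn n)) 0.
Proof.
move=> hz ep ep0; have [n0 h0] := harmonic_small ep0; exists n0 => n /h0; apply: le_lt_trans.
rewrite subr0 cmod_cexp2pi expRN lef_pV2 ?posrE ?expR_gt0 ?ltr0n //.
apply: le_trans (expR_ge1Dx _); rewrite -natr1 addrC lerD2l.
have := hz n; have := pi_ge2 R; have : 0 <= n%:R :> R by []; nra.
Qed.

Lemma mk_mdk_cusp (zn : nat -> C) : (forall n : nat, n%:R < complex.Im (zn n)) ->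
  clim (fun n => mk (zn n)) 1 /\ clim (fun n => mdk (zn n)) 0.
Proof.
move=> /cexp2pi_cusp hq; have c0 : cmod (0 : C) < 1 by rewrite cmod0.
have la := ev_clim (@rapid_fa R) c0 hq; have lb := ev_clim (@rapid_fb3 R) c0 hq.
have ls := ev_clim (@rapid_fs R) c0 hq; have l2 := ev_clim (@rapid_fE2 R) c0 hq.
rewrite !ev_at0 ?fa_0 ?fb3_0 ?fs_0 ?fE2_0 in la lb ls l2.
have l1 := climD (clim_cst 1) ls; rewrite addr0 in l1.
have n1 : 1 != 0 :> C := oner_neq0 _.
have n1' : 1 ^+ 2 != 0 :> C by rewrite expf_neq0.
have lx : clim (fun n => mx (zn n)) 0.
  have := climM (climMl 4 ls) (climV n1' (climX 2 l1)); rewrite mulr0 mul0r; exact.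
have lv : clim (fun n => mv (zn n)) 1.
  have := climM (climB (clim_cst 1) ls) (climV n1 l1); rewrite subr0 invr1 mulr1; exact.
have l0 : clim (fun n => hF 0 (zn n)) 1.
  by have := ev_clim (@rapid_fF R) c0 lx; rewrite ev_at0 fF_0.
have lF1 : clim (fun n => hF 1 (zn n)) 0.
  by have := ev_clim (rapid_dq (@rapid_fF R)) c0 lx; rewrite ev_at0 /dq mul0r.
(* At q = 0 the series a, b and E2 are 1, and (1 - 4 + 3)/12 = 0. *)
have lA : clim (fun n => mda (zn n)) 0.
  have := climMl 12^-1 (climD (climB (climM la l2) (climMl 4 lb)) (climMl 3 (climX 3 la))).
  rewrite (_ : 12^-1 * _ = 0); last by ring.
  exact.
split.
  by have := climM l0 (climV n1 la); rewrite invr1 mulr1.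
have := climB (climM (climM lF1 la) lv) (climM (climM l0 lA) (climV n1' (climX 2 la))).
by rewrite !mulr0 !mul0r subr0.
Qed.

Lemma component_values tau : C_invw_oo tau -> [/\ invw_disc tau, mk tau = 1 & mdk tau = 0].
Proof.
move=> h; have [z0 hz0 _] := h 0.
have ht : invw_disc tau by case: hz0 => B [Bt BD _] _; exact: BD.
have [zn hzn] : exists zn : nat -> C, forall n,
    connected_component (@invw_disc R) tau (zn n) /\ n%:R < complex.Im (zn n).
  have /choice[zn hzn] : forall n : nat, exists z : C,
      connected_component (@invw_disc R) tau z /\ n%:R < complex.Im z.
    by move=> n; have [z h1 h2] := h n%:R; exists z.
  by exists zn.
have [lk lm] := mk_mdk_cusp (fun n => (hzn n).2).
have m0 : mdk tau = 0.
  apply: (clim_uniq _ lm); apply: eq_clim (clim_cst _); exists 0%N => n _.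
  by rewrite (mdk_component (hzn n).1).
split=> //; apply: (clim_uniq _ lk); apply: eq_clim (clim_cst _); exists 0%N => n _.
by rewrite (mk_component (hzn n).1 m0).
Qed.
End Component.

(** * The closing algebra *)

Section Final.
Variable R : realType.
Local Notation C := R[i].

(** With x = 1/w the operator w d/dw is - x d/dx, which on power series is - D. *)
Lemma derive_hyp_sqr (w : C) : w != 0 -> cmod w^-1 < 1 ->
  w * derive1 ((fun x => hyp2F1 (1 / 6) (1 / 3) 1 (1 / x) ^+ 2) : C^o -> C^o) w =
  - (2 * ev (fF R) w^-1 * ev (dq (fF R)) w^-1).
Proof.
move=> w0 w1; have wi : w^-1 != 0 by rewrite invr_eq0.
have d := cderivX 2 (cderiv_comp (cderiv_inv w0) (cderiv_ev (@rapid_fF R) wi w1)).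
have near : cnear (fun x => ev (fF R) x^-1 ^+ 2 = hyp2F1 (1 / 6) (1 / 3) 1 (1 / x) ^+ 2) w.
  have [dl d0 hd] := ccont_cmod_lt (cderiv_cont (cderiv_inv w0)) w1.
  by exists dl; [exact: d0 | move=> h /hd hh; rewrite (div1r (w + h)) hyp2F1_ev].
rewrite (cderiv_derive1 (eq_cderiv near d)).
move: (ev (fF R) w^-1) (ev (dq (fF R)) w^-1) => x y; rewrite /= expr1.
by field.
Qed.

(** Here x stands for E2, y for 1/(2 pi Im tau), E for [E2star] and P1 for DF at 1/w; the last
    hypothesis is [mdk] = 0 with F = a inserted. *)
Lemma level3_identity (F : numFieldType) (a b s x y P1 u e4 e6 E : F) :
  a != 0 -> s != 0 -> 1 + s != 0 -> 1 - s != 0 -> a ^+ 3 = b * (1 + s) ->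
  e4 = 9 * a ^+ 4 - 8 * (a * b) -> e6 = 36 * a ^+ 3 * b - 27 * a ^+ 6 - 8 * b ^+ 2 ->
  u = - s^-1 -> e4 != 0 -> (e6 = 0 -> E = 0) -> E = x - 6 * y ->
  P1 * a * ((1 - s) / (1 + s)) = 12^-1 * (a * x - 4 * b + 3 * a ^+ 3) / a ->
  a ^+ 2 / 6 * ((u + 3) / (u + 1) - (u ^+ 2 + 18 * u - 27) / ((u - 9) * (u + 1)) * (e4 / e6 * E))
    + 2 * a * P1 = y * ((u - 1) / (u + 1)).
Proof.
move=> a0 s0 s1 sn1 /esym hb e4E e6E uE e40 E0 Ey hP.
have {}hb : b = a ^+ 3 / (1 + s) by rewrite -hb mulfK.
have e4s : e4 = a ^+ 4 * (1 + 9 * s) / (1 + s) by rewrite e4E hb; field.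
have s9 : 1 + 9 * s != 0 by apply: contra e40 => /eqP h; rewrite e4s h mulr0 mul0r.
pose K := 1 - 18 * s - 27 * s ^+ 2.
have e6s : e6 = a ^+ 6 * K / (1 + s) ^+ 2 by rewrite e6E hb /K; field.
have u1E : u + 1 = - (1 - s) / s by rewrite uE; field.
have u9E : u - 9 = - (1 + 9 * s) / s by rewrite uE; field.
(* K is the common factor: u^2 + 18u - 27 = K/s^2 and E6 = a^6 K/(1 + s)^2, while u - 9 and E4 share
   1 + 9s. If E6 = 0 both sides vanish, because then E = 0. *)
have hE : (u ^+ 2 + 18 * u - 27) / ((u - 9) * (u + 1)) * (e4 / e6 * E) = (1 + s) / (a ^+ 2 * (1 - s)) * E.
  have [/E0 ->|e60] := eqVneq e6 0; first by rewrite !mulr0.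
  have K0 : K != 0 by apply: contra e60 => /eqP h; rewrite e6s h mulr0 mul0r.
  have uK : u ^+ 2 + 18 * u - 27 = K / s ^+ 2 by rewrite uE /K; field.
  rewrite uK u9E u1E e4s e6s; move: (K) K0 => k k0.
  by field; rewrite k0 a0 s0 s1 sn1 s9.
have {}hP : P1 = 12^-1 * (a * x - 4 * b + 3 * a ^+ 3) * (1 + s) / (a ^+ 2 * (1 - s)).
  have v0 : a * ((1 - s) / (1 + s)) != 0 by rewrite !mulf_neq0 ?invr_eq0.
  by apply: (mulIf v0); rewrite mulrA hP; field; rewrite a0 sn1 s1.
by rewrite hE hP Ey hb u1E uE; field; rewrite a0 s0 s1 sn1.
Qed.

Lemma value_identity (tau : C) : invw_disc tau -> mk tau = 1 -> mdk tau = 0 ->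
  let u := u3 tau in let w := w3 tau in let F2 := hyp2F1 (1 / 6) (1 / 3) 1 (1 / w) ^+ 2 in
  F2 / 6 * ((u + 3) / (u + 1) - (u ^+ 2 + 18 * u - 27) / ((u - 9) * (u + 1)) * s2 tau)
    + 2 * ev (fF R) w^-1 * ev (dq (fF R)) w^-1
  = (1 / (2 * pi * complex.Im tau))%:C * ((u - 1) / (u + 1)).
Proof.
move=> ht hk hm u w F2; have gt := invw_disc_good ht; have [t0 s1 x1] := gt.
have a0 := ma_neq0 gt.
have wx : w^-1 = mx tau by rewrite /w (w3_ms t0) invf_div.
have h0 : hF 0 tau = ma tau by move: hk; rewrite /mk => /(canRL (divfK a0)); rewrite mul1r.
have y0 : (3 / (pi * complex.Im tau))%:C = 6 * (1 / (2 * pi * complex.Im tau))%:C :> C.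
  rewrite -(rmorph_nat (real_complex R) 6) -rmorphM; congr (_%:C).
  move: (complex.Im tau) (lt0r_neq0 t0) (pi : R) (lt0r_neq0 (pi_gt0 R)) => y y0 p p0.
  by clear - y0 p0; field; apply/andP.
rewrite /F2 (div1r w) wx (hyp2F1_ev x1) -[ev (fF R) _]/(hF 0 tau) -[ev (dq (fF R)) _]/(hF 1 tau) h0 /s2.
apply: (@level3_identity _ _ (mb tau) _ (E2 tau) _ _ _ _ _ _ a0 (ms_neq0 t0) s1 (ms_neq1 gt) (ma_cube t0) _ _ (u3_ms t0) (E4_neq0_F3A (proj1 ht))
  (E2star_eq0_F3A (proj1 ht))).
- by rewrite -(e4E t0) (e4_ab t0).
- by rewrite -(e6E t0) (e6_ab t0).
- by rewrite /E2star -y0.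
rewrite -/(mv tau) -(e2E t0) -/(mda tau).
move: hm; rewrite /mdk h0 => /eqP; rewrite subr_eq0 => /eqP ->.
by move: (ma tau) a0 (mda tau) => a a0 y; field.
Qed.
End Final.

Theorem mainTheorem16 (R : realType) (a b c d : int) (tau : R[i])
    (a_gt0 : 0 < a)
    (abc_coprime : gcdz (gcdz a b) c = 1)
    (d_def : - d = b ^+ 2 - 4 * a * c)
    (tau_def : tau = ((- b%:~R) +i* Num.sqrt d%:~R) / (2 * a%:~R))
    (tau_root : a%:~R * tau ^+ 2 + b%:~R * tau + c%:~R = 0)
    (tau_C : C_invw_oo tau) :
  let u := u3 tau in
  let w := w3 tau in
  let F2 : R[i]^o -> R[i]^o :=
    fun x => hyp2F1 (1 / 6) (1 / 3) 1 (1 / x) ^+ 2 in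
  F2 w / 6 * ((u + 3) / (u + 1)
              - (u ^+ 2 + 18 * u - 27) / ((u - 9) * (u + 1)) * s2 tau)
    - w * derive1 F2 w
  = (a%:~R / (pi * Num.sqrt d%:~R))%:C * ((u - 1) / (u + 1)).
Proof.
have [ht hk hm] := component_values tau_C; move=> u w F2.
have gt := invw_disc_good ht; have [t0 s1 x1] := gt.
have w0 : w != 0.
  by rewrite /w w3_ms // mulf_neq0 ?invr_eq0 ?expf_neq0 // mulf_neq0 ?ms_neq0 // pnatr_eq0.
have w1 : cmod w^-1 < 1 by rewrite /w w3_ms // invf_div.
rewrite (@derive_hyp_sqr R w w0 w1) opprK (@value_identity R tau ht hk hm); congr (_%:C * _).
have iE : complex.Im tau = Num.sqrt d%:~R / (2 * a%:~R).
  have e2a : 2 * a%:~R = (2 * a%:~R)%:C :> R[i] by rewrite rmorphM /= rmorph_nat rmorph_int.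
  by rewrite tau_def e2a -fmorphV complexImM /= mulr0 add0r.
have a0 : a%:~R != 0 :> R by rewrite intr_eq0 gt_eqF.
have p0 : pi != 0 :> R by rewrite gt_eqF // pi_gt0.
(* The real square root is 0 on nonpositive numbers; that case is excluded because it would give Im
   tau = 0. *)
move: t0; rewrite iE; have [->|q0] := eqVneq (Num.sqrt d%:~R : R) 0; first by rewrite mul0r ltxx.
by move=> _; move: pi p0 (Num.sqrt _) q0 (a%:~R) a0 => p p0 q q0 y y0; field; rewrite p0 q0 y0.
Qed.
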